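(* Let $m\geq 2$ and let $U\subseteq\mathbf{R}^{2m}$ be any connected open subset. Then $U$ has a harmonic hull, and the harmonic hull of $U$ is the set $\tilde{U}$.
   Context: Regard $\mathbf{R}^n$ as the real part of $\mathbf{C}^n$ and write $\langle z,w\rangle=\sum_{i=1}^n z_iw_i$ for the complex bilinear form on $\mathbf{C}^n$ extending the Euclidean inner product. A harmonic function on an open set $U\subseteq\mathbf{R}^n$ is a (complex-valued) solution $u$ of Laplace's equation $\Delta u=\sum_{i=1}^n\partial^2u/\partial x_i^2=0$ on $U$. For $z\in\mathbf{C}^n$, the isotropic cone through $z$ is $V(z)=\{w\in\mathbf{C}^n:\langle w-z,w-z\rangle=0\}$. For $U$ a (nonempty) connected open subset of $\mathbf{R}^n$, $\tilde{U}$ denotes the connected component of $\mathbf{C}^n\setminus\bigcup_{x\in\mathbf{R}^n\setminus U}V(x)$ containing $U$. Harmonic hull: consider the connected open subsets $W\subseteq\mathbf{C}^n$ containing $U$ such that every harmonic function on $U$ extends to a holomorphic function on $W$. If there is a maximal such $W$ (that is, one containing all the other such sets), it is called the harmonic hull of $U$. *)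

(* Defs.v *)
From HB Require Import structures.
From mathcomp Require Import all_boot all_order all_algebra.
From mathcomp Require Import all_classical all_reals all_analysis.
From mathcomp Require Import complex.

Set Implicit Arguments.
Unset Strict Implicit.
Unset Printing Implicit Defensive.
Import Order.TTheory GRing.Theory Num.Theory.
Import numFieldNormedType.Exports.

Local Open Scope classical_set_scope.
Local Open Scope ring_scope.

(* The complex numbers as an abstract numFieldType, so that C and C^n receive
   the topology and norm that MathComp-Analysis puts on every numFieldType. *)
Definition Cplx (R : realType) : numFieldType := R[i].

Section Defs.
Variables (R : realType) (n : nat).
Local Notation C := (Cplx R).
Implicit Types (U : set 'rV[R]_n) (W : set 'rV[C]_n).

Definition real_part_embedding (x : 'rV[R]_n) : 'rV[C]_n :=
  \row_j (x 0 j)%:C%C.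

Definition bilin (z w : 'rV[C]_n) : C := \sum_(i < n) z 0 i * w 0 i.

Definition isotropic_cone (z : 'rV[C]_n) : set 'rV[C]_n :=
  [set w | bilin (w - z) (w - z) = 0].

Definition partial (i : 'I_n) (f : 'rV[R]_n -> R) : 'rV[R]_n -> R :=
  'D_(delta_mx 0 i) f.

(* [Ck k U f]: on the open set U, all partial derivatives of f of order at most
   k exist and are continuous; the values of f outside U are irrelevant. *)
Fixpoint Ck (k : nat) U (f : 'rV[R]_n -> R) : Prop :=
  (forall x, U x -> {for x, continuous f}) /\
  (if k is k'.+1 then forall i : 'I_n,
     (forall x, U x -> derivable f x (delta_mx 0 i)) /\ Ck k' U (partial i f)
   else True).

Definition laplacian (f : 'rV[R]_n -> R) (x : 'rV[R]_n) : R :=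
  \sum_(i < n) partial i (partial i f) x.

Definition real_harmonic U (f : 'rV[R]_n -> R) : Prop :=
  Ck 2 U f /\ forall x, U x -> laplacian f x = 0.

(* Partial derivatives of a complex-valued function of real variables are taken
   separately on the real and imaginary parts. *)
Definition harmonic_on U (u : 'rV[R]_n -> C) : Prop :=
  real_harmonic U (fun x => complex.Re (u x)) /\
  real_harmonic U (fun x => complex.Im (u x)).

(* For W open; [differentiable] is Frechet differentiability over the scalar
   field C, hence complex-linear. *)
Definition holomorphic_on W (f : 'rV[C]_n -> C) : Prop :=
  forall z, W z -> differentiable f z.

Definition harmonic_extension_domain U W : Prop :=
  [/\ open W, connected W, real_part_embedding @` U `<=` W &
      forall u : 'rV[R]_n -> C, harmonic_on U u ->
        exists f : 'rV[C]_n -> C, holomorphic_on W f /\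
          forall x, U x -> f (real_part_embedding x) = u x].

Definition is_harmonic_hull U W : Prop :=
  harmonic_extension_domain U W /\
  forall W', harmonic_extension_domain U W' -> W' `<=` W.

Definition cone_complement U : set 'rV[C]_n :=
  ~` \bigcup_(x in ~` U) isotropic_cone (real_part_embedding x).

(* The connected component of [cone_complement U] containing U, for U connected
   and nonempty: all points of U then lie in the same component. *)
Definition tilde U : set 'rV[C]_n :=
  \bigcup_(x in U)
    connected_component (cone_complement U) (real_part_embedding x).

End Defs.

(* Main.v *)
(**
  Upper bound: for a real point a outside U the function <x - a, x - a>^(1 - m)
  is harmonic on U.  An extension f to W satisfies f(z) <z - a, z - a>^(m - 1) = 1
  on U, hence on W by the identity theorem, so W misses the isotropic cone of a.

  Existence: let phi be a compactly supported C^2 cut-off in U, equal to 1 on an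
  open set O.  For u harmonic on U, g = Laplacian (phi u) is supported outside O,
  and Green's formula gives u(x) = c^-1 * int |x - y|^(2 - 2m) g(y) dy for x in O.
  As the exponent is even, the kernel continues to <z - y, z - y>^(1 - m), so the
  integral is holomorphic at every z whose isotropic cone meets R^n inside O.  These
  sets exhaust the complement of the cones of R^n \ U, and the continuations are
  glued along the directed family of cut-offs by the identity theorem.

  To avoid singular integrals, Green's formula is obtained from the smooth kernel
  (|x|^2 + eps)^(1 - m), whose Laplacian is -4 m (m - 1) eps (|x|^2 + eps)^(-m - 1),
  by letting eps tend to 0.
*)
Require Import Defs.
From mathcomp Require Import all_boot all_order all_algebra.
From mathcomp Require Import all_classical all_reals all_analysis.
From mathcomp Require Import complex ring lra.
Import Order.TTheory GRing.Theory Num.Theory.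
Import numFieldNormedType.Exports.
Local Open Scope classical_set_scope.
Local Open Scope ring_scope.
Set Implicit Arguments.
Unset Strict Implicit.
Unset Printing Implicit Defensive.

(** * Complex numbers over a real field *)

Section ComplexNumbers.
Variable R : realType.
Local Notation C := (Cplx R).
Local Notation Re := (@complex.Re R).
Local Notation Im := (@complex.Im R).

(** Only Cauchy theory on squares is used. The identity theorem is reached without power series: a
    function with many zeros near 0 is divided by them. The quotients are known to be merely
    continuous at those zeros, so Goursat's theorem is proved with finitely many exceptional points.
    The contour integral of 1 / (z - c) is never evaluated; that it is nonzero suffices.

    The real side is equally economical. Integrals over R^n are iterated integrals of continuous
    functions over a box [-M, M]^n; the order of integration is never exchanged, and translation
    invariance replaces the divergence theorem. The constant in Green's formula is only shown to be
    negative, by pairing the kernel with one fixed radial bump.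

    In the gluing, the domains of two cut-offs may intersect in a disconnected set, and the identity
    theorem says nothing on a component without real points. Each extension is therefore compared
    with that of a cut-off equal to 1 wherever one of the two is. *)

Definition mkC (x y : R) : C := (x +i* y)%C.
(** The norm of [Cplx R] has values in the complex numbers, which are only partially ordered; [absC]
    moves every estimate to the ordered field [R]. *)
Definition absC (z : C) : R := Re `|z|.

Lemma mkC_eta (z : C) : z = mkC (Re z) (Im z).
Proof. by case: z. Qed.

Lemma eqC (z w : C) : Re z = Re w -> Im z = Im w -> z = w.
Proof. by case: z => a b; case: w => c d /= -> ->. Qed.

Lemma ReD (z w : C) : Re (z + w) = Re z + Re w.
Proof. by case: z => a b; case: w. Qed.
Lemma ImD (z w : C) : Im (z + w) = Im z + Im w.
Proof. by case: z => a b; case: w. Qed.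
Lemma ReN (z : C) : Re (- z) = - Re z.
Proof. by case: z. Qed.
Lemma ImN (z : C) : Im (- z) = - Im z.
Proof. by case: z. Qed.
Lemma ReM (z w : C) : Re (z * w) = Re z * Re w - Im z * Im w.
Proof. by case: z => a b; case: w. Qed.
Lemma ImM (z w : C) : Im (z * w) = Re z * Im w + Im z * Re w.
Proof. by case: z => a b; case: w. Qed.

Lemma absC_ge0 (z : C) : 0 <= absC z.
Proof. by case: z => a b; rewrite /absC /= sqrtr_ge0. Qed.

Lemma absCE (z : C) : absC z = Num.sqrt (Re z ^+ 2 + Im z ^+ 2).
Proof. by case: z. Qed.

Lemma normCE (z : C) : `|z| = mkC (absC z) 0.
Proof. by case: z. Qed.

Lemma absC_eq0 (z : C) : (absC z == 0) = (z == 0).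
Proof.
apply/eqP/eqP => [h|->]; last by rewrite /absC normr0.
by apply/eqP; rewrite -normr_eq0 normCE h.
Qed.

Lemma absC_gt0 (z : C) : (0 < absC z) = (z != 0).
Proof. by rewrite lt_def absC_eq0 absC_ge0 andbT. Qed.

Lemma absC0 : absC 0 = 0.
Proof. by apply/eqP; rewrite absC_eq0. Qed.

Lemma absCM (z w : C) : absC (z * w) = absC z * absC w.
Proof. by rewrite /absC normrM ReM !normCE /= mul0r subr0. Qed.

Lemma absC1 : absC 1 = 1.
Proof. by rewrite /absC normr1. Qed.

Lemma absCN (z : C) : absC (- z) = absC z.
Proof. by rewrite /absC normrN. Qed.

Lemma absCB (z w : C) : absC (z - w) = absC (w - z).
Proof. by rewrite -absCN opprB. Qed.

Lemma absCX (z : C) k : absC (z ^+ k) = absC z ^+ k.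
Proof. by elim: k => [|k IH]; rewrite ?expr0 ?absC1// !exprS absCM IH. Qed.

Lemma absCV (z : C) : absC z^-1 = (absC z)^-1.
Proof.
have [->|z0] := eqVneq z 0; first by rewrite !(invr0,absC0).
have n0 : absC z != 0 by rewrite absC_eq0.
by apply: (mulfI n0); rewrite -absCM !mulfV// absC1.
Qed.

Lemma absCD (z w : C) : absC (z + w) <= absC z + absC w.
Proof.
have := ler_normD z w; rewrite !normCE.
by rewrite lecE /= => /andP[_].
Qed.

Lemma ler_absCB (z w : C) : absC z - absC w <= absC (z - w).
Proof. by rewrite lerBlDr -{1}(subrK w z) absCD. Qed.

Lemma absC_sum n (F : 'I_n -> C) : absC (\sum_i F i) <= \sum_i absC (F i).
Proof.
elim/big_ind2 : _ => //; first by rewrite absC0.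
by move=> a b c d ab cd; apply: (le_trans (absCD _ _)); rewrite lerD.
Qed.

Lemma Re_le_absC (z : C) : `|Re z| <= absC z.
Proof.
rewrite absCE -sqrtr_sqr ler_wsqrtr//.
by rewrite lerDl sqr_ge0.
Qed.

Lemma Im_le_absC (z : C) : `|Im z| <= absC z.
Proof.
rewrite absCE -sqrtr_sqr ler_wsqrtr//.
by rewrite lerDr sqr_ge0.
Qed.

Lemma absC_mk0 (x : R) : absC (mkC x 0) = `|x|.
Proof. by rewrite absCE /= expr0n addr0 sqrtr_sqr. Qed.

Lemma absC_0mk (x : R) : absC (mkC 0 x) = `|x|.
Proof. by rewrite absCE /= expr0n add0r sqrtr_sqr. Qed.

Lemma absC_le (z : C) : absC z <= `|Re z| + `|Im z|.
Proof.
have -> : z = mkC (Re z) 0 + mkC 0 (Im z).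
  by apply: eqC; rewrite ?ReD ?ImD /= ?addr0 ?add0r.
apply: (le_trans (absCD _ _)).
by rewrite absC_mk0 absC_0mk ReD ImD /= addr0 add0r.
Qed.

Lemma ltC_gt0 (e : C) : 0 < e -> 0 < Re e /\ e = mkC (Re e) 0.
Proof.
by case: e => a b; rewrite ltcE /= => /andP[/eqP -> ?].
Qed.

Lemma mkC_gt0 (x : R) : (0 < mkC x 0) = (0 < x).
Proof. by rewrite ltcE /= eqxx. Qed.

Lemma lt_normC (z : C) (x : R) : (`|z| < mkC x 0) = (absC z < x).
Proof. by rewrite normCE ltcE /= eqxx. Qed.

Lemma nbhsC (z : C) (P : C -> Prop) :
  (\forall w \near z, P w) <-> exists2 r : R, 0 < r & forall w, absC (w - z) < r -> P w.
Proof.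
split.
  move=> /nbhs_ballP[e /= e0 he].
  have [r0 ee] := ltC_gt0 e0; exists (Re e) => // w wz.
  by apply: he; rewrite -ball_normE /= distrC ee lt_normC.
move=> [r r0 hr]; apply/nbhs_ballP; exists (mkC r 0) => /=; first by rewrite mkC_gt0.
by move=> w; rewrite -ball_normE /= distrC lt_normC => /hr.
Qed.

Lemma mkCD (a b c d : R) : mkC a b + mkC c d = mkC (a + c) (b + d).
Proof. by []. Qed.
Lemma mkCN (a b : R) : - mkC a b = mkC (- a) (- b).
Proof. by []. Qed.
Lemma mkCM (a b c d : R) : mkC a b * mkC c d = mkC (a * c - b * d) (a * d + b * c).
Proof. by []. Qed.

End ComplexNumbers.

(** * One-dimensional integrals *)

Section SegmentIntegral.
Variable R : realType.
Implicit Types (a b c : R) (f g : R -> R).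
Local Notation mu := (@lebesgue_measure R).

Definition cont_seg a b f := forall x, a <= x <= b -> {for x, continuous f}.

(** No orientation: for b < a the interval is empty and the value is 0. *)
Definition seg_int a b f : R := \int[mu]_(x in `[a, b]) f x.

Lemma cont_seg_integrable a b f : cont_seg a b f ->
  mu.-integrable `[a, b] (EFin \o f).
Proof.
move=> cf; apply: continuous_compact_integrable; first exact: segment_compact.
by apply: continuous_in_subspaceT => x; rewrite inE /= in_itv /= => /cf.
Qed.

Lemma cont_segS a b c d f : c <= a -> b <= d -> cont_seg c d f -> cont_seg a b f.
Proof.
by move=> ca bd h x /andP[ax xb]; apply: h; rewrite (le_trans ca ax) (le_trans xb bd).
Qed.

Lemma cont_segD a b f g : cont_seg a b f -> cont_seg a b g ->
  cont_seg a b (fun x => f x + g x).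
Proof. by move=> hf hg x xab; apply: cvgD; [exact: hf|exact: hg]. Qed.

Lemma cont_segZ a b k f : cont_seg a b f -> cont_seg a b (fun x => k * f x).
Proof. by move=> hf x xab; apply: cvgM; [exact: cvg_cst|exact: hf]. Qed.

Lemma cont_seg_cst a b k : cont_seg a b (fun=> k).
Proof. by move=> x _; exact: cvg_cst. Qed.

Lemma JD a b f g : cont_seg a b f -> cont_seg a b g ->
  seg_int a b (fun x => f x + g x) = seg_int a b f + seg_int a b g.
Proof.
move=> hf hg; rewrite /seg_int RintegralD//.
- exact: (cont_seg_integrable hf).
- exact: (cont_seg_integrable hg).
Qed.

Lemma JZ a b k f : cont_seg a b f -> seg_int a b (fun x => k * f x) = k * seg_int a b f.
Proof. by move=> hf; rewrite /seg_int RintegralZl//; exact: (cont_seg_integrable hf). Qed.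

Lemma le_J a b f g : cont_seg a b f -> cont_seg a b g ->
  (forall x, a <= x <= b -> f x <= g x) -> seg_int a b f <= seg_int a b g.
Proof.
move=> hf hg fg; apply: le_Rintegral => //; [exact: (cont_seg_integrable hf)|exact: (cont_seg_integrable hg)].
Qed.

Lemma eq_J a b f g : (forall x, a <= x <= b -> f x = g x) -> seg_int a b f = seg_int a b g.
Proof.
move=> fg; apply: eq_Rintegral => x.
by rewrite inE /= in_itv /=; exact: fg.
Qed.

Lemma J_cst a b k : a <= b -> seg_int a b (fun=> k) = k * (b - a).
Proof.
move=> ab; rewrite /seg_int Rintegral_cst//= lebesgue_measure_itv /= lte_fin.
by move: ab; rewrite le_eqVlt => /orP[/eqP ->|->//]; rewrite ltxx /= subrr.
Qed.

Lemma J_cat a c b f : a <= c -> c <= b -> cont_seg a b f ->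
  seg_int a b f = seg_int a c f + seg_int c b f.
Proof.
move=> ac cb cf.
have iab := cont_seg_integrable cf.
have := @Rintegral_itvB R f (BLeft a) (BRight b) c iab.
rewrite !bnd_simp => /(_ ac cb).
rewrite Rintegral_itv_obnd_cbnd; first by rewrite /seg_int => <-; rewrite addrC subrK.
by apply: integrableS iab => //; apply: subset_itvr; rewrite bnd_simp.
Qed.

Lemma J_FTC2 a b f F : a <= b -> cont_seg a b f ->
  (forall x, a <= x <= b -> is_derive x (1:R) F (f x)) -> seg_int a b f = F b - F a.
Proof.
move=> ab cf dF.
move: ab; rewrite le_eqVlt => /orP[/eqP <-|ab].
  by rewrite subrr /seg_int set_itv1 Rintegral_set1.
have cF x : a <= x <= b -> {for x, continuous F}.
  move=> /dF h; apply: differentiable_continuous.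
  by apply/derivable1_diffP; case: h.
rewrite /seg_int /Rintegral (@continuous_FTC2 _ f F)//.
- by apply: continuous_in_subspaceT => x; rewrite inE /= in_itv /= => /cf.
- split.
  + by move=> x; rewrite in_itv /= => /andP[/ltW ax /ltW xb]; case: (dF x _) => //; rewrite ax.
  + by apply: cvg_at_right_filter; apply: cF; rewrite lexx ltW.
  + by apply: cvg_at_left_filter; apply: cF; rewrite lexx ltW.
- move=> x; rewrite in_itv /= => /andP[/ltW ax /ltW xb].
  by rewrite derive1E; apply: derive_val; apply: dF; rewrite ax.
Qed.

Lemma primitive_exists a b f : a <= b -> continuous f ->
  exists F, forall x, a <= x <= b -> is_derive x (1:R) F (f x).
Proof.
(* Starting at a - 1 and going on to b + 1 makes every point of [a, b] interior, so the derivative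
   is two-sided at the end points too. *)
move=> ab cf; exists (fun x => seg_int (a - 1) x f) => x /andP[ax xb].
have h : x < b + 1 by rewrite (le_lt_trans xb)// ltrDl.
have iab : mu.-integrable `[a - 1, b + 1] (EFin \o f).
  by apply: cont_seg_integrable => y _; exact: cf.
have ax1 : a - 1 < x by rewrite (lt_le_trans _ ax)// ltrBlDr ltrDl.
have [d1 d2] := continuous_FTC1_closed h iab ax1 (cf x).
exact: (DeriveDef d1 (etrans (esym (derive1E _ _)) d2)).
Qed.

(** Both sides are increments of one primitive F, since t -> F (t + h) is a primitive of the
    translate. *)
Lemma J_shift a b h f : a <= b -> continuous f ->
  seg_int a b (fun t => f (t + h)) = seg_int (a + h) (b + h) f.
Proof.
move=> ab cf.
have [|F dF] := @primitive_exists (a + h) (b + h) f _ cf; first by rewrite lerD2r.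
have -> : seg_int (a + h) (b + h) f = F (b + h) - F (a + h).
  by apply: J_FTC2 => //; [rewrite lerD2r|move=> x _; exact: cf].
apply: (@J_FTC2 a b _ (fun t => F (t + h))) => //.
  move=> x _; apply: (@continuous_comp _ _ _ (fun t => t + h) f); last exact: cf.
  by apply: cvgD; [exact: cvg_id|exact: cvg_cst].
move=> x /andP[ax xb].
have dx : is_derive (x + h) (1:R) F (f (x + h)) by apply: dF; rewrite !lerD2r ax.
have dh : is_derive x (1:R) (fun t => t + h) (1:R).
  by have := is_deriveD (is_derive_id x 1) (is_derive_cst h x (1:R)); rewrite addr0.
have := @is_derive1_comp _ F (fun t => t + h) x (f (x + h)) 1 dx dh.
by rewrite mulr1.
Qed.

Lemma J_gt0 a b f x0 : a < b -> cont_seg a b f ->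
  (forall x, a <= x <= b -> 0 <= f x) -> a <= x0 <= b -> 0 < f x0 -> 0 < seg_int a b f.
Proof.
move=> ab cf f0 x0ab fx0.
have fx2 : 0 < f x0 / 2 by rewrite divr_gt0.
have /cvgrPdist_lt /(_ _ fx2) := cf x0 x0ab.
move=> /nbhs_ballP[e /= e0 he].
have [ax xb] := andP x0ab.
(* A nondegenerate subinterval around x0 on which f stays above f x0 / 2. *)
pose c := Num.max a (x0 - e / 2); pose d := Num.min b (x0 + e / 2).
have e2 : 0 < e / 2 by rewrite divr_gt0.
have cd : c < d.
  rewrite /c /d lt_min !gt_max ab/=.
  by apply/and3P; split; lra.
have ac : a <= c by rewrite /c le_max lexx.
have db : d <= b by rewrite /d ge_min lexx.
have nn u v : a <= u -> u <= v -> v <= b -> 0 <= seg_int u v f.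
  move=> au uv vb; rewrite -[0](mul0r (v - u)) -J_cst//.
  apply: le_J => //; [exact: cont_seg_cst|exact: cont_segS cf|].
  by move=> x /andP[ux xv]; apply: f0; rewrite (le_trans au)//= (le_trans xv).
rewrite (@J_cat a c b)//; last by rewrite (le_trans (ltW cd)).
rewrite (@J_cat c d b)//; [|exact: ltW|exact: cont_segS cf].
rewrite ltr_wpDl ?nn ?(le_trans (ltW cd))// ltr_wpDr ?nn ?(le_trans _ (ltW cd))//.
apply: (@lt_le_trans _ _ (seg_int c d (fun=> f x0 / 2))).
  by rewrite J_cst ?ltW// mulr_gt0 ?divr_gt0 ?subr_gt0.
apply: le_J; [exact: cont_seg_cst|exact: cont_segS cf|].
move=> x /andP[]; rewrite /c /d ge_max le_min => /andP[ax' xe] /andP[xb' xe'].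
have : ball x0 e x by rewrite /ball /= ltr_norml; apply/andP; split; lra.
move=> /he /=; rewrite ltr_norml => /andP[]; lra.
Qed.

End SegmentIntegral.

(** * Goursat's theorem and the identity theorem *)

Section Bisection.
Variable R : realType.

Lemma exists_half_lt (s d : R) : 0 < d -> exists n, s / 2 ^+ n < d.
Proof.
move=> d0.
exists (Num.bound (s / d)).
have := upper_nthrootP (leqnn (Num.bound (s / d))).
by rewrite ltr_pdivrMr// => h; rewrite ltr_pdivrMr ?exprn_gt0// mulrC.
Qed.

(** The subdivision argument behind Goursat's theorem. As [be] is subadditive and [mu] superadditive
    under quartering, a square with [be] > [mu] has a quarter with the same defect; the nested bad
    squares shrink to a point, which contradicts the local hypothesis there. *)
Lemma bisection (be mu : R -> R -> R -> R) (a0 b0 s0 : R) : 0 < s0 ->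
  (forall a b h, 0 < h -> a0 <= a -> a + (h + h) <= a0 + s0 ->
     b0 <= b -> b + (h + h) <= b0 + s0 ->
     be a b (h + h) <= be a b h + be (a + h) b h + be a (b + h) h + be (a + h) (b + h) h) ->
  (forall a b h, 0 < h ->
     mu a b h + mu (a + h) b h + mu a (b + h) h + mu (a + h) (b + h) h <= mu a b (h + h)) ->
  (forall p q, a0 <= p <= a0 + s0 -> b0 <= q <= b0 + s0 ->
     exists2 d, 0 < d & forall a b s, 0 < s -> s < d ->
       a <= p <= a + s -> b <= q <= b + s ->
       a0 <= a -> a + s <= a0 + s0 -> b0 <= b -> b + s <= b0 + s0 ->
       be a b s <= mu a b s) ->
  be a0 b0 s0 <= mu a0 b0 s0.
Proof.
move=> s00 hbe hmu hloc; rewrite leNgt; apply/negP => hbad.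
pose bad (t : R * R * R) := [/\ 0 < t.2, a0 <= t.1.1, t.1.1 + t.2 <= a0 + s0,
  b0 <= t.1.2 /\ t.1.2 + t.2 <= b0 + s0 & mu t.1.1 t.1.2 t.2 < be t.1.1 t.1.2 t.2].
(* Conditioning on [bad t] gives every triple a successor, as dependent choice requires. *)
pose T (t u : R * R * R) := bad t -> bad u /\ [/\ u.2 = t.2 / 2, t.1.1 <= u.1.1,
  u.1.1 + u.2 <= t.1.1 + t.2, t.1.2 <= u.1.2 & u.1.2 + u.2 <= t.1.2 + t.2].
have step t : {u | T t u}.
  apply: cid; case: (pselect (bad t)) => [bt|nb]; last by exists t => /nb.
  case: t bt => [[a b] s] [/= s_gt0 ha has [hb hbs] hlt].
  pose h := s / 2; have h0 : 0 < h by rewrite divr_gt0.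
  have hh : s = h + h by rewrite /h; lra.
  have a1 : a <= a <= a + h by rewrite lexx lerDl ltW.
  have a2 : a <= a + h <= a + h by rewrite lexx lerDl ltW.
  have b1 : b <= b <= b + h by rewrite lexx lerDl ltW.
  have b2 : b <= b + h <= b + h by rewrite lexx lerDl ltW.
  have sub a' b' : a <= a' <= a + h -> b <= b' <= b + h -> mu a' b' h < be a' b' h ->
      T (a, b, s) (a', b', h).
    by move=> /andP[? ?] /andP[? ?] lt _; rewrite /bad /=; do 4?split => //; lra.
  have [lt|B1] := ltP (mu a b h) (be a b h); first by exists (a, b, h); exact: sub.
  have [lt|B2] := ltP (mu (a + h) b h) (be (a + h) b h).
    by exists (a + h, b, h); exact: sub.
  have [lt|B3] := ltP (mu a (b + h) h) (be a (b + h) h).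
    by exists (a, b + h, h); exact: sub.
  have [lt|B4] := ltP (mu (a + h) (b + h) h) (be (a + h) (b + h) h).
    by exists (a + h, b + h, h); exact: sub.
  exfalso; move: hlt; rewrite hh; apply/negP; rewrite -leNgt.
  have h1 := hmu a b h h0.
  have h2 : be a b (h + h) <= be a b h + be (a + h) b h + be a (b + h) h + be (a + h) (b + h) h.
    by apply: hbe => //; rewrite -hh.
  lra.
have [f [f0 fS]] := dependent_choice step (a0, b0, s0).
have fbad n : bad (f n).
  elim: n => [|n IH]; first by rewrite f0.
  by have [] := fS n IH.
have fs n : (f n).2 = s0 / 2 ^+ n.
  elim: n => [|n IH]; first by rewrite f0 expr0 divr1.
  have [_ [-> _ _ _ _]] := fS n (fbad n).
  by rewrite IH exprSr invfM mulrA.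
have mono n k : [/\ (f n).1.1 <= (f (n + k)%N).1.1,
    (f (n + k)%N).1.1 + (f (n + k)%N).2 <= (f n).1.1 + (f n).2,
    (f n).1.2 <= (f (n + k)%N).1.2 &
    (f (n + k)%N).1.2 + (f (n + k)%N).2 <= (f n).1.2 + (f n).2].
  elim: k => [|k [i1 i2 i3 i4]]; first by rewrite addn0.
  have [_ [_ j1 j2 j3 j4]] := fS (n + k)%N (fbad _).
  by rewrite addnS; split; [exact: le_trans j1|exact: le_trans i2|
    exact: le_trans j3|exact: le_trans i4].
have mono1 n k : (f k).1.1 <= (f n).1.1 + (f n).2.
  have [/ltW s1 _ _ _ _] := fbad n; have [/ltW s2 _ _ _ _] := fbad k.
  have [nk|/ltnW kn] := leqP n k.
    have [_ + _ _] := mono n (k - n)%N; rewrite subnKC//; lra.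
  have [+ _ _ _] := mono k (n - k)%N; rewrite subnKC//; lra.
have mono2 n k : (f k).1.2 <= (f n).1.2 + (f n).2.
  have [/ltW s1 _ _ _ _] := fbad n; have [/ltW s2 _ _ _ _] := fbad k.
  have [nk|/ltnW kn] := leqP n k.
    have [_ _ _ +] := mono n (k - n)%N; rewrite subnKC//; lra.
  have [_ _ + _] := mono k (n - k)%N; rewrite subnKC//; lra.
(* The suprema of the lower left corners are the coordinates of the common point of the nested
   squares. *)
pose A := range (fun n => (f n).1.1); pose B := range (fun n => (f n).1.2).
have supA n : (f n).1.1 <= sup A <= (f n).1.1 + (f n).2.
  apply/andP; split.
    apply: ub_le_sup; last by exists n.
    by exists ((f n).1.1 + (f n).2) => _ [k _ <-].
  by apply: ge_sup => [|_ [k _ <-]//]; exists (f 0%N).1.1; exists 0%N.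
have supB n : (f n).1.2 <= sup B <= (f n).1.2 + (f n).2.
  apply/andP; split.
    apply: ub_le_sup; last by exists n.
    by exists ((f n).1.2 + (f n).2) => _ [k _ <-].
  by apply: ge_sup => [|_ [k _ <-]//]; exists (f 0%N).1.2; exists 0%N.
have [d d0 hd] := hloc (sup A) (sup B)
  (eq_ind _ (fun t => t.1.1 <= sup A <= t.1.1 + t.2) (supA 0%N) _ f0)
  (eq_ind _ (fun t => t.1.2 <= sup B <= t.1.2 + t.2) (supB 0%N) _ f0).
have [n hn] := exists_half_lt s0 d0.
have [h1 h2 h3 [h4 h5] h6] := fbad n.
move: h6; rewrite ltNge => /negP; apply.
by apply: hd => //; rewrite fs.
Qed.

End Bisection.

(** * Extension of real monotone linear functionals to complex-valued functions *)

Section Complexification.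
Variables (R : realType) (T : Type) (adm : (T -> R) -> Prop) (dom : T -> Prop).
Variable L : (T -> R) -> R.
Local Notation C := (Cplx R).
Local Notation Re := (@complex.Re R).
Local Notation Im := (@complex.Im R).

(* [adm] stands for the admissible integrands, [dom] for the range of integration. *)
Record mono_linear : Prop := MonoLinear {
  ml_admD : forall f g, adm f -> adm g -> adm (fun x => f x + g x);
  ml_admZ : forall k f, adm f -> adm (fun x => k * f x);
  ml_D : forall f g, adm f -> adm g -> L (fun x => f x + g x) = L f + L g;
  ml_Z : forall k f, adm f -> L (fun x => k * f x) = k * L f;
  ml_le : forall f g, adm f -> adm g -> (forall x, dom x -> f x <= g x) -> L f <= L g }.

Definition admC (f : T -> C) := adm (fun x => Re (f x)) /\ adm (fun x => Im (f x)).
Definition complexify (f : T -> C) : C := mkC (L (fun x => Re (f x))) (L (fun x => Im (f x))).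

Hypothesis ml : mono_linear.

Lemma admCD f g : admC f -> admC g -> admC (fun x => f x + g x).
Proof.
move=> [f1 f2] [g1 g2]; split.
  have -> : (fun x => Re (f x + g x)) = (fun x => Re (f x) + Re (g x)).
    by apply: funext => x; rewrite ReD.
  exact: (ml_admD ml).
have -> : (fun x => Im (f x + g x)) = (fun x => Im (f x) + Im (g x)).
  by apply: funext => x; rewrite ImD.
exact: (ml_admD ml).
Qed.

Lemma LCD f g : admC f -> admC g -> complexify (fun x => f x + g x) = complexify f + complexify g.
Proof.
move=> [f1 f2] [g1 g2]; apply: eqC; rewrite ?ReD ?ImD /=.
  by rewrite -(ml_D ml)//; congr L; apply: funext => x; rewrite ReD.
by rewrite -(ml_D ml)//; congr L; apply: funext => x; rewrite ImD.
Qed.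

Let ReZ (k : C) (f : T -> C) :
  (fun x => Re (k * f x)) = (fun x => Re k * Re (f x) + - Im k * Im (f x)).
Proof. by apply: funext => x; rewrite ReM mulNr. Qed.

Let ImZ (k : C) (f : T -> C) :
  (fun x => Im (k * f x)) = (fun x => Re k * Im (f x) + Im k * Re (f x)).
Proof. by apply: funext => x; rewrite ImM. Qed.

Lemma admCZ k f : admC f -> admC (fun x => k * f x).
Proof.
move=> [f1 f2]; split; rewrite ?ReZ ?ImZ; apply: (ml_admD ml); exact: (ml_admZ ml).
Qed.

Lemma LCZ k f : admC f -> complexify (fun x => k * f x) = k * complexify f.
Proof.
move=> [f1 f2]; apply: eqC; rewrite ?ReM ?ImM /= ?ReZ ?ImZ.
  by rewrite (ml_D ml) ?(ml_Z ml)// ?mulNr//; exact: (ml_admZ ml).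
by rewrite (ml_D ml) ?(ml_Z ml)//; exact: (ml_admZ ml).
Qed.

Lemma admCB f g : admC f -> admC g -> admC (fun x => f x - g x).
Proof.
move=> hf hg; have -> : (fun x => f x - g x) = (fun x => f x + (- 1) * g x).
  by apply: funext => x; rewrite mulN1r.
by apply: admCD => //; exact: admCZ.
Qed.

Lemma LCB f g : admC f -> admC g -> complexify (fun x => f x - g x) = complexify f - complexify g.
Proof.
move=> hf hg; have -> : (fun x => f x - g x) = (fun x => f x + (- 1) * g x).
  by apply: funext => x; rewrite mulN1r.
by rewrite LCD ?LCZ ?mulN1r//; exact: admCZ.
Qed.

Lemma ml_abs f g : adm f -> adm g -> (forall x, dom x -> `|f x| <= g x) -> `|L f| <= L g.
Proof.
move=> hf hg fg; rewrite ler_norml; apply/andP; split.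
  rewrite -mulN1r -(ml_Z ml)//; apply: (ml_le ml) => //; first exact: (ml_admZ ml).
  by move=> x /fg; rewrite ler_norml mulN1r => /andP[].
by apply: (ml_le ml) => // x /fg; rewrite ler_norml => /andP[].
Qed.

(** Real and imaginary parts are estimated separately, hence the factor 2; its size never
    matters. *)
Lemma absLC_le f g : admC f -> adm g -> (forall x, dom x -> absC (f x) <= g x) ->
  absC (complexify f) <= 2 * L g.
Proof.
move=> [f1 f2] hg fg; apply: (le_trans (absC_le _)) => /=.
rewrite mulrDl mul1r lerD//; apply: ml_abs => // x dx.
  exact: le_trans (Re_le_absC _) (fg x dx).
exact: le_trans (Im_le_absC _) (fg x dx).
Qed.

End Complexification.

(** * Contour integrals along squares *)

Section SquareContour.
Variable R : realType.
Local Notation C := (Cplx R).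
Local Notation Re := (@complex.Re R).
Local Notation Im := (@complex.Im R).
Implicit Types (a b s : R) (phi psi : C -> C).

Definition seg a b : set R := [set x | a <= x <= b].

Lemma J_mono_linear a b : mono_linear (cont_seg a b) (seg a b) (seg_int a b).
Proof.
split; [exact: cont_segD|exact: cont_segZ|exact: JD|exact: JZ|exact: le_J].
Qed.

Definition cseg_int a b (f : R -> C) : C := complexify (seg_int a b) f.

Lemma continuousC phi z : {for z, continuous phi} <->
  forall e, 0 < e -> exists2 d, 0 < d & forall w, absC (w - z) < d -> absC (phi w - phi z) < e.
Proof.
split=> [h e e0|h].
  have e0' : 0 < mkC e 0 by rewrite mkC_gt0.
  have /cvgrPdist_lt /(_ _ e0') /nbhsC[d d0 hd] := h.
  by exists d => // w /hd; rewrite distrC lt_normC.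
apply: (iffRL (@cvgrPdist_lt _ _ _ (nbhs z) _ phi (phi z))) => e /ltC_gt0[e0 ->].
have [d d0 hd] := h _ e0; apply/nbhsC; exists d => // w /hd.
by rewrite distrC lt_normC.
Qed.

Lemma continuous_Re_line phi (l : R -> C) t0 : {for l t0, continuous phi} ->
  (forall t, absC (l t - l t0) = `|t - t0|) ->
  {for t0, continuous (fun t => Re (phi (l t)))} /\
  {for t0, continuous (fun t => Im (phi (l t)))}.
Proof.
move=> /continuousC cphi hl; split; apply/cvgrPdist_lt => e e0;
  have [d d0 hd] := cphi e e0; apply/nbhs_ballP; exists d => //= t;
  rewrite /ball/= distrC -hl => /hd; apply: le_lt_trans; rewrite -absCN opprB.
  by rewrite -ReN -ReD Re_le_absC.
by rewrite -ImN -ImD Im_le_absC.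
Qed.

Definition contQ phi a b s := forall z : C, a <= Re z <= a + s -> b <= Im z <= b + s ->
  {for z, continuous phi}.

Definition onbd a b s (z : C) := a <= Re z <= a + s /\ b <= Im z <= b + s /\
  (Re z = a \/ Re z = a + s \/ Im z = b \/ Im z = b + s).

(** Continuity on the boundary alone, because the Cauchy kernel is singular inside the square. *)
Definition contBd phi a b s := forall z, onbd a b s z -> {for z, continuous phi}.

Lemma contQ_Bd phi a b s : contQ phi a b s -> contBd phi a b s.
Proof. by move=> h z [z1 [z2 _]]; exact: h. Qed.

Lemma admC_hline phi a b y : (forall x, a <= x <= b -> {for mkC x y, continuous phi}) ->
  admC (cont_seg a b) (fun x => phi (mkC x y)).
Proof.
move=> cQ; split=> x xa;
  have [] := @continuous_Re_line phi (fun x => mkC x y) x (cQ x xa) => // t;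
  by rewrite mkCN mkCD subrr absC_mk0.
Qed.

Lemma admC_vline phi a b x : (forall y, a <= y <= b -> {for mkC x y, continuous phi}) ->
  admC (cont_seg a b) (fun y => phi (mkC x y)).
Proof.
move=> cQ; split=> y ya;
  have [] := @continuous_Re_line phi (fun y => mkC x y) y (cQ y ya) => // t;
  by rewrite mkCN mkCD subrr absC_0mk.
Qed.

Lemma adm_hline phi a b s y : contQ phi a b s -> b <= y <= b + s ->
  admC (cont_seg a (a + s)) (fun x => phi (mkC x y)).
Proof. by move=> cQ yb; apply: admC_hline => x xa; exact: cQ. Qed.

Lemma adm_vline phi a b s x : contQ phi a b s -> a <= x <= a + s ->
  admC (cont_seg b (b + s)) (fun y => phi (mkC x y)).
Proof. by move=> cQ xa; apply: admC_vline => y yb; exact: cQ. Qed.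

Section Sides.
Variables (phi : C -> C) (a b s : R).
Hypotheses (s0 : 0 <= s) (cphi : contBd phi a b s).

Let a0 : a <= a <= a + s /\ a <= a + s <= a + s.
Proof. by have h := s0; split; apply/andP; split; lra. Qed.
Let b0 : b <= b <= b + s /\ b <= b + s <= b + s.
Proof. by have h := s0; split; apply/andP; split; lra. Qed.

Lemma adm_bottom : admC (cont_seg a (a + s)) (fun x => phi (mkC x b)).
Proof.
by apply: admC_hline => x xa; apply: cphi; split=> //=; split; [case: b0|right; right; left].
Qed.
Lemma adm_top : admC (cont_seg a (a + s)) (fun x => phi (mkC x (b + s))).
Proof.
by apply: admC_hline => x xa; apply: cphi; split=> //=; split; [case: b0|right; right; right].
Qed.
Lemma adm_right : admC (cont_seg b (b + s)) (fun y => phi (mkC (a + s) y)).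
Proof.
by apply: admC_vline => y yb; apply: cphi; split; [case: a0|split=> //=; right; left].
Qed.
Lemma adm_left : admC (cont_seg b (b + s)) (fun y => phi (mkC a y)).
Proof.
by apply: admC_vline => y yb; apply: cphi; split; [case: a0|split=> //=; left].
Qed.
End Sides.

(** The counterclockwise contour integral around the square with lower left corner a + ib and side
    s; the factor i comes from dz = i dy on the vertical sides. *)
Definition square_int phi a b s : C :=
  cseg_int a (a + s) (fun x => phi (mkC x b)) - cseg_int a (a + s) (fun x => phi (mkC x (b + s)))
  + mkC 0 1 * (cseg_int b (b + s) (fun y => phi (mkC (a + s) y))
             - cseg_int b (b + s) (fun y => phi (mkC a y))).

Lemma contQS phi a b s a' b' s' : a <= a' -> b <= b' -> a' + s' <= a + s ->
  b' + s' <= b + s -> contQ phi a b s -> contQ phi a' b' s'.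
Proof. by move=> h1 h2 h3 h4 c z /andP[? ?] /andP[? ?]; apply: c; apply/andP; split; lra. Qed.

Lemma contQZ (k : C) phi a b s : contQ phi a b s -> contQ (fun z => k * phi z) a b s.
Proof. by move=> h z z1 z2; apply: continuousM; [exact: cst_continuous|exact: h]. Qed.

Lemma contQB phi psi a b s : contQ phi a b s -> contQ psi a b s ->
  contQ (fun z => phi z - psi z) a b s.
Proof. by move=> h h' z z1 z2; apply: continuousB; [exact: h|exact: h']. Qed.

Lemma BdB phi psi a b s : 0 <= s -> contBd phi a b s -> contBd psi a b s ->
  square_int (fun z => phi z - psi z) a b s = square_int phi a b s - square_int psi a b s.
Proof.
move=> s0 h1 h2.
have e1 := LCB (J_mono_linear a (a + s)) (adm_bottom s0 h1) (adm_bottom s0 h2).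
have e2 := LCB (J_mono_linear a (a + s)) (adm_top s0 h1) (adm_top s0 h2).
have e3 := LCB (J_mono_linear b (b + s)) (adm_right s0 h1) (adm_right s0 h2).
have e4 := LCB (J_mono_linear b (b + s)) (adm_left s0 h1) (adm_left s0 h2).
rewrite /square_int /cseg_int {}e1 {}e2 {}e3 {}e4.
have alg (i x1 x2 x3 x4 y1 y2 y3 y4 : C) :
  x1 - y1 - (x2 - y2) + i * (x3 - y3 - (x4 - y4)) =
  x1 - x2 + i * (x3 - x4) - (y1 - y2 + i * (y3 - y4)) by ring.
exact: alg.
Qed.

Lemma BdZ (k : C) phi a b s : 0 <= s -> contBd phi a b s ->
  square_int (fun z => k * phi z) a b s = k * square_int phi a b s.
Proof.
move=> s0 h1.
have e1 := LCZ (J_mono_linear a (a + s)) k (adm_bottom s0 h1).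
have e2 := LCZ (J_mono_linear a (a + s)) k (adm_top s0 h1).
have e3 := LCZ (J_mono_linear b (b + s)) k (adm_right s0 h1).
have e4 := LCZ (J_mono_linear b (b + s)) k (adm_left s0 h1).
rewrite /square_int /cseg_int {}e1 {}e2 {}e3 {}e4.
have alg (i x1 x2 x3 x4 : C) :
  k * x1 - k * x2 + i * (k * x3 - k * x4) = k * (x1 - x2 + i * (x3 - x4)) by ring.
exact: alg.
Qed.

Lemma absJC_le a b (f : R -> C) M : a <= b -> admC (cont_seg a b) f ->
  (forall x, a <= x <= b -> absC (f x) <= M) -> absC (cseg_int a b f) <= 2 * (M * (b - a)).
Proof.
move=> ab cf fM; rewrite -J_cst//.
by apply: (absLC_le (J_mono_linear a b)) => //; exact: cont_seg_cst.
Qed.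

(** The 8 is made of four sides and the factor 2 of [absLC_le]. *)
Lemma absBd_le phi a b s M : 0 <= s -> contBd phi a b s ->
  (forall z, onbd a b s z -> absC (phi z) <= M) -> absC (square_int phi a b s) <= 8 * M * s.
Proof.
move=> s0 h1 hM.
have [ha ha'] : a <= a <= a + s /\ a <= a + s <= a + s by split; apply/andP; split; lra.
have [hb hb'] : b <= b <= b + s /\ b <= b + s <= b + s by split; apply/andP; split; lra.
have lra_ : a <= a + s by rewrite lerDl.
have lrb_ : b <= b + s by rewrite lerDl.
have e1 : absC (cseg_int a (a + s) (fun x => phi (mkC x b))) <= 2 * (M * (a + s - a)).
  apply: absJC_le => //; first exact: (adm_bottom s0 h1).
  by move=> x xa; apply: hM; split => //; split => //=; right; right; left.
have e2 : absC (cseg_int a (a + s) (fun x => phi (mkC x (b + s)))) <= 2 * (M * (a + s - a)).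
  apply: absJC_le => //; first exact: (adm_top s0 h1).
  by move=> x xa; apply: hM; split => //; split => //=; right; right; right.
have e3 : absC (cseg_int b (b + s) (fun x => phi (mkC (a + s) x))) <= 2 * (M * (b + s - b)).
  apply: absJC_le => //; first exact: (adm_right s0 h1).
  by move=> x xa; apply: hM; split => //; split => //=; right; left.
have e4 : absC (cseg_int b (b + s) (fun x => phi (mkC a x))) <= 2 * (M * (b + s - b)).
  apply: absJC_le => //; first exact: (adm_left s0 h1).
  by move=> x xa; apply: hM; split => //; split => //=; left.
apply: (le_trans (absCD _ _)).
rewrite absCM absC_0mk normr1 mul1r.
have f1 := absCD (cseg_int a (a + s) (fun x => phi (mkC x b)))
  (- cseg_int a (a + s) (fun x => phi (mkC x (b + s)))).
have f2 := absCD (cseg_int b (b + s) (fun x => phi (mkC (a + s) x)))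
  (- cseg_int b (b + s) (fun x => phi (mkC a x))).
move: f1 f2; rewrite !absCN => f1 f2.
have -> : 8 * M * s = 2 * (M * (a + s - a)) + 2 * (M * (a + s - a)) +
  (2 * (M * (b + s - b)) + 2 * (M * (b + s - b))) by ring.
apply: lerD; apply: le_trans (lerD _ _); [exact: f1|exact: e1|exact: e2|exact: f2|exact: e3|exact: e4].
Qed.

Lemma JC_cat a c b (f : R -> C) : a <= c -> c <= b -> admC (cont_seg a b) f ->
  cseg_int a b f = cseg_int a c f + cseg_int c b f.
Proof. by move=> ac cb [f1 f2]; apply: eqC => /=; exact: J_cat. Qed.

Lemma Bd_split phi a b h : 0 <= h -> contQ phi a b (h + h) ->
  square_int phi a b (h + h) = square_int phi a b h + square_int phi (a + h) b h + square_int phi a (b + h) h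
    + square_int phi (a + h) (b + h) h.
Proof.
move=> h0 cQ; rewrite /square_int.
have hs y : b <= y <= b + (h + h) -> cseg_int a (a + (h + h)) (fun x => phi (mkC x y)) =
    cseg_int a (a + h) (fun x => phi (mkC x y)) + cseg_int (a + h) (a + h + h) (fun x => phi (mkC x y)).
  by move=> yb; rewrite (@JC_cat a (a + h)) ?addrA//; [lra|lra|rewrite -addrA; exact: (adm_hline cQ)].
have vs x : a <= x <= a + (h + h) -> cseg_int b (b + (h + h)) (fun y => phi (mkC x y)) =
    cseg_int b (b + h) (fun y => phi (mkC x y)) + cseg_int (b + h) (b + h + h) (fun y => phi (mkC x y)).
  by move=> xa; rewrite (@JC_cat b (b + h)) ?addrA//; [lra|lra|rewrite -addrA; exact: (adm_vline cQ)].
rewrite !hs ?vs; do ?[by apply/andP; split; lra].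
rewrite !addrA.
move: (cseg_int _ _ _) (cseg_int _ _ _) (cseg_int _ _ _) (cseg_int _ _ _) (cseg_int _ _ _) (cseg_int _ _ _) (cseg_int _ _ _)
  (cseg_int _ _ _) (cseg_int _ _ _) (cseg_int _ _ _) (cseg_int _ _ _) (cseg_int _ _ _) (mkC 0 1).
by move=> *; ring.
Qed.

Lemma Bd_cst (k : C) a b s : square_int (fun=> k) a b s = 0.
Proof. by rewrite /square_int !subrr mulr0 addr0. Qed.

Lemma Bd_id a b s : 0 <= s -> square_int id a b s = 0.
Proof.
move=> s0; rewrite /square_int /cseg_int /complexify /=.
have ha : a <= a + s by rewrite lerDl.
have hb : b <= b + s by rewrite lerDl.
rewrite !J_cst//.
apply: eqC; rewrite !(ReD,ImD,ReN,ImN,ReM,ImM) /=; ring.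
Qed.

End SquareContour.

(** * Goursat's theorem with exceptional points *)

Section Goursat.
Variable R : realType.
Local Notation C := (Cplx R).
Local Notation Re := (@complex.Re R).
Local Notation Im := (@complex.Im R).
Implicit Types (a b s : R) (phi : C -> C).

Lemma absCD4 (x y z w : C) : absC (x + y + z + w) <= absC x + absC y + absC z + absC w.
Proof.
apply: (le_trans (absCD _ _)); rewrite lerD2r.
by apply: (le_trans (absCD _ _)); rewrite lerD2r absCD.
Qed.

Lemma differentiableC phi z : differentiable phi z -> exists l : C, forall e, 0 < e ->
  exists2 d, 0 < d & forall w, absC (w - z) < d ->
    absC (phi w - phi z - l * (w - z)) <= e * absC (w - z).
Proof.
move=> /derivable1_diffP dphi; exists ('D_1 phi z) => e e0.
have e0' : 0 < mkC e 0 by rewrite mkC_gt0.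
have /cvgrPdist_lt /(_ _ e0') := dphi.
rewrite near_withinE => /nbhsC[d d0 hd]; exists d => // w wd.
have [->|wz] := eqVneq w z; first by rewrite !subrr mulr0 subr0 absC0 mulr0.
have h0 : w - z != 0 by rewrite subr_eq0.
have := hd (w - z); rewrite subr0 => /(_ wd h0).
rewrite lt_normC /= /GRing.scale /= mulr1 subrK -/('D_1 phi z) => /ltW h.
rewrite -absCN.
have -> : - (phi w - phi z - 'D_1 phi z * (w - z)) =
  ('D_1 phi z - (w - z)^-1 * (phi w - phi z)) * (w - z).
  by rewrite mulrBl mulrAC mulVf// mul1r opprB.
by rewrite absCM ler_wpM2r// absC_ge0.
Qed.

(** The odd extension of the square root: an increasing function whose increments over short
    intervals around 0 are large compared with their length. *)
Definition ssqrt (t : R) : R := if 0 <= t then Num.sqrt t else - Num.sqrt (- t).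

Lemma ssqrt_le t u : t <= u -> ssqrt t <= ssqrt u.
Proof.
move=> tu; rewrite /ssqrt; case: (leP 0 t) => t0; case: (leP 0 u) => u0.
- exact: ler_wsqrtr.
- by have := lt_le_trans u0 (le_trans t0 tu); rewrite ltxx.
- by rewrite (@le_trans _ _ 0)// ?sqrtr_ge0// oppr_le0 sqrtr_ge0.
- by rewrite lerN2 ler_wsqrtr// lerN2.
Qed.

(** Subadditivity of the square root: p splits the interval into lengths x and y, and the increment
    is sqrt x + sqrt y. *)
Lemma ssqrt_gap a s p : a <= p <= a + s -> Num.sqrt s <= ssqrt (a + s - p) - ssqrt (a - p).
Proof.
move=> /andP[ap ps]; set x := a + s - p; set y := p - a.
have x0 : 0 <= x by rewrite /x; lra.
have y0 : 0 <= y by rewrite /y; lra.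
have -> : s = x + y by rewrite /x /y; ring.
have -> : ssqrt x = Num.sqrt x by rewrite /ssqrt x0.
have -> : ssqrt (a - p) = - Num.sqrt y.
  rewrite /ssqrt -opprB -/y; case: leP => [|_]; last by rewrite opprK.
  rewrite oppr_ge0 => y0'; have -> : y = 0 by apply/eqP; rewrite eq_le y0 y0'.
  by rewrite oppr0 sqrtr0 oppr0.
rewrite opprK -[leRHS]ger0_norm ?addr_ge0 ?sqrtr_ge0// -sqrtr_sqr ler_wsqrtr//.
rewrite sqrrD !sqr_sqrtr// [leRHS]addrAC lerDl mulrn_wge0// mulr_ge0 ?sqrtr_ge0//.
Qed.

(** A product of increments is additive under quartering, like the area, but on a square of side s
    containing e each factor is at least sqrt s, so the value there is at least s instead of s^2. *)
Definition gauge (e : C) a b s : R :=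
  (ssqrt (a + s - Re e) - ssqrt (a - Re e)) * (ssqrt (b + s - Im e) - ssqrt (b - Im e)).

Lemma gauge_ge0 e a b s : 0 <= s -> 0 <= gauge e a b s.
Proof.
by move=> s0; apply: mulr_ge0; rewrite subr_ge0 ssqrt_le// lerD2r lerDl.
Qed.

Lemma gauge_ge e a b s : 0 <= s -> a <= Re e <= a + s -> b <= Im e <= b + s ->
  s <= gauge e a b s.
Proof.
move=> s0 ha hb; rewrite -{1}(sqr_sqrtr s0) expr2.
by apply: ler_pM; rewrite ?sqrtr_ge0//; exact: ssqrt_gap.
Qed.

Lemma gauge_split e a b h : gauge e a b h + gauge e (a + h) b h +
  gauge e a (b + h) h + gauge e (a + h) (b + h) h = gauge e a b (h + h).
Proof. by rewrite /gauge !addrA; ring. Qed.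

(* The [gauge] of an exceptional point e dominates the side of every square
   containing e, which is why continuity at e is enough. *)
Lemma Goursat phi a b s (E : seq C) : 0 < s -> contQ phi a b s ->
  (forall z : C, a <= Re z <= a + s -> b <= Im z <= b + s -> z \notin E ->
     differentiable phi z) ->
  square_int phi a b s = 0.
Proof.
move=> s0 cphi dphi.
have cc (k : C) u v t : contQ (fun=> k) u v t by move=> w _ _; exact: cst_continuous.
(* The area pays for points of differentiability, around which the integral is o(s^2); the gauges
   pay for the exceptional points, around which continuity gives only o(s). *)
pose mu a b s := s ^+ 2 + \sum_(e <- E) gauge e a b s.
have key e : 0 < e -> absC (square_int phi a b s) <= e * mu a b s.
  move=> e0; pose be a b s := absC (square_int phi a b s).
  apply: (bisection (be := be) (mu := fun a b s => e * mu a b s)) => //.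
  - move=> a' b' h h0 h1 h2 h3 h4; rewrite /be (Bd_split (ltW h0)); last exact: contQS cphi.
    exact: absCD4.
  - move=> a' b' h h0; rewrite -!mulrDr ler_pM2l//.
    rewrite /mu !addrA.
    have -> : \sum_(e <- E) gauge e a' b' (h + h) = \sum_(e <- E) gauge e a' b' h +
      \sum_(e <- E) gauge e (a' + h) b' h + \sum_(e <- E) gauge e a' (b' + h) h +
      \sum_(e <- E) gauge e (a' + h) (b' + h) h.
      by rewrite -!big_split /=; apply: eq_bigr => i _; rewrite -gauge_split.
    by rewrite le_eqVlt; apply/orP; left; apply/eqP; ring.
  - move=> p q ha hb; pose z : C := mkC p q.
    have sge0 a' b' s' : 0 < s' -> 0 <= \sum_(e <- E) gauge e a' b' s'.
      by move=> s'0; apply: sumr_ge0 => i _; rewrite gauge_ge0// ltW.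
    have near_z a' b' s' w : 0 < s' -> a' <= p <= a' + s' -> b' <= q <= b' + s' ->
        onbd a' b' s' w -> absC (w - z) <= 2 * s'.
      move=> s'0 /andP[p1 p2] /andP[q1 q2] [/andP[w1 w2] [/andP[w3 w4] _]].
      apply: (le_trans (absC_le _)); rewrite ReD ImD ReN ImN /=.
      by rewrite mulrDl mul1r lerD// ler_norml; apply/andP; split; lra.
    have [zE|zE] := boolP (z \in E).
      have e8 : 0 < e / 8 by rewrite divr_gt0.
      have /continuousC /(_ _ e8) [d d0 hd] : {for z, continuous phi} by exact: cphi.
      exists (d / 2) => [|a' b' s' s'0 s'd p1 q1 h1 h2 h3 h4]; first by rewrite divr_gt0.
      have c' : contQ phi a' b' s' by apply: contQS cphi.
      have -> : be a' b' s' = absC (square_int (fun w => phi w - phi z) a' b' s').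
        by rewrite (BdB (ltW s'0) (contQ_Bd c') (contQ_Bd (cc _ _ _ _))) Bd_cst subr0.
      apply: (@le_trans _ _ (8 * (e / 8) * s')).
        apply: absBd_le; first exact: ltW.
          exact: contQ_Bd (contQB c' (cc _ _ _ _)).
        by move=> w hw; apply/ltW/hd; apply: (le_lt_trans (near_z _ _ _ _ s'0 p1 q1 hw)); lra.
      have -> : 8 * (e / 8) = e by field.
      rewrite ler_pM2l// /mu (big_rem z)//= addrA.
      have g1 : s' <= gauge z a' b' s' by apply: gauge_ge => //; rewrite ltW.
      have g2 : 0 <= \sum_(y <- rem z E) gauge y a' b' s'.
        by apply: sumr_ge0 => i _; rewrite gauge_ge0// ltW.
      have g3 := sqr_ge0 s'; lra.
    have [l hl] := differentiableC (dphi z ha hb zE).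
    (* 16 = 8 * 2: the 8 comes from [absBd_le], and boundary points lie within 2 s' of z. *)
    have e16 : 0 < e / 16 by rewrite divr_gt0.
    have [d d0 hd] := hl _ e16.
    exists (d / 2) => [|a' b' s' s'0 s'd p1 q1 h1 h2 h3 h4]; first by rewrite divr_gt0.
    have c' : contQ phi a' b' s' by apply: contQS cphi.
    have ci : contQ id a' b' s' by move=> w _ _; exact: cvg_id.
    have cl : contQ (fun w => l * (w - z)) a' b' s'.
      exact: (contQZ (phi := fun w => w - z) (contQB ci (cc z _ _ _))).
    have c1 : contQ (fun w => phi w - phi z) a' b' s' by exact: (contQB c' (cc _ _ _ _)).
    (* Subtracting the first-order Taylor polynomial leaves the integral unchanged, since constants
       and the identity integrate to 0. *)
    have -> : be a' b' s' = absC (square_int (fun w => phi w - phi z - l * (w - z)) a' b' s').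
      have s'1 := ltW s'0.
      rewrite /be (BdB s'1 (contQ_Bd c1) (contQ_Bd cl)) (BdB s'1 (contQ_Bd c') (contQ_Bd (cc _ _ _ _)))
        (BdZ l s'1 (phi := fun w => w - z) (contQ_Bd (contQB ci (cc z _ _ _)))).
      by rewrite (BdB s'1 (contQ_Bd ci) (contQ_Bd (cc _ _ _ _))) (Bd_id _ _ s'1) !Bd_cst !subr0 mulr0 subr0.
    apply: (@le_trans _ _ (8 * (e / 16 * (2 * s')) * s')).
      apply: absBd_le; [exact: ltW|exact: contQ_Bd (contQB c1 cl)|] => w hw.
      have wz := near_z _ _ _ _ s'0 p1 q1 hw.
      apply: (le_trans (hd w _)); first by apply: (le_lt_trans wz); lra.
      by rewrite ler_pM2l.
    have -> : 8 * (e / 16 * (2 * s')) * s' = e * s' ^+ 2 by field.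
    by rewrite ler_pM2l// /mu lerDl sge0.
apply/eqP; rewrite -absC_eq0 eq_le absC_ge0 andbT leNgt; apply/negP => pos.
have mu0 : 0 < mu a b s.
  rewrite ltr_wpDr ?exprn_gt0//; apply: sumr_ge0 => i _; rewrite gauge_ge0// ltW//.
(* With this e the estimate bounds a positive number by its half. *)
have := key (absC (square_int phi a b s) / (2 * mu a b s)).
rewrite divr_gt0 ?mulr_gt0// => /(_ isT).
have -> : absC (square_int phi a b s) / (2 * mu a b s) * mu a b s = absC (square_int phi a b s) / 2.
  by field; rewrite gt_eqF.
by move: pos; set x := absC _ => ? ?; lra.
Qed.

End Goursat.

(** * Division by zeros and the Cauchy estimate *)

Section CauchyEstimate.
Variable R : realType.
Local Notation C := (Cplx R).
Local Notation Re := (@complex.Re R).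
Local Notation Im := (@complex.Im R).

Lemma near_neqC (z a : C) : z != a -> \forall w \near z, w != a.
Proof.
move=> za; apply/nbhsC; exists (absC (z - a)).
  by rewrite absC_gt0 subr_eq0.
by move=> w; apply: contraTN => /eqP ->; rewrite absCB ltxx.
Qed.

Lemma near_eq_continuousC (f g : C -> C) z : (\forall w \near z, f w = g w) ->
  {for z, continuous f} -> {for z, continuous g}.
Proof.
move=> /nbhsC[d d0 hd] /continuousC cf; apply/continuousC => e e0.
have [d' d'0 hd'] := cf e e0.
exists (Num.min d d') => [|w]; first by rewrite lt_min d0.
rewrite lt_min => /andP[wd wd']; rewrite -!hd ?subrr ?absC0//; exact: hd'.
Qed.

Lemma near_eq_differentiableC (f g : C -> C) z : (\forall w \near z, f w = g w) ->
  differentiable f z -> differentiable g z.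
Proof.
move=> fg /derivable1_diffP df; apply/derivable1_diffP.
by apply: near_eq_derivable df => //; exact: oner_neq0.
Qed.

(** The quotient takes the derivative of f as its value at a and is thereby continuous there. Its
    differentiability at a is left open: a joins the exceptional points, which Goursat's theorem
    tolerates. *)
Lemma divide_zero (D : set C) (f : C -> C) (E : seq C) (a : C) :
  (forall z, D z -> {for z, continuous f}) ->
  (forall z, D z -> z \notin E -> differentiable f z) ->
  D a -> a \notin E -> f a = 0 ->
  exists g : C -> C, [/\ forall z, D z -> {for z, continuous g},
    forall z, D z -> z \notin a :: E -> differentiable g z &
    forall z, f z = (z - a) * g z].
Proof.
move=> cf df Da aE fa0.
have [l hl] := differentiableC (df a Da aE).
pose g z := if z == a then l else f z * (z - a)^-1.
have gne z : z != a -> \forall w \near z, f w * (w - a)^-1 = g w.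
  by move=> /near_neqC; apply: filterS => w wa; rewrite /g (negbTE wa).
exists g; split=> [z Dz|z Dz|z].
- have [->|za] := eqVneq z a.
    apply/continuousC => e e0.
    have e2 : 0 < e / 2 by rewrite divr_gt0.
    have [d d0 hd] := hl _ e2; exists d => // w wd.
    rewrite /g eqxx; case: eqVneq => [|wa]; first by rewrite subrr absC0.
    have wa0 : w - a != 0 by rewrite subr_eq0.
    have := hd w wd; rewrite fa0 subr0 => h.
    have -> : f w * (w - a)^-1 - l = (f w - l * (w - a)) * (w - a)^-1.
      by rewrite mulrBl mulfK.
    rewrite absCM absCV ltr_pdivrMr ?absC_gt0//; apply: le_lt_trans h _.
    by rewrite ltr_pM2r ?absC_gt0//; lra.
  apply: near_eq_continuousC (gne _ za) _.
  apply: continuousM; first exact: cf.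
  apply: continuousV; first by rewrite subr_eq0.
  by apply: continuousB; [exact: cvg_id|exact: cst_continuous].
- rewrite inE negb_or => /andP[za zE].
  apply: near_eq_differentiableC (gne _ za) _.
  apply: differentiableM; first exact: df.
  by apply: differentiableV; rewrite ?subr_eq0//; apply: differentiableB.
- rewrite /g; case: eqVneq => [->|za]; first by rewrite fa0 subrr mul0r.
  by rewrite mulrCA mulfV ?mulr1// subr_eq0.
Qed.

Lemma divide_zeros (D : set C) (f : C -> C) (s : seq C) :
  (forall z, D z -> differentiable f z) -> uniq s ->
  {in s, forall a, D a /\ f a = 0} ->
  exists g : C -> C, [/\ forall z, D z -> {for z, continuous g},
    forall z, D z -> z \notin s -> differentiable g z &
    forall z, f z = (\prod_(a <- s) (z - a)) * g z].
Proof.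
move=> df; elim: s => [_ _|a s IH /= /andP[as_ us] hs].
  exists f; split=> [z /df /differentiable_continuous//|z /df//|z].
  by rewrite big_nil mul1r.
have [|g [cg dg hg]] := IH us; first by move=> x xs; apply: hs; rewrite inE xs orbT.
have [Da fa0] : D a /\ f a = 0 by apply: hs; rewrite inE eqxx.
have ga0 : g a = 0.
  (* The zeros are distinct, so the product does not vanish at a and the zero of f passes to g. *)
  apply/eqP; move/eqP: fa0; rewrite hg mulf_eq0 => /orP[|//].
  rewrite prodf_seq_eq0 => /hasP[x xs /=]; rewrite subr_eq0 => /eqP xa.
  by move: as_; rewrite xa xs.
have [h [ch dh hh]] := divide_zero cg dg Da as_ ga0.
by exists h; split=> // z; rewrite big_cons hg hh mulrCA mulrA.
Qed.

Lemma ReV (z : C) : Re z^-1 = Re z / (Re z ^+ 2 + Im z ^+ 2).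
Proof. by case: z. Qed.
Lemma ImV (z : C) : Im z^-1 = - (Im z / (Re z ^+ 2 + Im z ^+ 2)).
Proof. by case: z. Qed.

Lemma onbd_gap a b s r (c z : C) : 0 <= r -> a + r <= Re c -> Re c + r <= a + s ->
  b + r <= Im c -> Im c + r <= b + s -> onbd a b s z -> r <= absC (z - c).
Proof.
move=> r0 c1 c2 c3 c4 [/andP[z1 z2] [/andP[z3 z4] hz]].
have hR := le_trans (ler_norm _) (Re_le_absC (z - c)).
have hI := le_trans (ler_norm _) (Im_le_absC (z - c)).
have hR' := le_trans (ler_norm _) (Re_le_absC (c - z)).
have hI' := le_trans (ler_norm _) (Im_le_absC (c - z)).
rewrite (absCB c z) in hR'; rewrite (absCB c z) in hI'.
rewrite ReD ReN in hR; rewrite ReD ReN in hR'.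
rewrite ImD ImN in hI; rewrite ImD ImN in hI'.
by move: hR hI hR' hI'; case: hz => [|[|[|]]] -> *; lra.
Qed.

(** The imaginary part is positive: every side contributes with a nonnegative sign, and the bottom
    side strictly. This spares the evaluation to 2 pi i. *)
Lemma Bd_kernel_neq0 a b s (c : C) : a < Re c < a + s -> b < Im c < b + s ->
  square_int (fun z => (z - c)^-1) a b s != 0.
Proof.
move=> /andP[c1 c2] /andP[c3 c4].
have s0 : 0 < s by lra.
pose K := fun z : C => (z - c)^-1.
have cK : contBd K a b s.
  move=> z [/andP[z1 z2] [/andP[z3 z4] hz]].
  have zc : z != c.
    apply/eqP => zc; rewrite zc in hz.
    by case: hz => [|[|[|]]] h; lra.
  apply: continuousV; first by rewrite subr_eq0.
  by apply: continuousB; [exact: cvg_id|exact: cst_continuous].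
have pos : 0 < Im (square_int K a b s).
  rewrite /square_int !(ImD,ImN,ImM,ReD,ReN) /= mul0r mul1r.
  have [_ k1] := adm_bottom (ltW s0) cK.
  have [_ k2] := adm_top (ltW s0) cK.
  have [k3 _] := adm_right (ltW s0) cK.
  have [k4 _] := adm_left (ltW s0) cK.
  have q0 (u v : R) : 0 <= u ^+ 2 + v ^+ 2 by rewrite addr_ge0 ?sqr_ge0.
  have l1 : 0 < seg_int a (a + s) (fun x => Im (K (mkC x b))).
    apply: (@J_gt0 _ a (a + s) _ a); [lra|exact: k1| |by apply/andP; split; lra|].
      move=> x _; rewrite /K ImV ImD ImN ReD ReN /= -mulNr divr_ge0//; lra.
    rewrite /K ImV ImD ImN ReD ReN /= -mulNr divr_gt0//; first lra.
    by rewrite ltr_pwDr ?sqr_ge0// exprn_even_gt0//= subr_eq0 lt_eqF.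
  have l2 : seg_int a (a + s) (fun x => Im (K (mkC x (b + s)))) <= 0.
    rewrite -[0](mul0r (a + s - a)) -J_cst; last lra.
    apply: le_J; [exact: k2|exact: cont_seg_cst|].
    by move=> x _; rewrite /K ImV ImD ImN ReD ReN /= oppr_le0 divr_ge0//; lra.
  have l3 : 0 <= seg_int b (b + s) (fun y => Re (K (mkC (a + s) y))).
    rewrite -[0](mul0r (b + s - b)) -J_cst; last lra.
    apply: le_J; [exact: cont_seg_cst|exact: k3|].
    by move=> x _; rewrite /K ReV ImD ImN ReD ReN /= divr_ge0//; lra.
  have l4 : seg_int b (b + s) (fun y => Re (K (mkC a y))) <= 0.
    rewrite -[0](mul0r (b + s - b)) -J_cst; last lra.
    apply: le_J; [exact: k4|exact: cont_seg_cst|].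
    move=> x _; rewrite /K ReV ImD ImN ReD ReN /= -oppr_ge0 -mulNr divr_ge0//; lra.
  by rewrite add0r /cseg_int /complexify /=; lra.
by apply: contraTneq pos => ->; rewrite ltxx.
Qed.

Definition square_in (D : set C) a b s := forall z : C,
  a <= Re z <= a + s -> b <= Im z <= b + s -> D z.

(** Goursat's theorem for the quotient (g z - g c) / (z - c). The constant K is fixed before g, its
    exceptional points and M, so that one K serves all the quotients by growing sets of zeros in the
    identity theorem. *)
Lemma Cauchy_estimate (D : set C) a b s r (c : C) : 0 < r ->
  a + r <= Re c -> Re c + r <= a + s -> b + r <= Im c -> Im c + r <= b + s ->
  square_in D a b s ->
  exists2 K, 0 <= K & forall (g : C -> C) (E : seq C) M,
    (forall z, D z -> {for z, continuous g}) ->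
    (forall z, D z -> z \notin E -> differentiable g z) -> c \notin E ->
    (forall z, onbd a b s z -> absC (g z) <= M) -> absC (g c) <= K * M.
Proof.
move=> r0 c1 c2 c3 c4 sD.
have s0 : 0 < s by lra.
have Kn0 : square_int (fun z => (z - c)^-1) a b s != 0.
  by apply: Bd_kernel_neq0; apply/andP; split; lra.
exists (8 * r^-1 * s / absC (square_int (fun z => (z - c)^-1) a b s)).
  by rewrite divr_ge0 ?absC_ge0// !mulr_ge0 ?invr_ge0 ?(ltW r0) ?(ltW s0).
move=> g E M cg dg cE gM.
have Dc : D c by apply: sD; apply/andP; split; lra.
have cgc z : D z -> {for z, continuous (fun z => g z - g c)}.
  by move=> Dz; apply: continuousB; [exact: cg|exact: cst_continuous].
have dgc z : D z -> z \notin E -> differentiable (fun z => g z - g c) z.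
  by move=> Dz zE; apply: differentiableB => //; exact: dg.
have [phi [cphi dphi hphi]] := divide_zero cgc dgc Dc cE (subrr (g c)).
have cQ : contQ phi a b s by move=> z z1 z2; apply: cphi; exact: sD.
have B0 : square_int phi a b s = 0.
  by apply: (@Goursat _ phi a b s (c :: E)) => // z z1 z2; apply: dphi; exact: sD.
have znc z : onbd a b s z -> z != c.
  move=> hz; have := onbd_gap (ltW r0) c1 c2 c3 c4 hz.
  by apply: contraTneq => ->; rewrite subrr absC0 -ltNge.
have cK : contBd (fun z => (z - c)^-1) a b s.
  move=> z hz; apply: continuousV; first by rewrite subr_eq0 znc.
  by apply: continuousB; [exact: cvg_id|exact: cst_continuous].
have cB : contBd phi a b s := contQ_Bd cQ.
have cKg : contBd (fun z => g c * (z - c)^-1) a b s.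
  by move=> z hz; apply: continuousM; [exact: cst_continuous|exact: cK].
have cG : contBd (fun z => phi z - (- g c) * (z - c)^-1) a b s.
  move=> z hz; apply: continuousB; first exact: cB.
  by apply: continuousM; [exact: cst_continuous|exact: cK].
(* On the boundary the integrand is g z / (z - c); as [phi] integrates to 0, this is Cauchy's
   formula with the kernel integral in place of 2 pi i. *)
have e1 : square_int (fun z => phi z - (- g c) * (z - c)^-1) a b s =
    g c * square_int (fun z => (z - c)^-1) a b s.
  rewrite (BdB (psi := fun z => (- g c) * (z - c)^-1) (ltW s0) cB).
    by rewrite B0 (BdZ _ (ltW s0) cK) sub0r mulNr opprK.
  by move=> z hz; apply: continuousM; [exact: cst_continuous|exact: cK].
have e2 : absC (g c * square_int (fun z => (z - c)^-1) a b s) <= 8 * (M * r^-1) * s.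
  rewrite -e1; apply: absBd_le => //; first exact: ltW.
  move=> z hz; have zc : z - c != 0 by rewrite subr_eq0 znc.
  have -> : phi z - (- g c) * (z - c)^-1 = g z * (z - c)^-1.
    by apply: (mulIf zc); rewrite mulrBl !mulfVK// mulrC -hphi opprK subrK.
  rewrite absCM absCV; apply: ler_pM; rewrite ?absC_ge0 ?invr_ge0 ?absC_ge0//.
    exact: gM.
  have := onbd_gap (ltW r0) c1 c2 c3 c4 hz => h.
  by rewrite lef_pV2// posrE; lra.
move: e2; rewrite absCM => e2.
have p : 0 < absC (square_int (fun z => (z - c)^-1) a b s) by rewrite absC_gt0.
rewrite mulrAC ler_pdivlMr//; apply: le_trans e2 _.
by rewrite le_eqVlt; apply/orP; left; apply/eqP; ring.
Qed.

End CauchyEstimate.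

(** * The identity theorem in one variable *)

Section IdentityTheorem.
Variable R : realType.
Local Notation C := (Cplx R).
Local Notation Re := (@complex.Re R).
Local Notation Im := (@complex.Im R).

Lemma cont_seg_bounded (a b : R) f : cont_seg a b f ->
  exists M, forall x, a <= x <= b -> `|f x| <= M.
Proof.
move=> cf; have [ab|ba] := leP a b; last first.
  by exists 0 => x /andP[ax xb]; have := le_lt_trans (le_trans ax xb) ba; rewrite ltxx.
have [|c _ hc] := @EVT_max R (fun x => `|f x|) a b ab.
  apply: continuous_in_subspaceT => x; rewrite inE /= in_itv /= => /cf h.
  by apply: continuous_comp => //; exact: norm_continuous.
by exists `|f c| => x xab; apply: hc; rewrite in_itv.
Qed.

Lemma admC_bounded (a b : R) (f : R -> C) : admC (cont_seg a b) f ->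
  exists M, forall x, a <= x <= b -> absC (f x) <= M.
Proof.
move=> [/cont_seg_bounded[M hM] /cont_seg_bounded[N hN]]; exists (M + N) => x xab.
by apply: (le_trans (absC_le _)); rewrite lerD ?hM ?hN.
Qed.

Lemma contBd_bounded (f : C -> C) a b s : 0 <= s -> contBd f a b s ->
  exists M, forall z, onbd a b s z -> absC (f z) <= M.
Proof.
move=> s0 cf.
have [M1 h1] := admC_bounded (adm_bottom s0 cf).
have [M2 h2] := admC_bounded (adm_top s0 cf).
have [M3 h3] := admC_bounded (adm_left s0 cf).
have [M4 h4] := admC_bounded (adm_right s0 cf).
have n1 := normr_ge0 M1; have n2 := normr_ge0 M2.
have n3 := normr_ge0 M3; have n4 := normr_ge0 M4.
have m1 := ler_norm M1; have m2 := ler_norm M2.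
have m3 := ler_norm M3; have m4 := ler_norm M4.
exists (`|M1| + `|M2| + `|M3| + `|M4|) => z [z1 [z2 hz]].
rewrite (mkC_eta z); case: hz => [|[|[|]]] ->.
- by apply: le_trans (h3 _ z2) _; lra.
- by apply: le_trans (h4 _ z2) _; lra.
- by apply: le_trans (h1 _ z1) _; lra.
- by apply: le_trans (h2 _ z1) _; lra.
Qed.

Lemma absC_prod_le (s : seq C) x B : 0 <= B -> {in s, forall a, absC (x - a) <= B} ->
  absC (\prod_(a <- s) (x - a)) <= B ^+ size s.
Proof.
move=> B0; elim: s => [_|a s IH h]; first by rewrite big_nil absC1 expr0.
rewrite big_cons absCM exprS ler_pM ?absC_ge0//.
  by apply: h; rewrite inE eqxx.
by apply: IH => y ys; apply: h; rewrite inE ys orbT.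
Qed.

Lemma absC_prod_ge (s : seq C) x B : 0 <= B -> {in s, forall a, B <= absC (x - a)} ->
  B ^+ size s <= absC (\prod_(a <- s) (x - a)).
Proof.
move=> B0; elim: s => [_|a s IH h]; first by rewrite big_nil absC1 expr0.
rewrite big_cons absCM exprS ler_pM ?exprn_ge0//.
  by apply: h; rewrite inE eqxx.
by apply: IH => y ys; apply: h; rewrite inE ys orbT.
Qed.

(* Dividing f by k of its zeros near 0 and estimating the quotient on the boundary
   of [-4,4]^2 gives |f c| <= const / 2^k. *)
Lemma identity_disc (f : C -> C) (de : R) (c : C) : 0 < de ->
  (forall z, absC z < 6 -> differentiable f z) ->
  (forall t, 0 <= t -> t <= de -> f (mkC t 0) = 0) -> absC c <= 1 -> f c = 0.
Proof.
move=> de0 df f0 c1.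
(* Shrinking the interval of zeros is no loss, and de <= 1 places the points [aj] below in (0,
   1/2]. *)
wlog de1 : de de0 f0 / de <= 1.
  move=> H; apply: (H (Num.min de 1)).
  - by rewrite lt_min de0 ltr01.
  - by move=> t t0; rewrite le_min => /andP[td _]; exact: f0.
  - by rewrite ge_min lexx orbT.
(* The disc contains the square [-4, 4]^2, whose corners have modulus 4 sqrt 2 < 6. *)
pose D := [set z : C | absC z < 6].
have QD : square_in D (- 4) (- 4) 8.
  move=> z /andP[z1 z2] /andP[z3 z4]; rewrite /D /=.
  rewrite -(@ltr_pXn2r _ 2) ?nnegrE ?absC_ge0//.
  rewrite absCE sqr_sqrtr ?addr_ge0 ?sqr_ge0//.
  have h1 : Re z ^+ 2 <= 16 by nra.
  have h2 : Im z ^+ 2 <= 16 by nra.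
  apply: (le_lt_trans (lerD h1 h2)); lra.
have := le_trans (Re_le_absC c) c1; have := le_trans (Im_le_absC c) c1.
rewrite !ler_norml => /andP[i1 i2] /andP[r1 r2].
have r3 : 0 < 3 :> R by [].
have [||||K K0 hK] := @Cauchy_estimate _ D (-4) (-4) 8 3 c r3 _ _ _ _ QD; [lra|lra|lra|lra|].
have cf z : D z -> {for z, continuous f}.
  by move=> Dz; apply: differentiable_continuous; exact: df.
have [M hM] : exists M, forall z, onbd (-4) (-4) 8 z -> absC (f z) <= M.
  by apply: contBd_bounded => // z [z1 [z2 _]]; apply: cf; exact: QD.
(* Distinct zeros of f, at distance at least 3 from the boundary of the square and at most 3/2 from
   c: each division gains a factor (3/2) / 3 = 1/2. The shift to j + 2 keeps them in (0, 1/2]. *)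
pose aj (j : nat) : C := mkC (de / j.+2%:R) 0.
have aj0 j : 0 <= de / j.+2%:R by rewrite divr_ge0 ?ltW.
have aj1 j : de / j.+2%:R <= 1 / 2.
  apply: (@le_trans _ _ (1 / j.+2%:R)); first by rewrite ler_pM2r ?invr_gt0.
  by rewrite !div1r lef_pV2 ?posrE// ler_nat.
have ajI : injective aj.
  move=> i j [] /(mulfI (lt0r_neq0 de0)) /invr_inj /eqP.
  by rewrite eqr_nat => /eqP [].
have faj j : f (aj j) = 0.
  apply: f0 => //; rewrite ler_pdivrMr// ler_peMr ?(ltW de0)//.
  by rewrite ler1n.
(* The Cauchy estimate requires c to lie outside the exceptional points. *)
have [[j ->]|cnot] := pselect (exists j, c = aj j); first exact: faj.
apply/eqP; rewrite -absC_eq0 eq_le absC_ge0 andbT leNgt; apply/negP => fc.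
have [k] := exists_half_lt (K * M) fc; rewrite ltNge => /negP; apply.
pose s := [seq aj j | j <- iota 0 k].
have ss : size s = k by rewrite size_map size_iota.
have [|||g [cg dg hg]] := @divide_zeros _ D f s.
- by move=> z; exact: df.
- by rewrite map_inj_uniq ?iota_uniq.
- move=> _ /mapP[j _ ->]; split=> //; rewrite /D /= absC_mk0 ger0_norm//.
  by apply: le_lt_trans (aj1 j) _; lra.
have cs : c \notin s by apply/negP => /mapP[j _ cj]; apply: cnot; exists j.
have gM z : onbd (-4) (-4) 8 z -> absC (g z) <= M / 3 ^+ k.
  move=> hz; rewrite ler_pdivlMr ?exprn_gt0//; apply: le_trans (hM z hz).
  rewrite hg absCM mulrC ler_wpM2r ?absC_ge0// -ss absC_prod_ge//.
  move=> _ /mapP[j _ ->]; have := aj0 j; have := aj1 j => h1 h2.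
  by apply: (onbd_gap _ _ _ _ _ hz) => //=; move: (de / _) h1 h2 => q h1 h2; lra.
have := hK g s _ cg dg cs gM => gc.
rewrite hg absCM.
have pc : absC (\prod_(a <- s) (c - a)) <= (3 / 2) ^+ k.
  rewrite -ss; apply: absC_prod_le; first lra.
  move=> _ /mapP[j _ ->]; apply: (le_trans (absCD _ _)).
  by rewrite absCN absC_mk0 ger0_norm//; have := aj1 j; move: (de / _) => q; lra.
apply: (@le_trans _ _ ((3 / 2) ^+ k * (K * (M / 3 ^+ k)))).
  by rewrite ler_pM ?absC_ge0.
have k3 : 3 ^+ k != 0 :> R by rewrite expf_neq0//; lra.
have k2 : 2 ^+ k != 0 :> R by rewrite expf_neq0//; lra.
rewrite expr_div_n le_eqVlt; apply/orP; left; apply/eqP; field.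
by rewrite k3 k2.
Qed.

End IdentityTheorem.

(** * The identity theorem in several variables *)

Section SeveralVariables.
Variables (R : realType) (n : nat).
Local Notation C := (Cplx R).
Local Notation Re := (@complex.Re R).
Local Notation Im := (@complex.Im R).
Local Notation emb := (@real_part_embedding R n).

Lemma nbhs_rowC (z : 'rV[C]_n) (P : 'rV[C]_n -> Prop) :
  (\forall w \near z, P w) <->
  exists2 r : R, 0 < r & forall w : 'rV[C]_n, (forall j, absC (w 0 j - z 0 j) < r) -> P w.
Proof.
split.
  move=> /nbhs_ballP[e /= e0 he].
  have [r0 ee] := ltC_gt0 e0; exists (Re e) => // w wz.
  apply: he; split=> // i j; rewrite ord1 -ball_normE /= distrC ee lt_normC; exact: wz.
move=> [r r0 hr]; apply/nbhs_ballP; exists (mkC r 0) => /=; first by rewrite mkC_gt0.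
move=> w [_ wz]; apply: hr => j; have := wz 0 j.
by rewrite -ball_normE /= distrC lt_normC.
Qed.

Lemma nbhs_rowR (z : 'rV[R]_n) (P : 'rV[R]_n -> Prop) :
  (\forall w \near z, P w) <->
  exists2 r : R, 0 < r & forall w : 'rV[R]_n, (forall j, `|w 0 j - z 0 j| < r) -> P w.
Proof.
split.
  move=> /nbhs_ballP[e /= e0 he]; exists e => // w wz.
  apply: he; split=> // i j; rewrite ord1 /ball /= distrC; exact: wz.
move=> [r r0 hr]; apply/nbhs_ballP; exists r => //=.
by move=> w [_ wz]; apply: hr => j; have := wz 0 j; rewrite /ball /= distrC.
Qed.

Lemma differentiable_line (f : 'rV[C]_n -> C) (p v : 'rV[C]_n) (t : C) :
  differentiable f (p + t *: v) -> differentiable (fun t : C => f (p + t *: v)) t.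
Proof.
move=> df; apply: (@differentiable_comp _ _ _ _ (fun t : C => p + t *: v) f) => //.
Qed.

(** Connectedness argument with the interior [Z] of the zero set. The one-variable theorem on
    complex lines does the rest: lines through real points show that [Z] is nonempty, lines through
    points of [Z] that it is closed in [W]. *)
Lemma identity_rV (W : set 'rV[C]_n) (U : set 'rV[R]_n) (f : 'rV[C]_n -> C) :
  open W -> connected W -> open U -> U !=set0 -> emb @` U `<=` W ->
  holomorphic_on W f -> (forall x, U x -> f (emb x) = 0) ->
  forall z, W z -> f z = 0.
Proof.
move=> oW cW oU [x0 Ux0] UW hf f0.
pose Z : set 'rV[C]_n := [set z | \forall w \near z, f w = 0].
suff WZ : W `&` Z = W.
  by move=> z; rewrite -{1}WZ => -[_] /nbhs_singleton.
have oZ : open Z by rewrite openE => z /near_join.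
apply: cW.
- exists (emb x0); split; first by apply: UW; exists x0.
  have [r1 r10 h1] : exists2 r : R, 0 < r & forall w : 'rV[C]_n, (forall j, absC (w 0 j - emb x0 0 j) < r) -> W w.
    by apply/nbhs_rowC; apply: open_nbhs_nbhs; split => //; apply: UW; exists x0.
  have [r2 r20 h2] : exists2 r : R, 0 < r & forall w : 'rV[R]_n, (forall j, `|w 0 j - x0 0 j| < r) -> U w.
    by apply/nbhs_rowR; apply: open_nbhs_nbhs.
  pose r := Num.min r1 r2.
  have r0 : 0 < r by rewrite lt_min r10.
  have rr1 : r <= r1 by rewrite ge_min lexx.
  have rr2 : r <= r2 by rewrite ge_min lexx orbT.
  (* Parameters of modulus below 6 must stay in the neighbourhood: r / 16 + 6 r / 16 < r. *)
  apply/nbhs_rowC; exists (r / 16) => [|w hw]; first by rewrite divr_gt0.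
  pose a : 'rV[R]_n := \row_j Re (w 0 j).
  pose b : 'rV[R]_n := \row_j Im (w 0 j).
  have ha j : `|a 0 j - x0 0 j| < r / 16.
    apply: le_lt_trans (hw j); rewrite !mxE.
    by have := Re_le_absC (w 0 j - (x0 0 j)%:C%C); rewrite ReD ReN.
  have hb j : `|b 0 j| < r / 16.
    apply: le_lt_trans (hw j); rewrite !mxE.
    by have := Im_le_absC (w 0 j - (x0 0 j)%:C%C); rewrite ImD ImN /= subr0.
  (* The complex line t -> a + t b is real for real t and reaches w at t = i. *)
  have wE : w = emb a + mkC 0 1 *: emb b.
    apply/rowP => j; rewrite !mxE; apply: eqC; rewrite ?(ReD,ImD,ReM,ImM) /=; ring.
  rewrite wE; apply: (@identity_disc _ (fun t => f (emb a + t *: emb b)) 1) => //.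
  + move=> t t6; apply: differentiable_line; apply: hf; apply: h1 => j.
    rewrite !mxE.
    have -> : (Re (w 0 j))%:C%C + t * (Im (w 0 j))%:C%C - (x0 0 j)%:C%C =
      mkC (a 0 j - x0 0 j) 0 + t * mkC (b 0 j) 0 :> C.
      by rewrite !mxE; apply: eqC; rewrite ?(ReD,ImD,ReM,ImM,ReN,ImN) /=; ring.
    apply: le_lt_trans (absCD _ _) _; rewrite absCM !absC_mk0.
    have h3 : absC t * `|b 0 j| <= 6 * (r / 16).
      by rewrite ler_pM ?absC_ge0// ltW.
    apply: lt_le_trans rr1; apply: (lt_le_trans (ltr_leD (ha j) h3)); lra.
  + move=> t t0 t1.
    have -> : emb a + mkC t 0 *: emb b = emb (a + t *: b).
      apply/rowP => j; rewrite !mxE; apply: eqC; rewrite ?(ReD,ImD,ReM,ImM) /=; ring.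
    apply: f0; apply: h2 => j; rewrite !mxE -/(Re (w 0 j)).
    have -> : Re (w 0 j) + t * Im (w 0 j) - x0 0 j = (a 0 j - x0 0 j) + t * b 0 j.
      by rewrite !mxE; ring.
    apply: le_lt_trans (ler_normD _ _) _; rewrite normrM (ger0_norm t0).
    have h3 : t * `|b 0 j| <= 1 * (r / 16) by rewrite ler_pM// ltW.
    apply: lt_le_trans rr2; apply: (lt_le_trans (ltr_leD (ha j) h3)); lra.
  + by rewrite absC_0mk normr1.
- by exists Z.
- exists (closure Z); first exact: closed_closure.
  rewrite eqEsubset; split=> [z [Wz Zz]|z [Wz cZz]]; first by split=> //; exact: subset_closure.
  split=> //.
  have [r r0 h1] : exists2 r : R, 0 < r & forall w : 'rV[C]_n, (forall j, absC (w 0 j - z 0 j) < r) -> W w.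
    by apply/nbhs_rowC; exact: open_nbhs_nbhs.
  have [p [Zp hp]] : exists p, Z p /\ forall j, absC (p 0 j - z 0 j) < r / 16.
    have : nbhs z [set p : 'rV[C]_n | forall j, absC (p 0 j - z 0 j) < r / 16].
      by apply/nbhs_rowC; exists (r / 16) => //; rewrite divr_gt0.
    by move=> /cZz[p [Zp hp]]; exists p.
  have [e e0 he] : exists2 e : R, 0 < e & forall w : 'rV[C]_n, (forall j, absC (w 0 j - p 0 j) < e) -> f w = 0.
    by apply/nbhs_rowC.
  apply/nbhs_rowC; exists (r / 16) => [|w hw]; first by rewrite divr_gt0.
  have hv j : absC ((w - p) 0 j) < r / 8.
    rewrite !mxE; have -> : w 0 j - p 0 j = (w 0 j - z 0 j) - (p 0 j - z 0 j).
      by rewrite opprB addrA subrK.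
    apply: le_lt_trans (absCD _ _) _; rewrite absCN.
    by have := hw j; have := hp j; lra.
  have -> : w = p + 1 *: (w - p) by rewrite scale1r addrC subrK.
  (* On the line from p to w the function vanishes for small real parameters, because f is 0 around
     p; parameter 1 is w. *)
  apply: (@identity_disc _ (fun t => f (p + t *: (w - p))) (e / r)) => //.
  + by rewrite divr_gt0.
  + move=> t t6; apply: differentiable_line; apply: hf; apply: h1 => j.
    have -> : (p + t *: (w - p)) 0 j - z 0 j = (p 0 j - z 0 j) + t * (w - p) 0 j.
      by rewrite !mxE addrAC.
    apply: le_lt_trans (absCD _ _) _; rewrite absCM.
    have h3 : absC t * absC ((w - p) 0 j) <= 6 * (r / 8).
      by rewrite ler_pM ?absC_ge0// ltW.
    have := hp j; lra.
  + move=> t t0 te; apply: he => j.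
    have -> : (p + mkC t 0 *: (w - p)) 0 j - p 0 j = mkC t 0 * (w - p) 0 j.
      by rewrite !mxE addrAC subrr add0r.
    rewrite absCM absC_mk0 ger0_norm//.
    apply: (@le_lt_trans _ _ (e / r * (r / 8))).
      by rewrite ler_pM ?absC_ge0// ltW.
    have -> : e / r * (r / 8) = e / 8 by field; rewrite gt_eqF.
    lra.
  + by rewrite absC1.
Qed.

End SeveralVariables.

(** * Derivatives along coordinate directions *)

Section DirectionalDerivatives.
Variables (R : realType) (V : normedModType R).
Implicit Types (f g : V -> R) (x v : V).

(** Restriction to a line gives access to the one-variable chain rule and mean value theorem. *)
Lemma is_derive_lineP f x v d :
  is_derive x v f d <-> is_derive (0 : R) (1 : R) (fun h : R => f (h *: v + x)) d.
Proof.
have e : (fun h : R => h^-1 *: ((f \o shift x) (h *: v) - f x)) =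
  (fun h : R => h^-1 *: (((fun h : R => f (h *: v + x)) \o shift 0) (h *: (1:R)) - f (0 *: v + x))).
  by apply: funext => h /=; rewrite addr0 scale0r add0r [_%:A]mulr1.
split=> -[d1 d2]; split; rewrite /derivable /derive in d1 d2 *.
- by rewrite -e.
- by rewrite -e.
- by rewrite e.
- by rewrite e.
Qed.

Lemma isdM f g x v df dg : is_derive x v f df -> is_derive x v g dg ->
  is_derive x v (fun y => f y * g y) (f x * dg + g x * df).
Proof. by move=> hf hg; have := is_deriveM hf hg. Qed.

Lemma isdD f g x v df dg : is_derive x v f df -> is_derive x v g dg ->
  is_derive x v (fun y => f y + g y) (df + dg).
Proof. by move=> hf hg; have := is_deriveD hf hg. Qed.

Lemma isd_cst (k : R) x v : is_derive x v (fun=> k) 0.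
Proof. exact: is_derive_cst. Qed.

Lemma isdZ (k : R) f x v df : is_derive x v f df -> is_derive x v (fun y => k * f y) (k * df).
Proof.
by move=> hf; apply: is_derive_eq (isdM (isd_cst k x v) hf) _; rewrite mulr0 addr0.
Qed.

Lemma isd_sum n (h : 'I_n -> V -> R) x v (dh : 'I_n -> R) :
  (forall i, is_derive x v (h i) (dh i)) ->
  is_derive x v (fun y => \sum_i h i y) (\sum_i dh i).
Proof.
move=> hh; have := is_derive_sum hh.
by have -> : \sum_(i < n) h i = (fun y => \sum_i h i y) by apply: funext => y; rewrite fct_sumE.
Qed.

Lemma isdV f x v df : f x != 0 -> is_derive x v f df ->
  is_derive x v (fun y => (f y)^-1) (- ((f x)^-1 * (f x)^-1) * df).
Proof.
move=> fx hf; have [d1 d2] := hf; split; first exact: derivableV.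
by rewrite deriveV// d2 /GRing.scale /= -invfM -expr2.
Qed.

Lemma isd_comp f (g : R -> R) x v df dg : is_derive x v f df ->
  is_derive (f x) (1 : R) g dg -> is_derive x v (fun y => g (f y)) (dg * df).
Proof.
move=> /is_derive_lineP hf hg; apply/is_derive_lineP.
by apply: (@is_derive1_comp _ g (fun h : R => f (h *: v + x))) => //; rewrite scale0r add0r.
Qed.

Lemma isdX f x v df k : is_derive x v f df ->
  is_derive x v (fun y => f y ^+ k) (k%:R * f x ^+ k.-1 * df).
Proof. by move=> hf; have := is_deriveX k hf; rewrite exprfctE. Qed.

Lemma isdXV f x v df k : f x != 0 -> is_derive x v f df ->
  is_derive x v (fun y => f y ^- k) (- k%:R * f x ^- k.+1 * df).
Proof.
move=> fx hf; apply: is_derive_eq (isdV _ (isdX k hf)) _; first exact: expf_neq0.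
case: k => [|k]; first by rewrite oppr0 !mul0r mulr0.
rewrite /= !exprS; field.
by rewrite fx expf_neq0.
Qed.

End DirectionalDerivatives.

(** * Calculus of C^k functions on open sets *)

Section CkCalculus.
Variables (R : realType) (n : nat).
Local Notation V := 'rV[R]_n.
Local Notation e_ i := (delta_mx 0 i : V).
Implicit Types (U : set V) (f g : V -> R) (x y : V).

Lemma Ck_cont k U f : Ck k U f -> forall x, U x -> {for x, continuous f}.
Proof. by case: k => [|k] []. Qed.

Lemma Ck0P U f : Ck 0 U f <-> forall x, U x -> {for x, continuous f}.
Proof. by split=> [[]|]. Qed.

Lemma CkSP k U f : Ck k.+1 U f <-> ((forall x, U x -> {for x, continuous f}) /\
  forall i : 'I_n, (forall x, U x -> derivable f x (e_ i)) /\ Ck k U (partial i f)).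
Proof. by []. Qed.

Lemma CkS k U f : Ck k.+1 U f -> Ck k U f.
Proof.
elim: k f => [|k IH] f /CkSP[cf df]; first by split.
by apply/CkSP; split=> // i; have [d1 d2] := df i; split=> //; exact: IH.
Qed.

Lemma Ck_subset k U U' f : U' `<=` U -> Ck k U f -> Ck k U' f.
Proof.
move=> UU; elim: k f => [|k IH] f [cf df]; split=> //.
- by move=> x /UU; exact: cf.
- by move=> x /UU; exact: cf.
move=> i; have [d1 d2] := df i; split=> [x /UU/d1//|]; exact: IH.
Qed.

Lemma CkU k U U' f : Ck k U f -> Ck k U' f -> Ck k (U `|` U') f.
Proof.
elim: k f => [|k IH] f [cf df] [cf' df']; split=> //.
- by move=> x [/cf|/cf'].
- by move=> x [/cf|/cf'].
- move=> i; have [d1 d2] := df i; have [d3 d4] := df' i.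
  by split; [move=> x [/d1|/d3]|exact: IH].
Qed.

Lemma near_eq_continuous_rV (f g : V -> R) x : (\forall y \near x, f y = g y) ->
  {for x, continuous f} -> {for x, continuous g}.
Proof.
move=> fg cf; have e : f x = g x := nbhs_singleton fg.
have : f @ x --> g x by rewrite -e.
apply: cvg_trans; apply: (@near_eq_cvg _ _ (nbhs x)).
by apply: filterS fg => y ->.
Qed.

Lemma near_eq_partial (f g : V -> R) i x : (\forall y \near x, f y = g y) ->
  \forall y \near x, partial i f y = partial i g y.
Proof.
move=> /near_join; apply: filterS => y; exact: near_eq_derive.
Qed.

Lemma Ck_eq k U f g : open U -> (forall x, U x -> f x = g x) -> Ck k U f -> Ck k U g.
Proof.
move=> oU.
have nU x : U x -> \forall y \near x, U y by move=> Ux; exact: open_nbhs_nbhs.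
elim: k f g => [|k IH] f g fg [cf df].
  split=> // x Ux; apply: near_eq_continuous_rV (cf x Ux).
  by apply: filterS (nU x Ux).
have nfg x : U x -> \forall y \near x, f y = g y by move=> /nU; apply: filterS.
apply/CkSP; split=> [x Ux|i]; first exact: near_eq_continuous_rV (nfg x Ux) (cf x Ux).
have [d1 d2] := df i; split=> [x Ux|].
  exact: near_eq_derivable (nfg x Ux) (d1 x Ux).
apply: IH d2 => x Ux; exact: nbhs_singleton (near_eq_partial i (nfg x Ux)).
Qed.

(** [partial i f] is a limit operator on all points; this rule lets a closed formula stand for it on
    the open set, so that each closure property below becomes an induction on k. *)
Lemma Ck_intro k U f (df : 'I_n -> V -> R) : open U ->
  (forall x, U x -> {for x, continuous f}) ->
  (forall i x, U x -> is_derive x (e_ i) f (df i x)) ->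
  (forall i, Ck k U (df i)) -> Ck k.+1 U f.
Proof.
move=> oU cf hdf cdf; apply/CkSP; split=> // i; split=> [x Ux|].
  by case: (hdf i x Ux).
by apply: Ck_eq (cdf i) => // x Ux; case: (hdf i x Ux).
Qed.

Lemma Ck_partial k U f i x : Ck k.+1 U f -> U x -> is_derive x (e_ i) f (partial i f x).
Proof. by move=> /CkSP[_ /(_ i)[d _]] Ux; split=> //; exact: d. Qed.

Lemma Ck_partialS k U f i : Ck k.+1 U f -> Ck k U (partial i f).
Proof. by move=> /CkSP[_ /(_ i)[]]. Qed.

Lemma Ck_cst k U (c : R) : open U -> Ck k U (fun=> c).
Proof.
move=> oU; elim: k c => [|k IH] c; first by split=> // x _; exact: cst_continuous.
apply: (@Ck_intro k U _ (fun _ _ => 0)) => //; first by move=> x _; exact: cst_continuous.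
Qed.

Lemma isd_coord (i j : 'I_n) (x : V) : is_derive x (e_ i) (fun y : V => y 0 j) (j == i)%:R.
Proof.
apply/is_derive_lineP.
have -> : (fun h : R => (h *: e_ i + x) 0 j) = (fun h : R => (j == i)%:R * h + x 0 j).
  by apply: funext => h; rewrite !mxE eqxx /= mulrC.
apply: is_derive_eq (isdD (isdZ _ (is_derive_id _ _)) (isd_cst _ _ _)) _.
by rewrite addr0 mulr1.
Qed.

Lemma Ck_coord k U j : open U -> Ck k U (fun y : V => y 0 j).
Proof.
move=> oU; have cc x : U x -> {for x, continuous (fun y : V => y 0 j)}.
  by move=> _; exact: coord_continuous.
case: k => [|k]; first by split.
apply: (@Ck_intro k U _ (fun i _ => (j == i)%:R)) => //.
  by move=> i x _; exact: isd_coord.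
by move=> i; exact: Ck_cst.
Qed.

Lemma CkD k U f g : open U -> Ck k U f -> Ck k U g -> Ck k U (fun x => f x + g x).
Proof.
move=> oU; elim: k f g => [|k IH] f g cf cg.
  by split=> // x Ux; apply: continuousD; [exact: (Ck_cont cf)|exact: (Ck_cont cg)].
apply: (@Ck_intro k U _ (fun i x => partial i f x + partial i g x)) => //.
- by move=> x Ux; apply: continuousD; [exact: (Ck_cont cf)|exact: (Ck_cont cg)].
- by move=> i x Ux; apply: isdD; [exact: Ck_partial cf Ux|exact: Ck_partial cg Ux].
- by move=> i; apply: IH; [exact: Ck_partialS cf|exact: Ck_partialS cg].
Qed.

Lemma CkM k U f g : open U -> Ck k U f -> Ck k U g -> Ck k U (fun x => f x * g x).
Proof.
move=> oU; elim: k f g => [|k IH] f g cf cg.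
  by split=> // x Ux; apply: continuousM; [exact: (Ck_cont cf)|exact: (Ck_cont cg)].
apply: (@Ck_intro k U _ (fun i x => f x * partial i g x + g x * partial i f x)) => //.
- by move=> x Ux; apply: continuousM; [exact: (Ck_cont cf)|exact: (Ck_cont cg)].
- by move=> i x Ux; apply: isdM; [exact: Ck_partial cf Ux|exact: Ck_partial cg Ux].
- by move=> i; apply: CkD => //; apply: IH;
    [exact: CkS|exact: Ck_partialS cg|exact: CkS|exact: Ck_partialS cf].
Qed.

Lemma CkZ k U (c : R) f : open U -> Ck k U f -> Ck k U (fun x => c * f x).
Proof. by move=> oU cf; apply: CkM => //; exact: Ck_cst. Qed.

Lemma CkB k U f g : open U -> Ck k U f -> Ck k U g -> Ck k U (fun x => f x - g x).
Proof.
move=> oU cf cg; have -> : (fun x => f x - g x) = (fun x => f x + (- 1) * g x).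
  by apply: funext => x; rewrite mulN1r.
by apply: CkD => //; exact: CkZ.
Qed.

Lemma CkX k U f p : open U -> Ck k U f -> Ck k U (fun x => f x ^+ p).
Proof.
move=> oU cf; elim: p => [|p IH]; first by exact: (@Ck_cst k U 1).
have -> : (fun x => f x ^+ p.+1) = (fun x => f x * f x ^+ p).
  by apply: funext => x; rewrite exprS.
exact: CkM.
Qed.

Lemma Ck_sum k U (h : 'I_n -> V -> R) : open U -> (forall i, Ck k U (h i)) ->
  Ck k U (fun x => \sum_i h i x).
Proof.
move=> oU ch.
have -> : (fun x => \sum_i h i x) = \sum_i h i by apply: funext => x; rewrite fct_sumE.
by elim/big_ind : _ => //; [exact: Ck_cst|move=> f g; exact: CkD].
Qed.

Lemma CkV k U f : open U -> (forall x, U x -> f x != 0) -> Ck k U f ->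
  Ck k U (fun x => (f x)^-1).
Proof.
move=> oU f0; have cV l : Ck l U f -> forall x, U x -> {for x, continuous (fun x => (f x)^-1)}.
  by move=> cf x Ux; apply: continuousV; [exact: f0|exact: (Ck_cont cf)].
elim: k => [|k IH] cf; first by split=> //; exact: cV cf.
apply: (@Ck_intro k U _ (fun i x => - 1 * ((f x)^-1 * (f x)^-1) * partial i f x)) => //.
- exact: cV cf.
- move=> i x Ux; rewrite mulN1r; apply: isdV; [exact: f0|exact: Ck_partial cf Ux].
- move=> i; have cfV := IH (CkS cf); apply: CkM => //; last exact: Ck_partialS cf.
  by apply: CkZ => //; exact: CkM.
Qed.

End CkCalculus.

Opaque Ck.

(** * A C^2 cut-off profile *)

Section PositivePart.
Variable R : realType.

Definition pos (t : R) : R := Num.max t 0.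

Lemma pos_ge0 t : 0 <= pos t.
Proof. by rewrite le_max lexx orbT. Qed.

Lemma pos_id t : 0 <= t -> pos t = t.
Proof. by move=> t0; apply/max_idPl. Qed.

Lemma pos_eq0 t : t <= 0 -> pos t = 0.
Proof. by move=> t0; apply/max_idPr. Qed.

Lemma pos_continuous : continuous pos.
Proof. by move=> t; apply: continuous_max; [exact: cvg_id|exact: cst_continuous]. Qed.

(** The only delicate point is 0, where the exponent, being at least 2, forces the difference
    quotient to 0. *)
Lemma is_derive_posX (t : R) k :
  is_derive t (1 : R) (fun t => pos t ^+ k.+2) (k.+2%:R * pos t ^+ k.+1).
Proof.
have [t0|t0|->] := ltrgtP t 0.
- rewrite pos_eq0 ?ltW// expr0n mulr0.
  apply: (@near_eq_is_derive _ _ _ (fun=> 0)).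
  apply: filterS (lt_nbhsl t0) => u u0.
  by rewrite pos_eq0 ?expr0n// ltW.
- rewrite pos_id ?ltW//.
  apply: (@near_eq_is_derive _ _ _ (fun u : R => u ^+ k.+2)).
    by apply: filterS (lt_nbhsr t0) => u u0; rewrite pos_id// ltW.
  by apply: is_derive_eq (isdX k.+2 (is_derive_id _ _)) _; rewrite mulr1.
- rewrite pos_id// expr0n mulr0.
  have c : h^-1 *: (((fun t => pos t ^+ k.+2) \o shift 0) (h *: (1 : R)) - pos 0 ^+ k.+2)
      @[h --> (0 : R)^'] --> (0 : R).
    apply/cvgrPdist_lt => e e0.
    rewrite near_withinE; apply/nbhs_ballP; exists (Num.min e 1) => /=.
      by rewrite lt_min e0 ltr01.
    move=> h; rewrite /ball /= sub0r normrN lt_min => /andP[he h1] h0.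
    rewrite addr0 [_%:A]mulr1 (pos_id (lexx 0)) expr0n /= subr0 sub0r normrN.
    rewrite /GRing.scale /= normrM normfV ltr_pdivrMl ?normr_gt0//.
    have ph : `|pos h| <= `|h|.
      by rewrite ger0_norm ?pos_ge0// /pos ge_max ler_norm normr_ge0.
    rewrite normrX 2!exprS mulrA.
    apply: (@le_lt_trans _ _ (`|h| * `|h| * 1)).
      rewrite ler_pM ?mulr_ge0 ?exprn_ge0//; first by rewrite ler_pM.
      by rewrite exprn_ile1// (le_trans ph)// ltW.
    by rewrite mulr1 ltr_pM2l// normr_gt0.
  by split; [apply/cvg_ex; exists 0|apply/cvg_lim].
Qed.

(** A transition from 1 on t <= 1 to 0 on t >= 2. The cube of the positive part is the lowest power
    that is C^2, which is all the regularity harmonicity asks for. *)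
Definition theta (t : R) : R := pos (1 - pos (t - 1) ^+ 3) ^+ 3.
Definition dtheta (t : R) : R :=
  - (9 * pos (1 - pos (t - 1) ^+ 3) ^+ 2 * pos (t - 1) ^+ 2).

Lemma theta1 t : t <= 1 -> theta t = 1.
Proof.
by move=> t1; rewrite /theta (@pos_eq0 (t - 1)) ?subr_le0// expr0n subr0 pos_id// expr1n.
Qed.

Lemma theta0 t : 2 <= t -> theta t = 0.
Proof.
move=> t2; rewrite /theta (@pos_eq0 (1 - _)) ?expr0n// pos_id; last lra.
by rewrite subr_le0 exprn_ege1//; lra.
Qed.

Lemma dtheta_le0 t : dtheta t <= 0.
Proof. by rewrite oppr_le0 !mulr_ge0 ?exprn_ge0 ?pos_ge0. Qed.

Lemma dtheta_lt0 : dtheta (3 / 2) < 0.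
Proof.
rewrite oppr_lt0 /= (@pos_id (3 / 2 - 1)); last lra.
by rewrite pos_id; rewrite ?mulr_gt0// ?exprn_gt0//; lra.
Qed.

Lemma is_derive_theta t : is_derive t (1 : R) theta (dtheta t).
Proof.
have h : is_derive t (1:R) (fun t => 1 - pos (t - 1) ^+ 3) (- (3 * pos (t - 1) ^+ 2)).
  have h1 : is_derive t (1 : R) (fun t : R => t - 1) (1 : R).
    by apply: is_derive_eq (isdD (is_derive_id _ _) (isd_cst _ _ _)) _; rewrite addr0.
  have h2 := isd_comp h1 (is_derive_posX (t - 1) 1).
  by apply: is_derive_eq (isdD (isd_cst 1 _ _) (is_deriveN h2)) _; rewrite add0r mulr1.
apply: is_derive_eq (isd_comp h (is_derive_posX _ 1)) _; rewrite /dtheta; ring.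
Qed.

End PositivePart.

(** * Radial functions and the regularised kernel *)

Section RadialFunctions.
Variables (R : realType) (n : nat).
Local Notation V := 'rV[R]_n.
Local Notation e_ i := (delta_mx 0 i : V).
Implicit Types (U : set V) (f g : V -> R) (x y a : V).

(** Each derivative costs one power, and the last one left is still continuous. *)
Lemma Ck_posX k U f : open U -> Ck k U f -> Ck k U (fun x => pos (f x) ^+ k.+1).
Proof.
move=> oU; have cc l j : Ck l U f -> forall x, U x -> {for x, continuous (fun x => pos (f x) ^+ j)}.
  move=> cf x Ux; apply: (@continuous_comp _ _ _ f (fun t => pos t ^+ j)).
    exact: (Ck_cont cf).
  apply: (@continuous_comp _ _ _ (@pos R) (fun t => t ^+ j)); first exact: pos_continuous.
  exact: exprn_continuous.
elim: k => [|k IH] cf; first by apply/Ck0P; exact: cc cf.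
apply: (@Ck_intro _ _ k U _ (fun i x => k.+2%:R * pos (f x) ^+ k.+1 * partial i f x)) => //.
- exact: cc cf.
- by move=> i x Ux; have d := Ck_partial i cf Ux; exact: (isd_comp d (is_derive_posX (f x) k)).
- move=> i; apply: CkM => //; last exact: Ck_partialS cf.
  by apply: CkZ => //; apply: IH; exact: CkS.
Qed.

Lemma Ck_theta U f : open U -> Ck 2 U f -> Ck 2 U (fun x => theta (f x)).
Proof.
move=> oU cf.
have c1 (g : V -> R) : Ck 2 U g -> Ck 2 U (fun x => g x - 1).
  by move=> cg; exact: (CkB oU cg (Ck_cst 2 1 oU)).
have h1 : Ck 2 U (fun x => pos (f x - 1) ^+ 3) := Ck_posX oU (c1 f cf).
have h2 : Ck 2 U (fun x => 1 - pos (f x - 1) ^+ 3) := CkB oU (Ck_cst 2 1 oU) h1.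
exact: (Ck_posX oU h2).
Qed.

Definition sq x : R := \sum_i x 0 i ^+ 2.

Lemma sq_ge0 x : 0 <= sq x.
Proof. by apply: sumr_ge0 => i _; exact: sqr_ge0. Qed.

Lemma sq_eq0 x : sq x = 0 -> x = 0.
Proof.
move=> /eqP; rewrite psumr_eq0 => [/allP h|i _]; last exact: sqr_ge0.
apply/rowP => i; rewrite mxE; apply/eqP; rewrite -sqrf_eq0.
by have := h i; rewrite mem_index_enum => /(_ isT).
Qed.

Lemma sq_coord x i : x 0 i ^+ 2 <= sq x.
Proof.
by rewrite /sq (bigD1 i)//= lerDl; apply: sumr_ge0 => j _; exact: sqr_ge0.
Qed.

Lemma sqN x : sq (- x) = sq x.
Proof. by apply: eq_bigr => i _; rewrite mxE sqrrN. Qed.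

Lemma Ck_sq k U a : open U -> Ck k U (fun y => sq (y - a)).
Proof.
move=> oU; apply: Ck_sum => // i; apply: CkX => //.
have -> : (fun y : V => (y - a) 0 i) = (fun y : V => y 0 i - a 0 i).
  by apply: funext => y; rewrite !mxE.
by apply: CkB => //; [exact: Ck_coord|exact: Ck_cst].
Qed.

Lemma sq_continuous a : continuous (fun y => sq (y - a)).
Proof. by move=> y; exact: (Ck_cont (@Ck_sq 0 setT a openT) I). Qed.

Lemma isd_sq a y i : is_derive y (e_ i) (fun y => sq (y - a)) (2 * (y 0 i - a 0 i)).
Proof.
have h (j : 'I_n) : is_derive y (e_ i) (fun y : V => (y - a) 0 j ^+ 2)
    (2 * (y 0 j - a 0 j) * (j == i)%:R).
  have -> : (fun y : V => (y - a) 0 j ^+ 2) = (fun y : V => (y 0 j - a 0 j) ^+ 2).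
    by apply: funext => z; rewrite !mxE.
  apply: is_derive_eq (isdX 2 (isdD (isd_coord _ _ _) (isd_cst (- a 0 j) _ _))) _.
  by rewrite addr0.
apply: is_derive_eq (isd_sum h) _.
by rewrite (bigD1 i)//= eqxx mulr1 big1 ?addr0// => j /negbTE ->; rewrite mulr0.
Qed.

Section Kernel.
Variables (a : V) (ep : R).

(** Used with k = m - 1: for [ep] = 0 a multiple of the fundamental solution with pole a, for [ep] >
    0 its smooth regularisation. *)
Definition kern k y : R := (sq (y - a) + ep) ^- k.

Let s y := sq (y - a) + ep.

Lemma open_kern_dom : open [set y | s y != 0].
Proof.
have cs : continuous s.
  by move=> y; exact: (Ck_cont (CkD openT (Ck_sq 0 a openT) (Ck_cst 0 ep openT)) I).
rewrite openE => y /= sy; exact: (@cvgr_neq0 _ _ _ (nbhs y) _ _ _ (cs y) sy).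
Qed.

Lemma isd_s y i : is_derive y (e_ i) s (2 * (y 0 i - a 0 i)).
Proof. by apply: is_derive_eq (isdD (isd_sq a y i) (isd_cst ep _ _)) _; rewrite addr0. Qed.

Lemma isd_kern k y i : s y != 0 -> is_derive y (e_ i) (kern k)
  (- k%:R * kern k.+1 y * (2 * (y 0 i - a 0 i))).
Proof. by move=> sy; apply: isdXV => //; exact: isd_s. Qed.

Lemma Ck_kern l k U : open U -> (forall y, U y -> s y != 0) -> Ck l U (kern k).
Proof.
move=> oU hU; apply: CkV => // [y /hU|]; first exact: expf_neq0.
by apply: CkX => //; apply: CkD => //; [exact: Ck_sq|exact: Ck_cst].
Qed.

Lemma partial_kern k i y : s y != 0 ->
  partial i (kern k) y = - k%:R * kern k.+1 y * (2 * (y 0 i - a 0 i)).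
Proof. by move=> sy; case: (isd_kern k i sy). Qed.

Lemma isd_partial_kern k i y : s y != 0 ->
  is_derive y (e_ i) (partial i (kern k))
   (- 2 * k%:R * kern k.+1 y + 4 * k%:R * k.+1%:R * (y 0 i - a 0 i) ^+ 2 * kern k.+2 y).
Proof.
move=> sy.
apply: (@near_eq_is_derive _ _ _ (fun y => - k%:R * kern k.+1 y * (2 * (y 0 i - a 0 i)))).
  apply: filterS (open_nbhs_nbhs (conj open_kern_dom sy)) => z sz.
  by rewrite partial_kern.
have h1 : is_derive y (e_ i) (fun y : V => 2 * (y 0 i - a 0 i)) 2.
  apply: is_derive_eq (isdZ 2 (isdD (isd_coord _ _ _) (isd_cst (- a 0 i) _ _))) _.
  by rewrite eqxx addr0 mulr1.
apply: is_derive_eq (isdM (isdZ (- k%:R) (isd_kern k.+1 i sy)) h1) _.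
ring.
Qed.

(** Writing [kern k.+1] as [s] times [kern k.+2], the dimension 2 (k + 1) is exactly the one in
    which the terms in |y - a|^2 cancel. The case [ep] = 0 gives harmonicity off the pole. *)
Lemma laplacian_kern k y : n = (2 * k.+1)%N -> s y != 0 ->
  laplacian (kern k) y = - 4 * k%:R * k.+1%:R * (ep * kern k.+2 y).
Proof.
move=> nk sy; rewrite /laplacian.
have E i : partial i (partial i (kern k)) y = - 2 * k%:R * kern k.+1 y +
    4 * k%:R * k.+1%:R * (y 0 i - a 0 i) ^+ 2 * kern k.+2 y.
  by case: (isd_partial_kern k i sy).
rewrite (eq_bigr _ (fun i _ => E i)).
rewrite big_split /= sumr_const card_ord -mulr_suml -mulr_sumr.
have -> : \sum_i (y 0 i - a 0 i) ^+ 2 = sq (y - a).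
  by apply: eq_bigr => i _; rewrite !mxE.
have -> : kern k.+1 y = s y * kern k.+2 y.
  rewrite /kern -/(s y) [_ ^+ k.+2]exprS; field.
  by rewrite sy expf_neq0.
have -> : forall c : R, c *+ n = (2 * k.+1%:R) * c.
  by move=> c; rewrite -[c *+ n]mulr_natl -natrM -nk.
rewrite /s; ring.
Qed.

End Kernel.

End RadialFunctions.

(** * Box integrals and Green's representation *)

Section BoxIntegral.
Variables (R : realType) (n : nat) (M : R).
Local Notation V := 'rV[R]_n.
Local Notation e_ i := (delta_mx 0 i : V).
Implicit Types (f g : V -> R) (x y : V) (i j : 'I_n) (s : seq 'I_n).
Hypothesis M0 : 0 < M.

Definition upd i (t : R) x : V := x + (t - x 0 i) *: e_ i.

Lemma updE i t x j : upd i t x 0 j = if j == i then t else x 0 j.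
Proof.
rewrite !mxE eqxx /=; case: eqVneq => [->|_]; first by rewrite mulr1 addrC subrK.
by rewrite mulr0 addr0.
Qed.

Lemma upd_id i x : upd i (x 0 i) x = x.
Proof. by rewrite /upd subrr scale0r addr0. Qed.

Definition box : set V := [set x | forall j, - M <= x 0 j <= M].

Lemma compact_box : compact box.
Proof.
have := @rV_compact R n (fun=> `[- M, M]%classic) (fun=> @segment_compact R _ _).
by congr compact; apply/seteqP; split=> x h j; have := h j; rewrite /= in_itv.
Qed.

Lemma box0 : box 0.
Proof. by move=> j; rewrite mxE; have h := M0; apply/andP; split; lra. Qed.

Lemma box_upd i t x : box x -> - M <= t <= M -> box (upd i t x).
Proof. by move=> bx tM j; rewrite updE; case: eqVneq => // _. Qed.

(** The result is still a function of the whole vector, constant in coordinate i, so iteration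
    involves no change of dimension. *)
Definition integrate i f x : R := seg_int (- M) M (fun t => f (upd i t x)).

Lemma continuous_rowR f x : {for x, continuous f} <->
  forall e, 0 < e -> exists2 d, 0 < d & forall y, (forall j, `|y 0 j - x 0 j| < d) -> `|f y - f x| < e.
Proof.
split=> [cf e e0|h].
  have /cvgrPdist_lt /(_ _ e0) /nbhs_rowR[d d0 hd] := cf.
  by exists d => // y /hd; rewrite distrC.
apply: (iffRL (@cvgrPdist_lt _ _ _ (nbhs x) _ f (f x))) => e e0.
have [d d0 hd] := h e e0; apply/nbhs_rowR; exists d => // y /hd; by rewrite distrC.
Qed.

Lemma continuous_upd i f x : continuous f -> continuous (fun t => f (upd i t x)).
Proof.
move=> cf t; apply/cvgrPdist_lt => e e0.
have [d d0 hd] := (continuous_rowR f (upd i t x)).1 (cf _) e e0.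
apply/nbhs_ballP; exists d => //= u ut; rewrite distrC; apply: hd => j.
by rewrite !updE; case: eqVneq => _; rewrite ?subrr ?normr0// distrC.
Qed.

Lemma integrate_seg i f x : continuous f -> cont_seg (- M) M (fun t => f (upd i t x)).
Proof. by move=> cf t _; exact: continuous_upd. Qed.

Let MM : - M <= M.
Proof. by have := M0; lra. Qed.

Lemma integrate_continuous i f : continuous f -> continuous (integrate i f).
Proof.
move=> cf x0; apply/continuous_rowR => e e0.
have M1 : 0 < 4 * M by have := M0; lra.
have e1 : 0 < e / (4 * M) by rewrite divr_gt0.
have e2 : 0 < e / (4 * M) / 2 by rewrite divr_gt0.
have := (compact_near_coveringP `[- M, M]%classic).1 (@segment_compact R (- M) M).
move=> /(_ V (nbhs x0) (fun x t => `|f (upd i t x) - f (upd i t x0)| < e / (4 * M)) _).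
case=> [t0 _|d d0 hd].
  have [d d0 hd] := (continuous_rowR f (upd i t0 x0)).1 (cf _) _ e2.
  exists (ball t0 d, [set x : V | forall j, `|x 0 j - x0 0 j| < d]).
    split; first exact: nbhsx_ballx.
    by apply/nbhs_rowR; exists d.
  move=> [t x] [/= tt0 xx0].
  have h y : (forall j, `|y 0 j - x0 0 j| < d) -> `|f (upd i t y) - f (upd i t0 x0)| < e / (4 * M) / 2.
    move=> hy; apply: hd => j; rewrite !updE; case: eqVneq => // _.
    by rewrite distrC.
  have h1 := h x xx0.
  have h2 : `|f (upd i t x0) - f (upd i t0 x0)| < e / (4 * M) / 2.
    by apply: h => j; rewrite subrr normr0.
  have -> : f (upd i t x) - f (upd i t x0) =
    (f (upd i t x) - f (upd i t0 x0)) - (f (upd i t x0) - f (upd i t0 x0)) by ring.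
  apply: le_lt_trans (ler_normB _ _) _; lra.
have /nbhs_rowR[r r0 hr] : \forall x \near x0, `[- M, M]%classic `<=`
    (fun t => `|f (upd i t x) - f (upd i t x0)| < e / (4 * M)) by exists d.
exists r => // y /hr hy.
have cy := @integrate_seg i f y cf; have cx := @integrate_seg i f x0 cf.
have key u v : continuous f -> (forall t, - M <= t <= M -> f (upd i t u) - f (upd i t v) <= e / (4 * M)) ->
    integrate i f u - integrate i f v <= e / 2.
  move=> _ huv; have cu := @integrate_seg i f u cf; have cv := @integrate_seg i f v cf.
  rewrite lerBlDr; have -> : e / 2 = seg_int (- M) M (fun=> e / (4 * M)).
    by rewrite J_cst//; field; rewrite gt_eqF.
  rewrite -JD//; last exact: cont_seg_cst.
  apply: le_J => //; first by apply: cont_segD => //; exact: cont_seg_cst.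
  by move=> t tM; rewrite -lerBlDr huv.
have k1 : integrate i f y - integrate i f x0 <= e / 2.
  apply: key => // t tM; apply: le_trans (ler_norm _) _; apply/ltW/hy.
  by rewrite /= in_itv.
have k2 : integrate i f x0 - integrate i f y <= e / 2.
  apply: key => // t tM; apply: le_trans (ler_norm _) _; rewrite distrC; apply/ltW/hy.
  by rewrite /= in_itv.
by rewrite ltr_norml; apply/andP; split; lra.
Qed.

Definition iint s f := foldr integrate f s.

Lemma iint_continuous s f : continuous f -> continuous (iint s f).
Proof. by move=> cf; elim: s => //= i s; exact: integrate_continuous. Qed.

Lemma continuousD_rV f g : continuous f -> continuous g -> continuous (fun x => f x + g x).
Proof. by move=> cf cg x; apply: continuousD; [exact: cf|exact: cg]. Qed.

Lemma continuousZ_rV (k : R) f : continuous f -> continuous (fun x => k * f x).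
Proof. by move=> cf x; apply: continuousM; [exact: cst_continuous|exact: cf]. Qed.

Lemma iintD s f g x : continuous f -> continuous g ->
  iint s (fun x => f x + g x) x = iint s f x + iint s g x.
Proof.
move=> cf cg; elim: s x => //= i s IH x.
have -> : iint s (fun x => f x + g x) = (fun x => iint s f x + iint s g x) by exact: funext.
rewrite /integrate (@JD _ (- M) M (fun t => iint s f (upd i t x)))//.
  exact: (@integrate_seg i _ x (@iint_continuous s _ cf)).
exact: (@integrate_seg i _ x (@iint_continuous s _ cg)).
Qed.

Lemma iintZ s k f x : continuous f -> iint s (fun x => k * f x) x = k * iint s f x.
Proof.
move=> cf; elim: s x => //= i s IH x.
have -> : iint s (fun x => k * f x) = (fun x => k * iint s f x) by exact: funext.
by rewrite /integrate JZ//; exact: (@integrate_seg i _ x (@iint_continuous s _ cf)).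
Qed.

Lemma iint_le s f g x : continuous f -> continuous g ->
  (forall x, box x -> f x <= g x) -> box x -> iint s f x <= iint s g x.
Proof.
move=> cf cg fg; elim: s x => [x bx|i s IH x bx] /=; first exact: fg.
apply: le_J => [||t tM].
- exact: (@integrate_seg i _ x (@iint_continuous s _ cf)).
- exact: (@integrate_seg i _ x (@iint_continuous s _ cg)).
- by apply: IH; exact: box_upd.
Qed.

Lemma iint_agree s f x y : (forall j, j \notin s -> x 0 j = y 0 j) ->
  iint s f x = iint s f y.
Proof.
elim: s x y => [x y xy|i s IH x y xy] /=; first by congr f; apply/rowP => j; exact: xy.
apply: eq_J => t _; apply: IH => j js; rewrite !updE; case: eqVneq => // ji.
by apply: xy; rewrite inE negb_or ji.
Qed.

Lemma iint_gt0 s f x : continuous f -> (forall y, box y -> 0 <= f y) -> box x ->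
  0 < f x -> 0 < iint s f x.
Proof.
move=> cf f0 bx fx; elim: s => //= i s IH.
apply: (@J_gt0 _ _ _ _ (x 0 i)); [by have := M0; lra| | |exact: bx|].
- exact: (@integrate_seg i _ x (@iint_continuous s _ cf)).
- move=> t tM; have c0 : continuous (fun _ : V => 0 : R) by move=> y; exact: cst_continuous.
  have -> : 0 = iint s (fun=> 0 * 1) (upd i t x) :> R.
    by rewrite (@iintZ s 0 (fun=> 1)) ?mul0r// => y; exact: cst_continuous.
  apply: iint_le => //; last exact: box_upd.
    by move=> y; exact: cst_continuous.
  by move=> y /f0; rewrite mul0r.
- by rewrite upd_id.
Qed.

(** Every coordinate is integrated out, so the base point 0 is immaterial. *)
Definition box_int f : R := iint (enum 'I_n) f 0.

Lemma I_mono_linear : mono_linear (fun f : V -> R => continuous f) box box_int.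
Proof.
split.
- exact: continuousD_rV.
- exact: continuousZ_rV.
- by move=> f g cf cg; exact: iintD.
- by move=> k f cf; exact: iintZ.
- by move=> f g cf cg fg; apply: iint_le => //; exact: box0.
Qed.

Lemma I_gt0 f x : continuous f -> (forall y, box y -> 0 <= f y) -> box x ->
  0 < f x -> 0 < box_int f.
Proof.
move=> cf f0 bx fx; rewrite /box_int (@iint_agree _ _ _ x) => [|j]; first exact: iint_gt0.
by rewrite mem_enum.
Qed.

Definition vanish i (r : R) f := forall x, r <= `|x 0 i| -> f x = 0.

Lemma J_vanish (phi : R -> R) r a b : 0 <= r -> continuous phi ->
  (forall t, r <= `|t| -> phi t = 0) -> a <= - r -> r <= b -> seg_int a b phi = seg_int (- r) r phi.
Proof.
move=> r0 cphi phi0 ar rb.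
have cs u v : cont_seg u v phi by move=> t _; exact: cphi.
rewrite (@J_cat _ a (- r) b)//; last lra.
rewrite (@J_cat _ (- r) r b)//; last lra.
rewrite (@eq_J _ a (- r) phi (fun=> 0)); last first.
  by move=> t /andP[_ t1]; apply: phi0; rewrite ler0_norm; lra.
rewrite (@eq_J _ r b phi (fun=> 0)); last first.
  by move=> t /andP[t1 _]; apply: phi0; rewrite ger0_norm; lra.
by rewrite !J_cst// !mul0r addr0 add0r.
Qed.

Lemma vanish_integrate i j r f : i != j -> vanish i r f -> vanish i r (integrate j f).
Proof.
move=> ij hf x rx; rewrite /integrate (@eq_J _ _ _ _ (fun=> 0)) ?J_cst ?mul0r//.
by move=> t _; apply: hf; rewrite updE (negbTE ij).
Qed.

Lemma vanish_iint i s r f : i \notin s -> vanish i r f -> vanish i r (iint s f).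
Proof.
elim: s => //= j s IH; rewrite inE negb_or => /andP[ij is_] hf.
by apply: vanish_integrate => //; exact: IH.
Qed.

Lemma integrate_shift i j h f : i != j ->
  integrate j (fun x => f (x + h *: e_ i)) = (fun x => integrate j f (x + h *: e_ i)).
Proof.
move=> ij; apply: funext => x; apply: eq_J => t _; congr f; apply/rowP => k.
rewrite !mxE !eqxx /= (eq_sym j i) (negbTE ij) mulr0 addr0; ring.
Qed.

Lemma integrate_shift_eq i h r f : continuous f -> 0 <= r -> r + `|h| <= M -> vanish i r f ->
  integrate i (fun x => f (x + h *: e_ i)) = integrate i f.
Proof.
move=> cf r0 rM hf; apply: funext => x; rewrite /integrate.
have e t : upd i t x + h *: e_ i = upd i (t + h) x.
  by rewrite /upd -addrA -scalerDl; congr (_ + _ *: _); ring.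
rewrite (@eq_J _ _ _ _ (fun t => f (upd i (t + h) x))) => [|t _]; last by rewrite e.
have hn1 := ler_norm h; have hn2 := ler_norm (- h); rewrite normrN in hn2.
have cx := @continuous_upd i f x cf.
rewrite (@J_shift _ _ _ h (fun t => f (upd i t x)))//.
have v0 t : r <= `|t| -> f (upd i t x) = 0 by move=> rt; apply: hf; rewrite updE eqxx.
rewrite (J_vanish r0 cx v0); [|lra|lra].
rewrite (J_vanish r0 cx v0)//; lra.
Qed.

(** A translation along coordinate i commutes with the integrations in other directions and is
    absorbed by the one along i; r + |h| <= M keeps the translated support inside the box. *)
Lemma iint_shift i s h r f : continuous f -> uniq s -> 0 <= r -> r + `|h| <= M -> vanish i r f ->
  iint s (fun x => f (x + h *: e_ i)) =
  if i \in s then iint s f else (fun x => iint s f (x + h *: e_ i)).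
Proof.
move=> cf + r0 rM hf; elim: s => //= j s IH /andP[js us]; rewrite inE.
rewrite IH//; case: (eqVneq i j) js => [<- /negbTE js|ij _] /=.
  rewrite js; apply: (@integrate_shift_eq i h r (iint s f) (@iint_continuous s f cf) r0 rM).
  by apply: vanish_iint => //; rewrite js.
by case: (i \in s); [|exact: integrate_shift].
Qed.

Lemma I_shift1 i h r f : continuous f -> 0 <= r -> r + `|h| <= M -> vanish i r f ->
  box_int (fun x => f (x + h *: e_ i)) = box_int f.
Proof.
move=> cf r0 rM hf; rewrite /box_int (iint_shift cf _ r0 rM hf) ?enum_uniq//.
by rewrite mem_enum.
Qed.

Lemma continuous_shift f (v : V) : continuous f -> continuous (fun x => f (x + v)).
Proof.
move=> cf x; apply: (@continuous_comp _ _ _ (fun x => x + v) f); last exact: cf.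
by apply: continuousD; [exact: cvg_id|exact: cst_continuous].
Qed.

Lemma I_shift r f (v : V) : continuous f -> 0 <= r -> (forall i, r + `|v 0 i| <= M) ->
  (forall i, vanish i r f) -> box_int (fun x => f (x + v)) = box_int f.
Proof.
move=> cf r0 rM hf.
have -> : v = \sum_(i <- enum 'I_n) v 0 i *: e_ i.
  by rewrite big_enum /= {1}(row_sum_delta v).
have := enum_uniq 'I_n; elim: (enum 'I_n) => [_|i s IH /= /andP[is_ us]].
  by congr box_int; apply: funext => x; rewrite big_nil addr0.
rewrite big_cons -[RHS](IH us); set w := \sum_(_ <- s) _.
have -> : (fun x => f (x + (v 0 i *: e_ i + w))) = (fun x => (fun y => f (y + w)) (x + v 0 i *: e_ i)).
  by apply: funext => x; rewrite addrA.
apply: (@I_shift1 i (v 0 i) r (fun y => f (y + w))) => //; first exact: continuous_shift.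
(* The remaining shift w has no i-th component, so it preserves the vanishing in direction i. *)
move=> x rx; apply: (hf i); rewrite mxE.
have -> : w 0 i = 0; last by rewrite addr0.
rewrite /w summxE big1_seq// => j /andP[_ js]; rewrite !mxE eqxx /=.
by case: eqVneq => [ij|]; [move: is_; rewrite ij js|rewrite mulr0].
Qed.

(* By translation invariance the difference quotients of f have integral 0, and they
   converge uniformly to g. *)
Lemma I_derive0 i r f g : continuous f -> continuous g ->
  (forall x, is_derive x (e_ i) f (g x)) -> 0 <= r -> r < M -> vanish i r f -> box_int g = 0.
Proof.
move=> cf cg df r0 rM hf; have ml := I_mono_linear.
have c1 : continuous (fun _ : V => 1 : R) by move=> x; exact: cst_continuous.
have I1 : 0 <= box_int (fun=> 1).
  rewrite -[X in X <= _](mul0r (box_int (fun=> 1))) -(ml_Z ml)//.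
  apply: (ml_le ml) => //; first exact: (@continuousZ_rV 0 _ c1).
have key e : 0 < e -> `|box_int g| <= e * box_int (fun=> 1).
  move=> e0; have e2 : 0 < e / 2 by rewrite divr_gt0.
  (* Uniform continuity of g along direction i over the box, in the form suited to the intermediate
     point of the mean value theorem. *)
  have := (compact_near_coveringP box).1 compact_box.
  move=> /(_ R (nbhs (0:R)) (fun h x => forall xi, 0 <= xi <= h -> `|g (x + xi *: e_ i) - g x| <= e) _).
  case=> [x0 _|d /= d0 hd].
    have [d d0 hd] := (continuous_rowR g x0).1 (cg _) _ e2.
    have d2 : 0 < d / 2 by rewrite divr_gt0.
    exists ([set x : V | forall j, `|x 0 j - x0 0 j| < d / 2], ball (0:R) (d / 2)).
      by split; [apply/nbhs_rowR; exists (d / 2)|exact: nbhsx_ballx].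
    move=> [x h] [/= hx]; rewrite /ball /= sub0r normrN => hh xi /andP[xi0 xih].
    have a1 : `|g x - g x0| < e / 2.
      by apply: hd => j; have := hx j; lra.
    have a2 : `|g (x + xi *: e_ i) - g x0| < e / 2.
      apply: hd => j; rewrite !mxE eqxx /= addrAC.
      apply: le_lt_trans (ler_normD _ _) _.
      have : `|xi * (j == i)%:R| <= `|h|.
        rewrite normrM (ger0_norm xi0) normr_nat; case: eqVneq => _.
          by rewrite mulr1 (le_trans xih)// ler_norm.
        by rewrite mulr0.
      by have := hx j; lra.
    have -> : g (x + xi *: e_ i) - g x = (g (x + xi *: e_ i) - g x0) - (g x - g x0) by ring.
    apply: le_trans (ler_normB _ _) _; lra.
  pose h := Num.min (d / 2) (M - r).
  have h0 : 0 < h by rewrite lt_min divr_gt0//= subr_gt0.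
  have hbox : box `<=` (fun x => forall xi, 0 <= xi <= h -> `|g (x + xi *: e_ i) - g x| <= e).
    apply: hd; rewrite /ball /= sub0r normrN gtr0_norm//.
    by apply: (@le_lt_trans _ _ (d / 2)); [rewrite ge_min lexx|lra].
  have rh : r + `|h| <= M.
    by rewrite gtr0_norm// addrC -lerBrDr ge_min lexx orbT.
  have cfh := @continuous_shift f (h *: e_ i) cf.
  have cD : continuous (fun x => f (x + h *: e_ i) + (- 1) * f x).
    by apply: continuousD_rV => //; exact: continuousZ_rV.
  pose Df x := h^-1 * (f (x + h *: e_ i) + (- 1) * f x).
  have cDf : continuous Df by exact: continuousZ_rV.
  have IDf : box_int Df = 0.
    rewrite (ml_Z ml)// (ml_D ml)//; last exact: continuousZ_rV.
    by rewrite (ml_Z ml)// (I_shift1 cf r0 rh hf) mulN1r subrr mulr0.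
  have -> : box_int g = box_int (fun x => g x + (- 1) * Df x).
    rewrite (ml_D ml)//; last exact: continuousZ_rV.
    by rewrite (ml_Z ml)// IDf mulr0 addr0.
  have cgD : continuous (fun x => g x + (- 1) * Df x).
    by apply: continuousD_rV => //; exact: continuousZ_rV.
  have bound x : box x -> `|g x + (- 1) * Df x| <= e * 1.
    move=> bx; rewrite mulr1 mulN1r.
    (* The difference quotient is a value of g at an intermediate point, hence within e of g x. *)
    have [||c] := @MVT _ (fun t => f (x + t *: e_ i)) (fun t => g (x + t *: e_ i)) 0 h h0.
    + move=> t _; apply/is_derive_lineP => /=.
      have -> : (fun u : R => f (x + (u *: (1 : R) + t) *: e_ i)) =
        (fun u => f (u *: e_ i + (x + t *: e_ i))).
        apply: funext => u; congr f.
        by rewrite [u *: (1:R)]mulr1 scalerDl addrCA.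
      exact: ((is_derive_lineP f (x + t *: e_ i) (e_ i) _).1 (df _)).
    + apply: continuous_subspaceT => t.
      apply: (@continuous_comp _ _ _ (fun t : R => x + t *: e_ i) f); last exact: cf.
      by apply: continuousD; [exact: cst_continuous|apply: continuousZl; exact: cvg_id].
    + rewrite in_itv /= scale0r addr0 subr0 => /andP[c0 ch] E.
      have -> : Df x = g (x + c *: e_ i).
        by rewrite /Df mulN1r E mulrC mulfK// gt_eqF.
      by rewrite distrC; apply: hbox => //; rewrite !ltW.
  rewrite -(ml_Z ml)//; exact: (ml_abs ml cgD (@continuousZ_rV e _ c1) bound).
apply/eqP; rewrite -normr_le0 leNgt; apply/negP => pos.
have p1 : 0 < 1 + box_int (fun=> 1) by lra.
have := key (`|box_int g| / (2 * (1 + box_int (fun=> 1)))).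
rewrite divr_gt0 ?mulr_gt0// => /(_ isT).
rewrite -mulrA ler_pMr// ler_pdivlMl ?mulr_gt0//; lra.
Qed.

End BoxIntegral.

(** * Green's representation formula *)

Section GreenRepresentation.
Variables (R : realType) (n : nat) (M : R).
Local Notation V := 'rV[R]_n.
Local Notation e_ i := (delta_mx 0 i : V).
Implicit Types (f g h : V -> R) (x y : V) (i j : 'I_n).
Hypothesis M0 : 0 < M.
Local Notation box_int := (@box_int R n M).
Local Notation box := (@box R n M).
Local Notation C2 := (Ck 2 [set: V]).
Let ml := @I_mono_linear R n M M0.

Lemma C2_continuous f : C2 f -> continuous f.
Proof. by move=> cf x; exact: (Ck_cont cf). Qed.
Lemma C2_continuous1 f i : C2 f -> continuous (partial i f).
Proof. by move=> cf x; exact: (Ck_cont (Ck_partialS i cf)). Qed.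
Lemma C2_continuous2 f i j : C2 f -> continuous (partial j (partial i f)).
Proof. by move=> cf x; exact: (Ck_cont (Ck_partialS j (Ck_partialS i cf))). Qed.
Lemma C2_derive1 f i x : C2 f -> is_derive x (e_ i) f (partial i f x).
Proof. by move=> cf; exact: (Ck_partial i cf Logic.I). Qed.
Lemma C2_derive2 f i j x : C2 f ->
  is_derive x (e_ j) (partial i f) (partial j (partial i f) x).
Proof. by move=> cf; exact: (Ck_partial j (Ck_partialS i cf) Logic.I). Qed.

Lemma continuousM_rV f g : continuous f -> continuous g -> continuous (fun x => f x * g x).
Proof. by move=> cf cg x; apply: continuousM; [exact: cf|exact: cg]. Qed.

Lemma continuous_sum_rV (F : 'I_n -> V -> R) : (forall i, continuous (F i)) ->
  continuous (fun x => \sum_i F i x).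
Proof.
move=> cF; have -> : (fun x => \sum_i F i x) = \sum_i F i by apply: funext => x; rewrite fct_sumE.
by elim/big_ind : _ => //; [move=> x; exact: cst_continuous|move=> f g; exact: continuousD_rV].
Qed.

Lemma laplacian_continuous f : C2 f -> continuous (laplacian f).
Proof.
move=> cf; apply: (@continuous_sum_rV (fun i => partial i (partial i f))) => i.
exact: C2_continuous2.
Qed.

Lemma I_sum (F : 'I_n -> V -> R) : (forall i, continuous (F i)) ->
  box_int (fun x => \sum_i F i x) = \sum_i box_int (F i).
Proof.
move=> cF; suff [_ h] : continuous (fun x => \sum_i F i x) /\
    box_int (fun x => \sum_i F i x) = \sum_i box_int (F i) by [].
elim: (index_enum 'I_n) => [|i s [IH1 IH2]].
  rewrite big_nil.
  have -> : (fun x => \sum_(i <- [::]) F i x) = (fun=> 0).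
    by apply: funext => x; rewrite big_nil.
  split; first by move=> x; exact: cst_continuous.
  have -> : (fun=> 0) = (fun _ : V => 0 * (0 : R)) by apply: funext => x; rewrite mul0r.
  by rewrite (ml_Z ml) ?mul0r// => x; exact: cst_continuous.
have -> : (fun x => \sum_(j <- i :: s) F j x) = (fun x => F i x + \sum_(j <- s) F j x).
  by apply: funext => x; rewrite big_cons.
split; first exact: continuousD_rV.
by rewrite (ml_D ml)// big_cons IH2.
Qed.

(** Derivatives are local, so the slab is enlarged: only for |x_j| > r is f known to vanish on a
    whole neighbourhood. *)
Lemma vanish_partial i j r r' f : r < r' -> vanish j r f -> vanish j r' (partial i f).
Proof.
move=> rr' hf x rx.
have -> : partial i f x = partial i (fun=> 0) x.
  apply: near_eq_derive.
  have r0 : 0 < r' - r by rewrite subr_gt0.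
  apply/nbhs_rowR; exists (r' - r) => // y hy; apply: hf.
  have := ler_normB (y 0 j) (y 0 j - x 0 j); rewrite subKr => h.
  by have := hy j; lra.
by case: (isd_cst (0:R) x (e_ i)).
Qed.

Lemma I_partial_parts i r f h : 0 <= r -> r < M -> vanish i r f -> C2 f -> C2 h ->
  box_int (fun x => h x * partial i (partial i f) x) =
  - box_int (fun x => partial i h x * partial i f x).
Proof.
move=> r0 rM hf cf ch.
pose r' := (r + M) / 2; have rr' : r < r' by rewrite /r'; lra.
have c1 := @C2_continuous h ch; have c2 := @C2_continuous1 f i cf.
have c3 := @C2_continuous1 h i ch; have c4 := @C2_continuous2 f i i cf.
have cA := @continuousM_rV _ _ c1 c4; have cB := @continuousM_rV _ _ c3 c2.
apply/eqP; rewrite -addr_eq0 -(ml_D ml)//; apply/eqP.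
apply: (@I_derive0 _ _ _ M0 i r' (fun x => h x * partial i f x)).
- exact: continuousM_rV.
- exact: continuousD_rV.
- move=> x; apply: is_derive_eq (isdM (C2_derive1 i x ch) (C2_derive2 i i x cf)) _.
  by rewrite (mulrC (partial i f x)).
- by rewrite /r'; lra.
- by rewrite /r'; lra.
- by move=> x rx; rewrite (vanish_partial i rr' hf)// mulr0.
Qed.

(** Green's second identity; there are no boundary terms because f vanishes near the boundary of the
    box. *)
Lemma I_laplacian_parts r f h : 0 <= r -> r < M -> (forall i, vanish i r f) -> C2 f -> C2 h ->
  box_int (fun x => h x * laplacian f x) = box_int (fun x => laplacian h x * f x).
Proof.
move=> r0 rM hf cf ch.
have c1 := @C2_continuous h ch; have c2 i := @C2_continuous1 f i cf.
have c0 := @C2_continuous f cf; have c5 i := @C2_continuous2 h i i ch.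
have c3 i := @C2_continuous1 h i ch; have c4 i := @C2_continuous2 f i i cf.
have -> : (fun x => h x * laplacian f x) = (fun x => \sum_i h x * partial i (partial i f) x).
  by apply: funext => x; rewrite mulr_sumr.
have -> : (fun x => laplacian h x * f x) = (fun x => \sum_i partial i (partial i h) x * f x).
  by apply: funext => x; rewrite mulr_suml.
rewrite I_sum => [|i]; last exact: continuousM_rV.
rewrite I_sum => [|i]; last exact: continuousM_rV.
apply: eq_bigr => i _; rewrite (I_partial_parts r0 rM (hf i) cf ch).
have cA := @continuousM_rV _ _ (c5 i) c0; have cB := @continuousM_rV _ _ (c3 i) (c2 i).
apply/eqP; rewrite eq_sym -addr_eq0 -(ml_D ml)//; apply/eqP.
apply: (@I_derive0 _ _ _ M0 i r (fun x => partial i h x * f x)) => //.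
- exact: continuousM_rV.
- exact: continuousD_rV.
- move=> x; apply: is_derive_eq (isdM (C2_derive2 i i x ch) (C2_derive1 i x cf)) _.
  by rewrite addrC (mulrC (f x)).
- by move=> x rx; rewrite (hf i x rx) mulr0.
Qed.

Lemma bounded_on_box f : continuous f -> exists2 L, 0 <= L & forall x, box x -> `|f x| <= L.
Proof.
move=> cf.
have [||c _ hc] := @compact_EVT_max _ _ (fun x => `|f x|) box _ (@compact_box R n M).
- by exists 0; exact: box0.
- apply: continuous_subspaceT => x.
  by apply: continuous_comp; [exact: cf|exact: norm_continuous].
by exists `|f c| => // x bx; apply: hc; rewrite inE.
Qed.

Lemma C2_kern ep k : 0 < ep -> C2 (kern 0 ep k).
Proof.
move=> ep0; apply: Ck_kern; first exact: openT.
by move=> y _; rewrite gt_eqF// ltr_wpDl ?sq_ge0.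
Qed.

Lemma laplacian_near_eq f g x : (\forall y \near x, f y = g y) -> laplacian f x = laplacian g x.
Proof.
move=> fg; apply: eq_bigr => i _; apply: near_eq_derive; exact: near_eq_partial.
Qed.

Lemma laplacian_lin f g (c : R) x : C2 f -> C2 g ->
  laplacian (fun x => f x + c * g x) x = laplacian f x + c * laplacian g x.
Proof.
move=> cf cg; rewrite /laplacian mulr_sumr -big_split /=; apply: eq_bigr => i _.
have e y : partial i (fun x => f x + c * g x) y = partial i f y + c * partial i g y.
  by case: (isdD (C2_derive1 i y cf) (isdZ c (C2_derive1 i y cg))).
have -> : partial i (fun x => f x + c * g x) = (fun y => partial i f y + c * partial i g y).
  exact: funext.
by case: (isdD (C2_derive2 i i x cf) (isdZ c (C2_derive2 i i x cg))).
Qed.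

Lemma laplacian_cst (c : R) x : laplacian (fun=> c) x = 0.
Proof.
rewrite /laplacian big1// => i _.
have -> : partial i (fun _ : V => c) = (fun=> 0).
  by apply: funext => y; case: (isd_cst c y (e_ i)).
by case: (isd_cst (0:R) x (e_ i)).
Qed.

Lemma exprB_le (a b : R) k : 0 <= b -> b <= a -> a ^+ k - b ^+ k <= k%:R * a ^+ k.-1 * (a - b).
Proof.
move=> b0 ba; have a0 := le_trans b0 ba; elim: k => [|k IH].
  by rewrite !expr0 subrr !mul0r.
have -> : a ^+ k.+1 - b ^+ k.+1 = a * (a ^+ k - b ^+ k) + b ^+ k * (a - b).
  by rewrite !exprS; ring.
have h1 : b ^+ k * (a - b) <= a ^+ k * (a - b).
  by rewrite ler_wpM2r ?subr_ge0// lerXn2r ?nnegrE.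
have h2 : a * (a ^+ k - b ^+ k) <= k%:R * a ^+ k * (a - b).
  apply: (le_trans (ler_wpM2l a0 IH)); case: k {IH h1} => [|k]; first by rewrite !mul0r mulr0.
  by rewrite /= exprS le_eqVlt; apply/orP; left; apply/eqP; ring.
rewrite /= -natr1; apply: (le_trans (lerD h2 h1)).
by rewrite le_eqVlt; apply/orP; left; apply/eqP; ring.
Qed.

Lemma kern_approx k d : 0 < d -> exists2 K, 0 <= K & forall ep x, 0 <= ep -> d <= sq x ->
  `|kern 0 0 k x - kern 0 ep k x| <= K * ep.
Proof.
move=> d0; have dV : 0 <= d^-1 by rewrite invr_ge0 ltW.
exists (k%:R * d^-1 ^+ k.-1 * (d^-1 * d^-1)).
  by rewrite !mulr_ge0 ?exprn_ge0.
move=> ep x ep0 dx; rewrite /kern subr0 addr0.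
have s0 : 0 < sq x by apply: lt_le_trans dx.
have se0 : 0 < sq x + ep by rewrite ltr_pwDl.
rewrite -!exprVn.
set a := (sq x)^-1; set b := (sq x + ep)^-1.
have b0 : 0 <= b by rewrite invr_ge0 ltW.
have ba : b <= a by rewrite lef_pV2 ?posrE// lerDl.
have ad : a <= d^-1 by rewrite lef_pV2 ?posrE.
have a0 : 0 <= a := le_trans b0 ba.
have abE : a - b = a * b * ep by rewrite /a /b; field; rewrite !gt_eqF.
have ab : b ^+ k <= a ^+ k by rewrite lerXn2r ?nnegrE.
rewrite ger0_norm ?subr_ge0//; apply: (le_trans (exprB_le k b0 ba)).
rewrite abE [_ * (_ * ep)]mulrA; apply: ler_wpM2r => //.
have h1 : k%:R * a ^+ k.-1 <= k%:R * d^-1 ^+ k.-1.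
  by rewrite ler_wpM2l// lerXn2r ?nnegrE.
have h2 : a * b <= d^-1 * d^-1 by apply: ler_pM => //; exact: le_trans ba ad.
by apply: ler_pM => //; rewrite mulr_ge0 ?exprn_ge0.
Qed.

Lemma I1_ge0 : 0 <= box_int (fun=> 1).
Proof.
have c1 : continuous (fun _ : V => 1 : R) by move=> x; exact: cst_continuous.
rewrite -[X in X <= _](mul0r (box_int (fun=> 1))) -(ml_Z ml)//.
by apply: (ml_le ml) => //; exact: (@continuousZ_rV _ _ 0 _ c1).
Qed.

Lemma absI_le f (c : R) : continuous f -> (forall x, box x -> `|f x| <= c) ->
  `|box_int f| <= c * box_int (fun=> 1).
Proof.
move=> cf hf.
have c1 : continuous (fun _ : V => 1 : R) by move=> x; exact: cst_continuous.
rewrite -(ml_Z ml)//; apply: (ml_abs ml cf (@continuousZ_rV _ _ c _ c1)) => x bx.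
by rewrite mulr1 hf.
Qed.

Lemma continuous_kern0M k g d : 0 < d -> continuous g -> (forall x, sq x < d -> g x = 0) ->
  continuous (fun x => kern 0 0 k x * g x).
Proof.
move=> d0 cg hg x; have [x0|x0] := eqVneq (sq x) 0.
  apply: (@near_eq_continuous_rV _ _ (fun=> 0)); last exact: cst_continuous.
  have : \forall y \near x, sq (y - 0) < d.
    apply: (@cvgr_lt _ _ (nbhs x) _ (fun y => sq (y - 0)) (sq (x - 0))) => //.
      exact: (@sq_continuous R n 0 x).
    by rewrite subr0 x0.
  by apply: filterS => y; rewrite subr0 => /hg ->; rewrite mulr0.
apply: continuousM; last exact: cg.
pose U := [set y : V | sq (y - 0) + 0 != 0].
have Ux : U x by rewrite /U /= subr0 addr0.
exact: (Ck_cont (@Ck_kern R n 0 0 0 k U (@open_kern_dom R n 0 0) (fun y hy => hy)) Ux).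
Qed.

(** Near 0 the factor g hides the singularity; elsewhere the two kernels differ by O(ep). *)
Lemma I_kern_approx k g d : 0 < d -> continuous g -> (forall x, sq x < d -> g x = 0) ->
  exists2 K, 0 <= K & forall ep, 0 < ep ->
    `|box_int (fun x => kern 0 0 k x * g x) - box_int (fun x => kern 0 ep k x * g x)| <= K * ep.
Proof.
move=> d0 cg hg; have [K K0 hK] := kern_approx k d0.
have [L L0 hL] := bounded_on_box cg.
exists (K * L * box_int (fun=> 1)); first by rewrite !mulr_ge0// I1_ge0.
move=> ep ep0.
have c1 := @continuous_kern0M k g d d0 cg hg.
have c2 : continuous (fun x => kern 0 ep k x * g x).
  exact: (@continuousM_rV _ _ (@C2_continuous _ (C2_kern k ep0)) cg).
have c3 := @continuousZ_rV _ _ (- 1) _ c2.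
have -> : box_int (fun x => kern 0 0 k x * g x) - box_int (fun x => kern 0 ep k x * g x) =
   box_int (fun x => kern 0 0 k x * g x + (- 1) * (kern 0 ep k x * g x)).
  by rewrite (ml_D ml)// (ml_Z ml)// mulN1r.
rewrite mulrAC; apply: absI_le => [|x bx]; first exact: continuousD_rV.
rewrite mulN1r -mulrBl normrM.
have [xd|dx] := ltP (sq x) d; first by rewrite hg// normr0 mulr0 !mulr_ge0// ltW.
by rewrite mulrAC ler_pM ?hL// hK// ltW.
Qed.

Definition bump0 x : R := theta (sq x).

Lemma bump0_near x : sq x < 1 -> \forall y \near x, bump0 y = 1.
Proof.
move=> x1; have : \forall y \near x, sq (y - 0) < 1.
  apply: (@cvgr_lt _ _ (nbhs x) _ (fun y => sq (y - 0)) (sq (x - 0))).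
    exact: (@sq_continuous R n 0 x).
  by rewrite subr0.
by apply: filterS => y; rewrite subr0 => /ltW; exact: theta1.
Qed.

Lemma C2_bump0 : C2 bump0.
Proof.
have := Ck_theta openT (@Ck_sq R n 2 setT 0 openT).
by congr Ck; apply: funext => x; rewrite subr0.
Qed.

Lemma bump0_ge0 x : 0 <= bump0 x.
Proof. by rewrite exprn_ge0 ?pos_ge0. Qed.

Lemma vanish_bump0 i : vanish i (3 / 2) bump0.
Proof.
move=> x hx; apply: theta0; apply: le_trans (sq_coord x i).
rewrite -real_normK ?num_real//.
have : (3 / 2) ^+ 2 <= `|x 0 i| ^+ 2 by rewrite lerXn2r ?nnegrE//; lra.
apply: le_trans; rewrite expr2; lra.
Qed.

Lemma partial_bump0 i x : partial i bump0 x = dtheta (sq x) * (2 * x 0 i).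
Proof.
have d : is_derive x (e_ i) (fun y => sq (y - 0)) (2 * x 0 i).
  by apply: is_derive_eq (isd_sq 0 x i) _; rewrite mxE subr0.
have := isd_comp d (is_derive_theta (sq (x - 0))).
rewrite subr0 (_ : (fun y => theta (sq (y - 0))) = bump0); first by case.
by apply: funext => y; rewrite subr0.
Qed.

Variable k : nat.
Hypotheses (k0 : (0 < k)%N) (nk : n = (2 * k.+1)%N) (M2 : 2 <= M).

Let hM : 3 / 2 < M.
Proof. have h := M2; lra. Qed.

Lemma laplacian_bump0_near x : sq x < 1 -> laplacian bump0 x = 0.
Proof. by move=> x1; rewrite (laplacian_near_eq (bump0_near x1)) laplacian_cst. Qed.

Lemma I_kern_laplacian ep r f : 0 < ep -> 0 <= r -> r < M -> (forall i, vanish i r f) ->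
  C2 f -> box_int (fun x => kern 0 ep k x * laplacian f x) =
    (- 4 * k%:R * k.+1%:R) * box_int (fun x => ep * kern 0 ep k.+2 x * f x).
Proof.
move=> ep0 r0 rM hf cf; rewrite (I_laplacian_parts r0 rM hf cf (C2_kern k ep0)).
have ck := @C2_continuous _ (C2_kern k.+2 ep0).
rewrite -(ml_Z ml); last first.
  by apply: continuousM_rV; [exact: continuousZ_rV|exact: C2_continuous].
congr box_int; apply: funext => x; rewrite laplacian_kern//; first by ring.
by rewrite gt_eqF// ltr_wpDl ?sq_ge0.
Qed.

Lemma kern_ge0 ep l x : 0 <= ep -> 0 <= kern 0 ep l x.
Proof. by move=> ep0; rewrite invr_ge0 exprn_ge0// addr_ge0 ?sq_ge0. Qed.

Let c : R := 4 * k%:R * k.+1%:R.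
Let c0 : 0 < c.
Proof. by rewrite !mulr_gt0 ?ltr0n. Qed.

(* The mass of the approximate identity is controlled by testing it against [bump0]. *)
Lemma kern_mass : exists2 B, 0 <= B & forall ep, 0 < ep -> ep <= 1 ->
  box_int (fun x => ep * kern 0 ep k.+2 x * bump0 x) <= B.
Proof.
have cl := @laplacian_continuous _ C2_bump0.
have [K K0 hK] := I_kern_approx k ltr01 cl laplacian_bump0_near.
exists ((`|box_int (fun x => kern 0 0 k x * laplacian bump0 x)| + K) / c).
  by rewrite divr_ge0 ?(ltW c0)// addr_ge0.
move=> ep ep0 ep1; rewrite ler_pdivlMr//.
have h0 : 0 <= 3 / 2 :> R by lra.
have E := I_kern_laplacian ep0 h0 hM vanish_bump0 C2_bump0.
set A := box_int (fun x => ep * kern 0 ep k.+2 x * bump0 x) in E *.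
have := hK ep ep0; rewrite E.
set T := box_int (fun x => kern 0 0 k x * _); have -> : - 4 * k%:R * k.+1%:R * A = - (A * c) by rewrite /c; ring.
rewrite opprK => h; have h1 := ler_norm (T + A * c); have h2 := ler_norm (- T).
rewrite normrN in h2.
have h3 : K * ep <= K by rewrite ler_piMr.
lra.
Qed.

(** Up to a factor, the Laplacian of the regularised kernel is an approximate identity at 0, where f
    vanishes. Near 0 the bound |f| <= ka * [bump0] brings in [kern_mass]; away from 0 the
    approximate identity itself is O(ep). *)
Lemma I_kern0_laplacian r d f : 0 <= r -> r < M -> (forall i, vanish i r f) -> C2 f ->
  f 0 = 0 -> 0 < d -> (forall x, sq x < d -> laplacian f x = 0) ->
  box_int (fun x => kern 0 0 k x * laplacian f x) = 0.
Proof.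
move=> r0 rM hf cf f0 d0 lf.
have cl := @laplacian_continuous _ cf.
have [K K0 hK] := I_kern_approx k d0 cl lf.
have [B B0 hB] := kern_mass.
have [H H0 hH] := bounded_on_box (@C2_continuous _ cf).
set T := box_int _ in hK *.
have step ka : 0 < ka -> `|T| <= c * (ka * B).
  move=> ka0.
  have [d1 d10 hd1] := (continuous_rowR f 0).1 (@C2_continuous _ cf 0) ka ka0.
  pose d2 := Num.min 1 (d1 ^+ 2).
  have d20 : 0 < d2 by rewrite lt_min ltr01 exprn_gt0.
  have small x : sq x < d2 -> `|f x| <= ka /\ bump0 x = 1.
    rewrite lt_min => /andP[x1 xd]; split; last by apply: theta1; exact: ltW.
    have := hd1 x; rewrite f0 subr0 => h; apply/ltW/h => j; rewrite mxE subr0.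
    rewrite -(@ltr_pXn2r _ 2) ?nnegrE ?(ltW d10)//; apply: le_lt_trans xd.
    by rewrite real_normK ?num_real// sq_coord.
  (* A bound for the kernel times |f| outside sq x < d2, uniform in [ep]. *)
  pose D := d2^-1 ^+ k.+2 * H.
  have D0 : 0 <= D by rewrite mulr_ge0 ?exprn_ge0 ?invr_ge0 ?(ltW d20).
  have bnd ep : 0 < ep -> ep <= 1 -> `|T| <= c * (ka * B) + ep * (K + c * D * box_int (fun=> 1)).
    move=> ep0 ep1.
    have ck := @C2_continuous _ (C2_kern k.+2 ep0).
    have cek := @continuousZ_rV _ _ ep _ ck.
    have c1 : continuous (fun x => ep * kern 0 ep k.+2 x * f x).
      by apply: continuousM_rV => //; exact: C2_continuous.
    have c2 : continuous (fun x => ep * kern 0 ep k.+2 x * bump0 x).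
      by apply: continuousM_rV => //; exact: C2_continuous C2_bump0.
    have c3 := @continuousZ_rV _ _ ka _ c2.
    have c4 : continuous (fun _ : V => 1 : R) by move=> x; exact: cst_continuous.
    have c5 := @continuousZ_rV _ _ (ep * D) _ c4.
    have e1 := I_kern_laplacian ep0 r0 rM hf cf.
    have e2 : `|box_int (fun x => ep * kern 0 ep k.+2 x * f x)| <= ka * B + ep * D * box_int (fun=> 1).
      apply: (@le_trans _ _ (box_int (fun x => ka * (ep * kern 0 ep k.+2 x * bump0 x) + ep * D * 1))).
        apply: (ml_abs ml c1); first exact: continuousD_rV.
        move=> x bx; rewrite !normrM (ger0_norm (ltW ep0)) (ger0_norm (kern_ge0 _ _ (ltW ep0))) mulr1.
        have p0 : 0 <= ep * kern 0 ep k.+2 x by rewrite mulr_ge0 ?kern_ge0// ltW.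
        have [xs|xs] := ltP (sq x) d2.
          have [h1 ->] := small x xs; rewrite mulr1 [ka * _]mulrC.
          apply: ler_wpDr; first by rewrite mulr_ge0 ?(ltW ep0).
          exact: ler_wpM2l.
        apply: ler_wpDl; first by rewrite mulr_ge0 ?(ltW ka0)// mulr_ge0 ?bump0_ge0.
        rewrite -mulrA; apply: ler_wpM2l; first exact: ltW.
        apply: ler_pM; [exact: kern_ge0 (ltW ep0)|exact: normr_ge0| |exact: hH].
        rewrite /kern -exprVn lerXn2r ?nnegrE ?invr_ge0 ?addr_ge0 ?sq_ge0 ?(ltW ep0) ?(ltW d20)//.
        rewrite subr0 lef_pV2 ?posrE//; last by rewrite ltr_wpDl ?sq_ge0.
        by rewrite (le_trans xs)// lerDl ltW.
      rewrite (ml_D ml)// !(ml_Z ml)// lerD2r ler_wpM2l ?(ltW ka0)//; exact: hB.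
    have e3 := hK ep ep0; rewrite e1 in e3.
    set A := box_int (fun x => ep * kern 0 ep k.+2 x * f x) in e2 e3.
    have e4 : `|T| <= `|T - - 4 * k%:R * k.+1%:R * A| + c * `|A|.
      have -> : T = (T - - 4 * k%:R * k.+1%:R * A) - c * A by rewrite /c; ring.
      apply: le_trans (ler_normB _ _) _; rewrite normrM (gtr0_norm c0).
      by have -> : T - - 4 * k%:R * k.+1%:R * A - c * A - - 4 * k%:R * k.+1%:R * A =
         T - - 4 * k%:R * k.+1%:R * A by rewrite /c; ring.
    apply: (le_trans e4); have := ler_wpM2l (ltW c0) e2 => e5.
    apply: (le_trans (lerD e3 e5)).
    by rewrite le_eqVlt; apply/orP; left; apply/eqP; ring.
  set Q := K + c * D * box_int (fun=> 1) in bnd.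
  have Q0 : 0 <= Q by apply: addr_ge0 => //; apply: mulr_ge0; [apply: mulr_ge0 => //; exact: ltW|exact: I1_ge0].
  rewrite leNgt; apply/negP => lt; set gap := `|T| - c * (ka * B).
  have g0 : 0 < gap by rewrite subr_gt0.
  (* Small enough for ep * Q to be at most half the gap; Q + 1 instead of Q avoids a zero
     denominator. *)
  pose ep := Num.min 1 (gap / (2 * (Q + 1))).
  have Q1 : 0 < 2 * (Q + 1) by lra.
  have ep0 : 0 < ep by rewrite lt_min ltr01 divr_gt0.
  have := bnd ep ep0; rewrite ge_min lexx => /(_ isT) h.
  have u1 : ep * Q <= gap / (2 * (Q + 1)) * Q by rewrite ler_wpM2r// ge_min lexx orbT.
  have u2 : gap / (2 * (Q + 1)) * Q <= gap / 2.
    rewrite mulrAC ler_pdivrMr//.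
    have -> : gap / 2 * (2 * (Q + 1)) = gap * Q + gap by field.
    by rewrite lerDl ltW.
  have gE : gap = `|T| - c * (ka * B) by [].
  have alg (x1 x2 x3 x4 x5 : R) : x2 <= x1 + x3 -> x3 <= x4 -> x4 <= x5 / 2 ->
    x5 = x2 - x1 -> 0 < x5 -> False by lra.
  exact: alg h u1 u2 gE g0.
apply/eqP; rewrite -normr_eq0 eq_le normr_ge0 andbT leNgt; apply/negP => T0.
have p : 0 < 2 * c * (B + 1) by apply: mulr_gt0; [exact: mulr_gt0|exact: ltr_wpDl].
have := step (`|T| / (2 * c * (B + 1))) (divr_gt0 T0 p).
have -> : c * (`|T| / (2 * c * (B + 1)) * B) = `|T| / 2 * (B / (B + 1)).
  by field; rewrite !gt_eqF//; lra.
have : B / (B + 1) <= 1 by rewrite ler_pdivrMr ?mul1r; lra.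
move: T0; set t := `|T|; set b := B / _ => T0 b1 h.
have : t / 2 * b <= t / 2 * 1 by rewrite ler_wpM2l// divr_ge0// ltW.
lra.
Qed.

Definition green_const : R := box_int (fun x => kern 0 0 k x * laplacian bump0 x).

Let i0 : 'I_n.
Proof. by rewrite nk; exact: ord0. Qed.

(** One integration by parts turns the regularised integral into minus the pairing of two radial
    gradients. Kernel and bump both decrease with |x|, so the pairing is positive, with a lower
    bound uniform in [ep] that survives the limit. *)
Lemma green_const_lt0 : green_const < 0.
Proof.
have cl := @laplacian_continuous _ C2_bump0.
have [K K0 hK] := I_kern_approx k ltr01 cl laplacian_bump0_near.
have cdt : continuous (fun x => - dtheta (sq x)).
  have cp (j : nat) : continuous (fun t : R => pos t ^+ j).
    move=> t; apply: (@continuous_comp _ _ _ (@pos R) (fun t => t ^+ j)).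
      exact: pos_continuous.
    exact: exprn_continuous.
  have cs (a : R) : continuous (fun t : R => t - a).
    by move=> t; apply: continuousB; [exact: cvg_id|exact: cst_continuous].
  have cc : continuous (fun t : R => - dtheta t).
    have -> : (fun t : R => - dtheta t) =
        (fun t => 9 * pos (1 - pos (t - 1) ^+ 3) ^+ 2 * pos (t - 1) ^+ 2).
      by apply: funext => t; rewrite /dtheta opprK.
    have c1 : continuous (fun t : R => pos (t - 1) ^+ 3).
      by move=> t; apply: (@continuous_comp _ _ _ (fun t : R => t - 1) (fun t => pos t ^+ 3)); [exact: cs|exact: cp].
    have c2 : continuous (fun t : R => pos (t - 1) ^+ 2).
      by move=> t; apply: (@continuous_comp _ _ _ (fun t : R => t - 1) (fun t => pos t ^+ 2)); [exact: cs|exact: cp].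
    have c3 : continuous (fun t : R => 1 - pos (t - 1) ^+ 3).
      by move=> t; apply: cvgB; [exact: cvg_cst|exact: c1].
    have c4 : continuous (fun t : R => pos (1 - pos (t - 1) ^+ 3) ^+ 2).
      move=> t; apply: (@continuous_comp _ _ _ (fun t : R => 1 - pos (t - 1) ^+ 3) (fun t => pos t ^+ 2)).
        exact: c3.
      exact: cp.
    move=> t; apply: cvgM; last exact: c2.
    by apply: cvgM; [exact: cvg_cst|exact: c4].
  move=> x; apply: (@continuous_comp _ _ _ (fun x => sq x) (fun t => - dtheta t)); last exact: cc.
  have := @sq_continuous R n 0 x.
  by have -> : (fun y : V => sq (y - 0)) = (fun y => sq y) by apply: funext => y; rewrite subr0.
have pI : 0 < box_int (fun x => - dtheta (sq x)).
  (* A point in the middle of the shell 1 < sq x < 2, where [dtheta] is strictly negative; M >= 2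
     puts it in the box. *)
  pose p : V := Num.sqrt (3 / 2) *: e_ i0.
  have h32 : 0 <= 3 / 2 :> R by lra.
  have sp : sq p = 3 / 2.
    rewrite /sq (bigD1 i0)//= big1 => [|j ji].
      by rewrite !mxE !eqxx mulr1 addr0 sqr_sqrtr.
    by rewrite !mxE eqxx /= (negbTE ji) mulr0 expr0n.
  apply: (@I_gt0 _ _ _ M0 _ p) => //.
  - by move=> y _; rewrite oppr_ge0 dtheta_le0.
  - move=> j; rewrite -ler_norml -(@ler_pXn2r _ 2) ?nnegrE ?(ltW M0)//.
    rewrite real_normK ?num_real// (le_trans (sq_coord p j))// sp.
    have : 2 ^+ 2 <= M ^+ 2 by rewrite lerXn2r ?nnegrE ?(ltW M0).
    by rewrite expr2; lra.
  - by rewrite sp oppr_gt0 dtheta_lt0.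
(* Where [dtheta (sq x)] is nonzero, 1 <= sq x <= 2; with ep <= 1 this gives sq x + ep <= 3. *)
pose q : R := 4 * k%:R * (3 ^- k.+1).
have q0 : 0 < q by rewrite !mulr_gt0 ?ltr0n ?invr_gt0 ?exprn_gt0.
have key ep : 0 < ep -> ep <= 1 -> box_int (fun x => kern 0 ep k x * laplacian bump0 x) <=
    - (q * box_int (fun x => - dtheta (sq x))).
  move=> ep0 ep1.
  have ck := @C2_continuous _ (C2_kern k ep0).
  have -> : (fun x => kern 0 ep k x * laplacian bump0 x) =
      (fun x => \sum_i kern 0 ep k x * partial i (partial i bump0) x).
    by apply: funext => x; rewrite mulr_sumr.
  rewrite I_sum => [|i]; last first.
    by apply: continuousM_rV => //; exact: C2_continuous2 C2_bump0.
  have h0 : 0 <= 3 / 2 :> R by lra.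
  rewrite (eq_bigr _ (fun i _ => I_partial_parts h0 hM (@vanish_bump0 i) C2_bump0 (C2_kern k ep0))).
  rewrite sumrN lerN2 -I_sum => [|i]; last first.
    apply: continuousM_rV; first exact: C2_continuous1 (C2_kern k ep0).
    exact: C2_continuous1 C2_bump0.
  rewrite -(ml_Z ml)//; apply: (ml_le ml).
  - exact: continuousZ_rV.
  - apply: continuous_sum_rV => i; apply: continuousM_rV.
      exact: C2_continuous1 (C2_kern k ep0).
    exact: C2_continuous1 C2_bump0.
  move=> x _.
  have sx : sq (x - 0) + ep != 0 by rewrite gt_eqF// ltr_wpDl ?sq_ge0.
  have -> : \sum_i partial i (kern 0 ep k) x * partial i bump0 x =
      4 * k%:R * (sq x * kern 0 ep k.+1 x) * - dtheta (sq x).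
    rewrite (eq_bigr (fun i => (4 * k%:R * kern 0 ep k.+1 x * - dtheta (sq x)) * x 0 i ^+ 2)).
      by rewrite -mulr_sumr -/(sq x); ring.
    by move=> i _; rewrite partial_kern// partial_bump0 mxE subr0; ring.
  have dt0 : 0 <= - dtheta (sq x) by rewrite oppr_ge0 dtheta_le0.
  have [x1|x1] := ltP (sq x) 1.
    by rewrite /dtheta (@pos_eq0 _ (sq x - 1)) ?expr0n ?mulr0 ?oppr0 ?mulr0// subr_le0 ltW.
  have [x2|x2] := ltP 2 (sq x).
    rewrite /dtheta (@pos_eq0 _ (1 - _)) ?expr0n ?mulr0 ?mul0r ?oppr0 ?mulr0//.
    rewrite subr_le0 pos_id; last lra.
    by rewrite exprn_ege1//; lra.
  rewrite ler_wpM2r// /q ler_wpM2l ?mulr_ge0//.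
  rewrite -[leLHS]mul1r ler_pM ?invr_ge0 ?exprn_ge0//.
  rewrite /kern subr0 lef_pV2 ?posrE ?exprn_gt0//; last by lra.
  by rewrite lerXn2r ?nnegrE//; lra.
rewrite /green_const; set T := box_int _ in hK *; rewrite ltNge; apply/negP => T0.
set P := q * _ in key; have P0 : 0 < P by rewrite mulr_gt0.
pose ep := Num.min 1 (P / (2 * (K + 1))).
have K1 : 0 < 2 * (K + 1) by lra.
have ep0 : 0 < ep by rewrite lt_min ltr01 divr_gt0.
have ep1 : ep <= 1 by rewrite ge_min lexx.
have h1 := key ep ep0 ep1; have h2 := le_trans (ler_norm _) (hK ep ep0).
have : K * ep <= K * (P / (2 * (K + 1))) by rewrite ler_wpM2l// ge_min lexx orbT.
have : K * (P / (2 * (K + 1))) <= P / 2.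
  rewrite mulrA ler_pdivrMr//.
  have -> : P / 2 * (2 * (K + 1)) = K * P + P by field.
  by rewrite lerDl ltW.
lra.
Qed.

Lemma is_derive_shift_rV f (v x w : V) d : is_derive (x + v) w f d ->
  is_derive x w (fun y => f (y + v)) d.
Proof.
have e : (fun h : R => h^-1 *: (((fun y => f (y + v)) \o shift x) (h *: w) - f (x + v))) =
  (fun h : R => h^-1 *: ((f \o shift (x + v)) (h *: w) - f (x + v))).
  by apply: funext => t /=; rewrite addrA.
by move=> [d1 d2]; split; rewrite /derivable /derive in d1 d2 *; rewrite e.
Qed.

Lemma Ck_shift l f (v : V) : Ck l setT f -> Ck l setT (fun y => f (y + v)).
Proof.
have cs g : (forall x, setT x -> {for x, continuous g}) ->
    forall x, setT x -> {for x, continuous (fun y => g (y + v))}.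
  move=> cg x _; apply: (@continuous_shift R n g v) => y; exact: cg.
elim: l f => [|l IH] f cf.
  by apply/Ck0P; apply: cs; exact/Ck0P.
apply: (@Ck_intro _ _ l setT _ (fun i x => partial i f (x + v)) openT).
- apply: cs; exact: Ck_cont cf.
- by move=> i x _; apply: is_derive_shift_rV; exact: (Ck_partial i cf (x := x + v) Logic.I).
- by move=> i; apply: IH; exact: Ck_partialS cf.
Qed.

Lemma laplacian_shift f (v : V) x : C2 f ->
  laplacian (fun y => f (y + v)) x = laplacian f (x + v).
Proof.
move=> cf; apply: eq_bigr => i _.
have -> : partial i (fun y => f (y + v)) = (fun y => partial i f (y + v)).
  by apply: funext => y; case: (is_derive_shift_rV (C2_derive1 i (y + v) cf)).
by case: (is_derive_shift_rV (C2_derive2 i i (x + v) cf)).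
Qed.

(** Translating x to 0 and subtracting f x times the bump produces a function [eta] with [eta] 0 =
    0, which [I_kern0_laplacian] annihilates; the bump contributes [green_const]. As the Laplacian
    of f vanishes near x, the integrand is continuous. *)
Lemma green_representation r rx d f x : 0 <= r -> (forall i, vanish i r f) -> C2 f ->
  (forall i, `|x 0 i| <= rx) -> r + rx < M -> 0 < d ->
  (forall y, sq (y - x) < d -> laplacian f y = 0) ->
  box_int (fun y => kern x 0 k y * laplacian f y) = green_const * f x.
Proof.
move=> r0 hf cf hx rM d0 lf.
have rx0 : 0 <= rx by apply: le_trans (hx i0).
have cl := @laplacian_continuous _ cf.
pose eta := fun y => f (y + x) + (- f x) * bump0 y.
have cfx : C2 (fun y => f (y + x)) := Ck_shift x cf.
have ceta : C2 eta := CkD openT cfx (CkZ (- f x) openT C2_bump0).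
have leta y : laplacian eta y = laplacian f (y + x) + (- f x) * laplacian bump0 y.
  by rewrite /eta (laplacian_lin _ _ cfx C2_bump0) (laplacian_shift _ _ cf).
have small0 y : sq y < d -> laplacian f (y + x) = 0.
  by move=> yd; apply: lf; rewrite addrK.
have veta i : vanish i (Num.max (r + rx) (3 / 2)) eta.
  move=> y; rewrite ge_max => /andP[y1 y2]; rewrite /eta (vanish_bump0 y2) mulr0 addr0.
  apply: (hf i); rewrite mxE.
  have := ler_normB (y 0 i + x 0 i) (x 0 i); rewrite addrK.
  by have := hx i; lra.
have eta0 : eta 0 = 0.
  by rewrite /eta add0r /bump0 theta1 ?mulr1 ?subrr// /sq big1// => j _; rewrite mxE expr0n.
have d1 : 0 < Num.min d 1 by rewrite lt_min d0 ltr01.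
have lsmall y : sq y < Num.min d 1 -> laplacian eta y = 0.
  by rewrite lt_min => /andP[yd y1]; rewrite leta small0// laplacian_bump0_near// mulr0 addr0.
have r1 : 0 <= Num.max (r + rx) (3 / 2) by rewrite le_max addr_ge0.
have r2 : Num.max (r + rx) (3 / 2) < M by rewrite gt_max rM hM.
have H0 := I_kern0_laplacian r1 r2 veta ceta eta0 d1 lsmall.
have clx := @continuous_shift R n _ x cl.
have c1 : continuous (fun y => kern 0 0 k y * laplacian f (y + x)).
  exact: (@continuous_kern0M k _ d d0 clx small0).
have c2 : continuous (fun y => kern 0 0 k y * laplacian bump0 y).
  exact: (@continuous_kern0M k _ 1 ltr01 (@laplacian_continuous _ C2_bump0) laplacian_bump0_near).
have c3 := @continuousZ_rV _ _ (- f x) _ c2.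
have HE : box_int (fun y => kern 0 0 k y * laplacian eta y) =
    box_int (fun y => kern 0 0 k y * laplacian f (y + x)) + (- f x) * green_const.
  rewrite -(ml_Z ml _ c2) -(ml_D ml c1 c3); congr box_int; apply: funext => y; rewrite leta.
  have alg (a b e p : R) : a * (b + e * p) = a * b + e * (a * p) by ring.
  exact: alg.
transitivity (box_int (fun y => kern 0 0 k y * laplacian f (y + x))); last first.
  have alg (A a b : R) : A + (- a) * b = 0 -> A = b * a.
    by move=> h; apply/eqP; rewrite -subr_eq0 -[X in _ == X]h; apply/eqP; ring.
  by apply: alg; rewrite -HE.
clear HE H0.
(* Each of the two derivatives in the Laplacian enlarges the slab once, r < r'' < r', and r' still
   leaves room in the box for the translation by x. *)
pose r' := (r + (M - rx)) / 2.
pose r'' := (r + r') / 2.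
have r'0 : 0 <= r' by rewrite /r'; lra.
have rr : r < r'' by rewrite /r'' /r'; lra.
have rr' : r'' < r' by rewrite /r'' /r'; lra.
have rM' i : r' + `|x 0 i| <= M by rewrite /r'; have := hx i; lra.
pose G := fun y => kern x 0 k y * laplacian f y.
have GE : (fun y => kern 0 0 k y * laplacian f (y + x)) = (fun y => G (y + x)).
  by apply: funext => y; rewrite /G /kern addrK subr0.
have vG i : vanish i r' G.
  move=> y hy; rewrite /G /laplacian big1 ?mulr0// => j _.
  exact: (vanish_partial j rr' (vanish_partial j rr (hf i))).
have cG : continuous G.
  have -> : G = (fun y => (fun z => G (z + x)) (y + - x)).
    by apply: funext => y; rewrite subrK.
  rewrite GE in c1; exact: (@continuous_shift R n _ (- x) c1).
apply: (etrans _ (congr1 box_int (esym GE))); symmetry.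
exact: (@I_shift _ _ _ M0 r' G x cG r'0 rM' vG).
Qed.

End GreenRepresentation.

(** * Isotropic cones and their real traces *)

Section ComplexQuadric.
Variables (R : realType) (n : nat).
Local Notation C := (Cplx R).
Local Notation Re := (@complex.Re R).
Local Notation Im := (@complex.Im R).
Local Notation V := 'rV[R]_n.
Local Notation W := 'rV[C]_n.
Local Notation emb := (@real_part_embedding R n).
Implicit Types (z w v : W) (x y : V) (i j : 'I_n).

(** As for [absC], the norm of a complex vector, here the maximum norm, is itself a complex
    number. *)
Definition rnorm v : R := Re `|v|.

Lemma rnorm_ge0 v : 0 <= rnorm v.
Proof. by have := normr_ge0 v; rewrite lecE /= => /andP[_]. Qed.

Lemma rnormE v : `|v| = mkC (rnorm v) 0.
Proof.
have := normr_ge0 v; rewrite lecE /= => /andP[/eqP im0 _].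
by rewrite [LHS]mkC_eta im0.
Qed.

Lemma coord_le_rnorm v j : absC (v 0 j) <= rnorm v.
Proof.
apply/ler_addgt0Pr => d d0.
have e0 : `|0 - v| < mkC (rnorm v + d) 0.
  by rewrite sub0r normrN rnormE ltcE /= eqxx ltrDl.
have : ball_ (fun x : W => `|x|) 0 (mkC (rnorm v + d) 0) v by [].
rewrite -mx_norm_ball => -[_ /(_ 0 j)].
by rewrite -ball_normE /= mxE sub0r normrN lt_normC => /ltW.
Qed.

Lemma near0_rnorm e : 0 < e -> \forall v \near (0 : W), rnorm v < e.
Proof.
move=> e0; apply/nbhs_ballP; exists (mkC e 0) => /=; first by rewrite mkC_gt0.
move=> v; rewrite mx_norm_ball /ball_ /= sub0r normrN rnormE ltcE /=.
by case/andP.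
Qed.

(** Criterion for derivative 0; the general case is reduced to it by subtracting a linear candidate
    whose differentiability is known. *)
Lemma differentiable_flat (f : W -> C) z :
  (forall e, 0 < e -> \forall v \near (0 : W), absC (f (v + z) - f z) <= e * rnorm v) ->
  differentiable f z.
Proof.
move=> hf.
have E : f \o shift z = cst (f z) + (\0 : {linear W -> C}) +o_ (0 : W) id.
  apply/eqaddoP => e /ltC_gt0[e0 ->].
  apply: filterS (hf _ e0) => v hv /=.
  rewrite !fctE /= addr0 rnormE normCE.
  by rewrite mkCM lecE /= !(mul0r,mulr0,addr0,subr0) eqxx hv.
have c0 : continuous (\0 : {linear W -> C}) by move=> v; exact: cst_continuous.
have d0 := diff_unique c0 E.
by apply/diff_locallyP; rewrite d0.
Qed.

Definition quad v : C := bilin v v.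

Lemma quadD v w : quad (v + w) = quad v + 2 * bilin v w + quad w.
Proof.
rewrite /quad /bilin mulr_sumr -!big_split /=; apply: eq_bigr => i _.
by rewrite !mxE; ring.
Qed.

Lemma quad_emb x : quad (emb x) = mkC (sq x) 0.
Proof.
rewrite /quad /bilin /sq.
rewrite (eq_bigr (fun i => (x 0 i ^+ 2)%:C%C)) => [|i _]; last by rewrite !mxE -rmorphM expr2.
by rewrite -rmorph_sum.
Qed.

Lemma embB x y : emb x - emb y = emb (x - y).
Proof. by apply/rowP => j; rewrite !mxE rmorphB. Qed.

Lemma bilin_le v w A B : (forall j, absC (v 0 j) <= A) -> (forall j, absC (w 0 j) <= B) ->
  absC (bilin v w) <= n%:R * (A * B).
Proof.
move=> hv hw; apply: (le_trans (absC_sum _)).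
apply: (@le_trans _ _ (\sum_(i < n) A * B)); last by rewrite sumr_const card_ord mulr_natl.
by apply: ler_sum => i _; rewrite absCM ler_pM ?absC_ge0.
Qed.

Lemma differentiable_quad a z : differentiable (fun z => quad (z - a)) z.
Proof.
have -> : (fun z => quad (z - a)) = \sum_(i < n) (fun z : W => (z 0 i - a 0 i) * (z 0 i - a 0 i)).
  by apply: funext => w; rewrite fct_sumE; apply: eq_bigr => i _; rewrite !mxE.
apply: differentiable_sum => i.
have d : differentiable (fun z : W => z 0 i - a 0 i) z.
  by apply: differentiableB => //; exact: differentiable_coord.
exact: differentiableM.
Qed.

Lemma differentiable_quadX a l z : differentiable (fun z => quad (z - a) ^+ l) z.
Proof.
elim: l => [|l IH]; first exact: differentiable_cst.
have -> : (fun z => quad (z - a) ^+ l.+1) = (fun z => quad (z - a) * quad (z - a) ^+ l).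
  by apply: funext => w; rewrite exprS.
by apply: differentiableM; [exact: differentiable_quad|exact: IH].
Qed.

Lemma quad_near z x e : 0 < e -> exists2 d, 0 < d &
  forall w y, (forall j, absC (w 0 j - z 0 j) < d) -> (forall j, `|y 0 j - x 0 j| < d) ->
    absC (quad (w - emb y) - quad (z - emb x)) < e.
Proof.
move=> e0; have e0' : 0 < mkC e 0 by rewrite mkC_gt0.
have c := @differentiable_continuous _ _ _ _ _ (differentiable_quad 0 (z - emb x)).
have /cvgrPdist_lt /(_ _ e0') /nbhs_rowC[d d0 hd] := c.
exists (d / 2) => [|w y hw hy]; first by rewrite divr_gt0.
have := hd (w - emb y); rewrite !subr0 distrC lt_normC; apply => j.
rewrite !mxE.
have -> : w 0 j - (y 0 j)%:C%C - (z 0 j - (x 0 j)%:C%C) =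
  (w 0 j - z 0 j) - mkC (y 0 j - x 0 j) 0 :> C.
  have -> : mkC (y 0 j - x 0 j) 0 = (y 0 j)%:C%C - (x 0 j)%:C%C :> C by rewrite -rmorphB.
  by ring.
apply: le_lt_trans (absCD _ _) _; rewrite absCN absC_mk0.
by have := hw j; have := hy j; lra.
Qed.

(* The real points of the isotropic cone with vertex [z]. *)
Definition trace z : set V := [set x | quad (z - emb x) = 0].

(** The real part of the equation puts x on the sphere with centre Re z and radius |Im z|. The
    constant is crude: n <= (2n)^2 avoids a square root of n. *)
Lemma trace_bounded z x : trace z x -> forall j, `|x 0 j| <= (2 * n%:R + 1) * rnorm z.
Proof.
move=> tx.
pose a : V := \row_j Re (z 0 j); pose b : V := \row_j Im (z 0 j).
have ReQ : Re (quad (z - emb x)) = sq (x - a) - sq b.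
  rewrite /quad /bilin /sq -sumrB (big_morph Re (@ReD R) (erefl : Re (0 : C) = 0)).
  by apply: eq_bigr => i _; rewrite !mxE ReM ReD ImD ReN ImN /=; ring.
move: ReQ; rewrite tx /= => /esym /eqP; rewrite subr_eq0 => /eqP E j.
have r0 := rnorm_ge0 z.
have sb : sq b <= n%:R * rnorm z ^+ 2.
  apply: (@le_trans _ _ (\sum_(i < n) rnorm z ^+ 2)); last first.
    by rewrite sumr_const card_ord mulr_natl.
  apply: ler_sum => i _; rewrite mxE -real_normK ?num_real//.
  rewrite lerXn2r ?nnegrE//.
  exact: le_trans (Im_le_absC _) (coord_le_rnorm _ _).
have n1 : n%:R <= (2 * n%:R) ^+ 2 :> R.
  case: (n) => [|l]; first by rewrite mulr0 expr0n.
  have : 1 <= l.+1%:R :> R by rewrite ler1n.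
  by move: (l.+1%:R) => N N1; nra.
have h1 : `|x 0 j - a 0 j| <= 2 * n%:R * rnorm z.
  rewrite -(@ler_pXn2r _ 2) ?nnegrE ?mulr_ge0// exprMn real_normK ?num_real//.
  have := sq_coord (x - a) j; rewrite !mxE => h; apply: (le_trans h).
  rewrite -/a E; apply: (le_trans sb).
  by rewrite ler_wpM2r ?sqr_ge0.
have h2 : `|a 0 j| <= rnorm z.
  rewrite mxE; exact: le_trans (Re_le_absC _) (coord_le_rnorm _ _).
have -> : x 0 j = (x 0 j - a 0 j) + a 0 j by rewrite subrK.
rewrite mulrDl mul1r; exact: le_trans (ler_normD _ _) (lerD h1 h2).
Qed.

Lemma trace_emb x : trace (emb x) = [set x].
Proof.
apply/seteqP; split=> y; rewrite /trace /= embB quad_emb.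
  by case=> /sq_eq0 /eqP; rewrite subr_eq0 => /eqP.
by move=> ->; rewrite subrr /sq big1// => i _; rewrite mxE expr0n.
Qed.

Lemma rnorm_near z : \forall w \near z, rnorm w <= rnorm z + 1.
Proof.
apply/nbhs_ballP; exists (mkC 1 0) => /=; first by rewrite mkC_gt0.
move=> w; rewrite mx_norm_ball /ball_ /= rnormE ltcE /= => /andP[_ h].
have := ler_normB z (z - w); rewrite subKr !rnormE mkCD lecE /= => /andP[_]; lra.
Qed.

(** Traces of points near z lie in one compact box. Each point of it either lies in O or has a
    nonzero quadric at z, a condition stable under small changes of both arguments; compactness
    makes it uniform. *)
Lemma trace_usc (O : set V) z : open O -> trace z `<=` O ->
  \forall w \near z, trace w `<=` O.
Proof.
move=> oO zO.
pose B := (2 * n%:R + 1) * (rnorm z + 1) + 1.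
have B0 : 0 < B.
  rewrite ltr_wpDl// mulr_ge0// addr_ge0 ?mulr_ge0 ?rnorm_ge0//.
have H : \forall w \near z, box B `<=` (fun x => trace w x -> O x).
  apply: ((compact_near_coveringP (box B)).1 (@compact_box R n B) W (nbhs z)
    (fun w x => trace w x -> O x)) => x _.
  have [Ox|nOx] := pselect (O x).
    exists (O, setT); first by split; [exact: open_nbhs_nbhs|exact: filterT].
    by move=> [y w] [/= Oy _].
  have q0 : 0 < absC (quad (z - emb x)).
    by rewrite absC_gt0; apply/eqP => q0; apply: nOx; exact: zO.
  have [d d0 hd] := quad_near z x q0.
  exists ([set y : V | forall j, `|y 0 j - x 0 j| < d], [set w : W | forall j, absC (w 0 j - z 0 j) < d]).
    by split; [apply/nbhs_rowR; exists d|apply/nbhs_rowC; exists d].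
  move=> [y w] [/= hy hw] ty; exfalso.
  by have := hd w y hw hy; rewrite ty sub0r absCN ltxx.
apply: filterS2 (rnorm_near z) H => w hw hB x tx; apply: hB => // j.
rewrite -ler_norml; apply: (le_trans (trace_bounded tx j)).
rewrite /B; apply: ler_wpDr => //; apply: ler_wpM2l => //.
Qed.

Lemma trace_compact z : compact (trace z).
Proof.
pose B := (2 * n%:R + 1) * rnorm z.
have B0 : 0 <= B by rewrite mulr_ge0 ?rnorm_ge0// addr_ge0 ?mulr_ge0.
have cl : closed (trace z).
  rewrite -openC openE => x /= /eqP; rewrite -absC_gt0 => q0.
  have [d d0 hd] := quad_near z x q0.
  apply/nbhs_rowR; exists d => // y hy ty.
  have := hd z y _ hy; rewrite ty sub0r absCN ltxx => h.
  by suff : false by []; apply: h => j; rewrite subrr absC0.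
apply: (@subclosed_compact _ _ (box B)) => //; first exact: compact_box.
by move=> x tx j; rewrite -ler_norml; exact: trace_bounded.
Qed.

End ComplexQuadric.

(** * Cut-off functions *)

Section Cutoffs.
Variables (R : realType) (n : nat) (U : set 'rV[R]_n).
Local Notation V := 'rV[R]_n.
Local Notation C2 := (Ck 2 [set: V]).
Implicit Types (x y : V) (phi : V -> R).

Definition is_cutoff phi := C2 phi /\ exists S : set V, [/\ closed S, S `<=` U,
  forall y, ~ S y -> phi y = 0 & exists r, forall y, S y -> forall i, `|y 0 i| < r].

(** The interior of the level set, since the derivatives of phi must vanish there as well. *)
Definition one_set phi : set V := [set x | \forall y \near x, phi y = 1].

Lemma open_one_set phi : open (one_set phi).
Proof. by rewrite openE => x /near_join. Qed.

Lemma one_setE phi x : one_set phi x -> phi x = 1.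
Proof. exact: nbhs_singleton. Qed.

Lemma cutoff0 : is_cutoff (fun=> 0).
Proof.
split; first exact: (Ck_cst 2 0 openT).
exists set0; split=> //; first exact: closed0.
by exists 0.
Qed.

(** This is 1 - (1 - phi) (1 - phi'): symmetric, and equal to 1 wherever one of the two is. It makes
    the family of cut-offs directed. *)
Definition cutoff_or phi phi' : V -> R := fun x => phi x + phi' x * (1 - phi x).

Lemma is_cutoff_or phi phi' : is_cutoff phi -> is_cutoff phi' -> is_cutoff (cutoff_or phi phi').
Proof.
move=> [c1 [S1 [cS1 SU1 S10 [r1 hr1]]]] [c2 [S2 [cS2 SU2 S20 [r2 hr2]]]]; split.
  have c3 := CkB openT (Ck_cst 2 1 openT) c1.
  exact: (CkD openT c1 (CkM openT c2 c3)).
exists (S1 `|` S2); split.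
- exact: closedU.
- by move=> x [/SU1|/SU2].
- move=> y nS; rewrite /cutoff_or S10 ?S20 ?mul0r ?addr0// => h; apply: nS; [by right|by left].
- exists (Num.max r1 r2) => y [/hr1|/hr2] h i; rewrite lt_max h ?orbT//.
Qed.

Lemma one_set_or phi phi' : one_set phi `|` one_set phi' `<=` one_set (cutoff_or phi phi').
Proof.
move=> x [h|h]; apply: filterS h => y h; rewrite /cutoff_or h.
  by rewrite subrr mulr0 addr0.
by rewrite mul1r addrC subrK.
Qed.

Hypothesis oU : open U.

Lemma cutoff_point x : U x -> exists2 phi, is_cutoff phi & one_set phi x.
Proof.
move=> Ux.
have [d d0 hd] : exists2 d : R, 0 < d & forall y : V, (forall j, `|y 0 j - x 0 j| < d) -> U y.
  by apply/nbhs_rowR; exact: open_nbhs_nbhs.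
(* The profile vanishes from f y = 2 on, that is |y - x|^2 = d^2 / 2 < d^2, so the support stays in
   [U]. *)
pose s := d ^+ 2 / 4; have s0 : 0 < s by rewrite divr_gt0 ?exprn_gt0.
pose f y := s^-1 * sq (y - x).
have cf : C2 f := CkZ s^-1 openT (@Ck_sq R n 2 setT x openT).
have contf : continuous f := @C2_continuous _ _ _ cf.
exists (fun y => theta (f y)).
  split; first exact: (Ck_theta openT cf).
  pose S := [set y | f y <= 2].
  have Sd y : S y -> forall j, `|y 0 j - x 0 j| < d.
    rewrite /S /f /= mulrC ler_pdivrMr// => h j.
    rewrite -(@ltr_pXn2r _ 2) ?nnegrE ?(ltW d0)// real_normK ?num_real//.
    have := sq_coord (y - x) j; rewrite !mxE => h1; apply: (le_lt_trans h1).
    apply: (le_lt_trans h); rewrite /s.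
    have := exprn_gt0 2 d0; lra.
  exists S; split.
  - apply: (@closed_comp _ _ f [set t | t <= 2]) => [y _|]; first exact: contf.
    exact: closed_le.
  - by move=> y /Sd /hd.
  - by move=> y; rewrite /S /= => /negP; rewrite -ltNge => /ltW; exact: theta0.
  - exists (\sum_i `|x 0 i| + d) => y /Sd h i.
    have := ler_normD (y 0 i - x 0 i) (x 0 i); rewrite subrK.
    have : `|x 0 i| <= \sum_j `|x 0 j| by rewrite (bigD1 i)//= lerDl sumr_ge0.
    by have := h i; lra.
have : \forall y \near x, f y < 1.
  apply: (@cvgr_lt _ _ (nbhs x) _ f (f x)); first exact: contf.
  rewrite /f subrr /sq big1 ?mulr0// => i _; by rewrite mxE expr0n.
by apply: filterS => y /ltW; exact: theta1.
Qed.

Lemma cutoff_compact (K : set V) : compact K -> K `<=` U ->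
  exists2 phi, is_cutoff phi & K `<=` one_set phi.
Proof.
move=> cK KU.
(* Properties that hold for all cut-offs with large enough [one_set]; [cutoff_or] gives stability
   under intersection. The covering form of compactness along this filter replaces a finite
   subcover. *)
pose F : set_system (V -> R) := [set P | exists2 phi, is_cutoff phi &
  forall psi, is_cutoff psi -> one_set phi `<=` one_set psi -> P psi].
have FF : Filter F.
  split.
  - by exists (fun=> 0) => //; exact: cutoff0.
  - move=> P Q [p1 cp1 h1] [p2 cp2 h2]; exists (cutoff_or p1 p2); first exact: is_cutoff_or.
    by move=> psi cpsi sub; split; [apply: h1|apply: h2] => // x hx; apply: sub;
      apply: one_set_or; [left|right].
  - by move=> P Q PQ [p cp h]; exists p => // psi c1 c2; apply: PQ; exact: h.
have [|p cp hp] := (compact_near_coveringP K).1 cK (V -> R) F (fun phi x => one_set phi x) FF.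
  move=> x /KU /cutoff_point[p cp px].
  exists (one_set p, [set psi | one_set p `<=` one_set psi]).
    split; first by apply: open_nbhs_nbhs; split=> //; exact: open_one_set.
    by exists p.
  by move=> [y psi] [/= py]; apply.
by exists p => //; exact: hp.
Qed.

Lemma one_set_sub phi : is_cutoff phi -> one_set phi `<=` U.
Proof.
move=> [_ [S [_ SU S0 _]]] x /one_setE px; apply: SU.
apply: contrapT => nS; move: px; rewrite S0// => /esym /eqP; by rewrite oner_eq0.
Qed.

(** Outside [U] the values of u are arbitrary, but there phi is 0: [U] and the complement of the
    closed set [S] cover the space, and the product is C^2 on each. *)
Lemma C2_cutoffM phi u : is_cutoff phi -> Ck 2 U u -> C2 (fun x => phi x * u x).
Proof.
move=> [cphi [S [cS SU S0 _]]] cu.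
have oS : open (~` S) by rewrite openC.
have c1 : Ck 2 U (fun x => phi x * u x).
  exact: (CkM oU (Ck_subset (@subsetT _ U) cphi) cu).
have c2 : Ck 2 (~` S) (fun x => phi x * u x).
  apply: (@Ck_eq _ _ 2 (~` S) (fun=> 0) _ oS); last exact: (Ck_cst 2 0 oS).
  by move=> x /S0 ->; rewrite mul0r.
apply: Ck_subset (CkU c1 c2) => x _.
by have [Sx|nSx] := pselect (S x); [left; exact: SU|right].
Qed.

End Cutoffs.

(** * Holomorphy of the potential *)

Section Potential.
Variables (R : realType) (n k : nat).
Hypotheses (k0 : (0 < k)%N) (nk : n = (2 * k.+1)%N).
Local Notation C := (Cplx R).
Local Notation Re := (@complex.Re R).
Local Notation Im := (@complex.Im R).
Local Notation V := 'rV[R]_n.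
Local Notation W := 'rV[C]_n.
Local Notation emb := (@real_part_embedding R n).
Implicit Types (z w v : W) (x y : V) (i j : 'I_n).

Lemma absC_nat l : absC (l%:R : C) = l%:R.
Proof.
have -> : l%:R = mkC l%:R 0 :> C by rewrite -(rmorph_nat (real_complex R)).
by rewrite absC_mk0 ger0_norm.
Qed.

Lemma continuousVC (h : V -> C) x : {for x, continuous h} <->
  forall e, 0 < e -> exists2 d, 0 < d &
    forall y, (forall j, `|y 0 j - x 0 j| < d) -> absC (h y - h x) < e.
Proof.
split=> [ch e e0|hh].
  have e0' : 0 < mkC e 0 by rewrite mkC_gt0.
  have /cvgrPdist_lt /(_ _ e0') /nbhs_rowR[d d0 hd] := ch.
  by exists d => // y /hd; rewrite distrC lt_normC.
apply: (iffRL (@cvgrPdist_lt _ _ _ (nbhs x) _ h (h x))) => e /ltC_gt0[e0 ->].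
have [d d0 hd] := hh _ e0; apply/nbhs_rowR; exists d => // y /hd.
by rewrite distrC lt_normC.
Qed.

Lemma continuous_Re_Im (h : V -> C) x : {for x, continuous h} ->
  {for x, continuous (fun y => Re (h y))} /\ {for x, continuous (fun y => Im (h y))}.
Proof.
move=> /continuousVC ch; split; apply/continuous_rowR => e e0; have [d d0 hd] := ch e e0;
  exists d => // y /hd; apply: le_lt_trans.
  by rewrite -ReN -ReD Re_le_absC.
by rewrite -ImN -ImD Im_le_absC.
Qed.

Variables (O : set V) (g : V -> R).
Hypotheses (oO : open O) (cg : continuous g) (gO : forall y, O y -> g y = 0).

(** Whatever h does on the open set O, including the default value of an inverse of 0, the weight g
    removes it. *)
Lemma admC_weight (h : V -> C) : (forall y, ~ O y -> {for y, continuous h}) ->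
  admC (fun f : V -> R => continuous f) (fun y => h y * mkC (g y) 0).
Proof.
move=> ch.
have key (f : V -> R) : (forall y, ~ O y -> {for y, continuous f}) ->
    continuous (fun y => f y * g y).
  move=> cf x; have [Ox|nOx] := pselect (O x); last first.
    by apply: continuousM; [exact: cf|exact: cg].
  apply: (@near_eq_continuous_rV _ _ (fun=> 0)); last exact: cst_continuous.
  have : \forall y \near x, O y by exact: open_nbhs_nbhs.
  by apply: filterS => y /gO ->; rewrite mulr0.
split.
  have -> : (fun y => Re (h y * mkC (g y) 0)) = (fun y => Re (h y) * g y).
    by apply: funext => y; rewrite ReM /= mulr0 subr0.
  by apply: key => y /ch /continuous_Re_Im[].
have -> : (fun y => Im (h y * mkC (g y) 0)) = (fun y => Im (h y) * g y).
  by apply: funext => y; rewrite ImM /= mulr0 add0r.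
by apply: key => y /ch /continuous_Re_Im[].
Qed.

Lemma continuous_quad z x : {for x, continuous (fun y => quad (z - emb y))}.
Proof.
apply/continuousVC => e e0; have [d d0 hd] := quad_near z x e0; exists d => // y hy.
by apply: hd => // j; rewrite subrr absC0.
Qed.

Lemma continuous_quadV l z x : quad (z - emb x) != 0 ->
  {for x, continuous (fun y => (quad (z - emb y))^-1 ^+ l)}.
Proof.
move=> q0.
have cV : {for x, continuous (fun y => (quad (z - emb y))^-1)}.
  by apply: continuousV => //; exact: continuous_quad.
elim: l => [|l IH]; first exact: cst_continuous.
have -> : (fun y => (quad (z - emb y))^-1 ^+ l.+1) =
    (fun y => (quad (z - emb y))^-1 * (quad (z - emb y))^-1 ^+ l).
  by apply: funext => y; rewrite exprS.
exact: (continuousM cV IH).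
Qed.

Variable M : R.
Hypothesis M0 : 0 < M.
Let ml := @I_mono_linear R n M M0.

Definition cbox_int (f : V -> C) : C := complexify (@box_int R n M) f.

Definition pot z : C := cbox_int (fun y => (quad (z - emb y))^-1 ^+ k * mkC (g y) 0).

Let nonzero z y : trace z `<=` O -> ~ O y -> quad (z - emb y) != 0.
Proof. by move=> zO nOy; apply/eqP => q0; apply: nOy; exact: zO. Qed.

Lemma adm_pot z : trace z `<=` O ->
  admC (fun f : V -> R => continuous f) (fun y => (quad (z - emb y))^-1 ^+ k * mkC (g y) 0).
Proof. by move=> zO; apply: admC_weight => y nOy; apply: continuous_quadV; exact: nonzero. Qed.

(** The partial derivative of the kernel with respect to the i-th coordinate of z. *)
Let coef z i y : C := (quad (z - emb y))^-1 ^+ k.+1 * (- 2 * k%:R * (z 0 i - mkC (y 0 i) 0)).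

Lemma continuous_linear_coord (c a : C) i x :
  {for x, continuous (fun y : V => c * (a - mkC (y 0 i) 0))}.
Proof.
apply/continuousVC => e e0.
have c1 : 0 < absC c + 1 by rewrite ltr_wpDl ?absC_ge0.
exists (e / (absC c + 1)) => [|y hy]; first by rewrite divr_gt0.
have -> : c * (a - mkC (y 0 i) 0) - c * (a - mkC (x 0 i) 0) =
    c * - (mkC (y 0 i) 0 - mkC (x 0 i) 0) by ring.
have -> : mkC (y 0 i) 0 - mkC (x 0 i) 0 = mkC (y 0 i - x 0 i) 0 :> C.
  by rewrite mkCN mkCD subrr.
rewrite absCM absCN absC_mk0.
have := hy i; rewrite ltr_pdivlMr// => h; apply: le_lt_trans h.
by rewrite mulrC ler_wpM2l// lerDl.
Qed.

Let continuous_coef z i y : trace z `<=` O -> ~ O y -> {for y, continuous (coef z i)}.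
Proof.
move=> zO nOy; have q0 := nonzero zO nOy.
exact: (continuousM (@continuous_quadV k.+1 z y q0)
  (@continuous_linear_coord (- 2 * k%:R) (z 0 i) i y)).
Qed.

Lemma adm_coef z i : trace z `<=` O ->
  admC (fun f : V -> R => continuous f) (fun y => coef z i y * mkC (g y) 0).
Proof. by move=> zO; apply: admC_weight => y nOy; exact: continuous_coef. Qed.

(** First-order Taylor formula for the power -l, with K depending only on l and the bound B of the
    inverses, which makes the later estimate uniform over the box. The induction is purely
    algebraic. *)
Lemma inv_taylor (B : R) l : 0 <= B -> exists2 K, 0 <= K & forall a b : C, a != 0 -> b != 0 ->
  absC a^-1 <= B -> absC b^-1 <= B ->
  absC (b^-1 ^+ l - a^-1 ^+ l + l%:R * a^-1 ^+ l.+1 * (b - a)) <= K * absC (b - a) ^+ 2.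
Proof.
move=> B0; elim: l => [|l [K K0 IH]].
  by exists 0 => // a b _ _ _ _; rewrite !expr0 subrr !mul0r addr0 absC0.
exists (B * K + absC l.+1%:R * B ^+ l.+2 * B).
  apply: addr_ge0; first exact: mulr_ge0.
  by apply: mulr_ge0 => //; apply: mulr_ge0; [exact: absC_ge0|exact: exprn_ge0].
move=> a b a0 b0 aB bB; have := IH a b a0 b0 aB bB.
set s := a^-1 in aB *; set t := b^-1 in bB *; set d := b - a.
(* The relation between the two inverses; modulo it the recursion for the remainder is a polynomial
   identity. *)
have tE : t - s + s * t * d = 0 by rewrite /t /s /d; field; rewrite a0 b0.
set Rl := (t ^+ l - s ^+ l + _) => hR.
have -> : t ^+ l.+1 - s ^+ l.+1 + l.+1%:R * s ^+ l.+2 * d =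
    t * Rl + l.+1%:R * s ^+ l.+2 * t * d ^+ 2.
  apply/eqP; rewrite -subr_eq0.
  have -> : t ^+ l.+1 - s ^+ l.+1 + l.+1%:R * s ^+ l.+2 * d -
      (t * Rl + l.+1%:R * s ^+ l.+2 * t * d ^+ 2) =
      - ((t - s + s * t * d) * s ^+ l * (l.+1%:R * s * d - 1)).
    by rewrite /Rl -natr1 !exprS expr0; ring.
  by rewrite tE !mul0r oppr0.
apply: (le_trans (absCD _ _)); rewrite mulrDl lerD//.
  rewrite absCM -mulrA ler_pM ?absC_ge0//.
have sB : absC (s ^+ l.+2) <= B ^+ l.+2.
  by rewrite absCX lerXn2r ?nnegrE ?absC_ge0.
rewrite (absCM _ (d ^+ 2)) absCX; apply: ler_wpM2r; first exact: sqr_ge0.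
rewrite (absCM _ t) (absCM _ (s ^+ l.+2)); apply: ler_pM => //.
- by apply: mulr_ge0; exact: absC_ge0.
- exact: absC_ge0.
- by apply: ler_wpM2l => //; exact: absC_ge0.
Qed.

Let rem z v y : C := (quad (v + z - emb y))^-1 ^+ k - (quad (z - emb y))^-1 ^+ k -
  \sum_i v 0 i * coef z i y.

(** Differentiability of the weighted kernel in z, uniform in y: around points of O the weight
    vanishes, around the others the remainder is quadratic in v. *)
Let rem_small z e : trace z `<=` O -> 0 < e ->
  \forall v \near (0 : W), box M `<=` (fun y => absC (rem z v y * mkC (g y) 0) <= e * rnorm v).
Proof.
move=> zO e0.
apply: ((compact_near_coveringP (box M)).1 (@compact_box R n M) W (nbhs (0 : W))
  (fun v y => absC (rem z v y * mkC (g y) 0) <= e * rnorm v)) => y0 _.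
have [Oy|nOy] := pselect (O y0).
  exists (O, setT); first by split; [exact: open_nbhs_nbhs|exact: filterT].
  move=> [y v] [/= /gO -> _].
  by rewrite absCM absC_mk0 normr0 mulr0 mulr_ge0 ?rnorm_ge0// ltW.
pose q := absC (quad (z - emb y0)).
have q0 : 0 < q by rewrite absC_gt0; exact: nonzero.
(* Staying within q / 2 of the value at (z, y0) bounds the inverses of the quadric by B = 2 / q. *)
have q2 : 0 < q / 2 by rewrite divr_gt0.
have [d1 d10 hd1] := quad_near z y0 q2.
have [d2 d20 hd2] := (continuous_rowR g y0).1 (@cg y0) 1 ltr01.
pose B := (q / 2)^-1; have B0 : 0 < B by rewrite invr_gt0.
have [K K0 hK] := @inv_taylor B k (ltW B0).
pose Z := rnorm (z - emb y0) + d1.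
have Z0 : 0 <= Z by rewrite addr_ge0 ?rnorm_ge0 ?(ltW d10).
pose N : R := n%:R.
have N0 : 0 <= N by [].
(* The first term is the Taylor remainder, with |b - a| <= (2 N Z + N) |v|; the second comes from
   the part [quad v] of b - a, which the linear term [coef] leaves out. *)
pose A := K * (2 * N * Z + N) ^+ 2 + k%:R * B ^+ k.+1 * N.
have A0 : 0 <= A.
  apply: addr_ge0; first by apply: mulr_ge0 => //; exact: sqr_ge0.
  by apply: mulr_ge0 => //; apply: mulr_ge0 => //; apply: exprn_ge0; exact: ltW.
pose G := `|g y0| + 1; have G0 : 0 <= G by rewrite addr_ge0.
pose d3 := Num.min d1 (Num.min 1 (e / (A * G + 1))).
have AG : 0 < A * G + 1 by rewrite ltr_wpDl ?mulr_ge0.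
have d30 : 0 < d3 by rewrite !lt_min d10 ltr01 divr_gt0.
exists ([set y : V | forall j, `|y 0 j - y0 0 j| < Num.min d1 d2],
        [set v : W | rnorm v < d3]).
  split; last exact: near0_rnorm.
  by apply/nbhs_rowR; exists (Num.min d1 d2) => //; rewrite lt_min d10.
move=> [y v] [/= hy hv].
have hy1 j : `|y 0 j - y0 0 j| < d1 by have := hy j; rewrite lt_min => /andP[].
have hy2 j : `|y 0 j - y0 0 j| < d2 by have := hy j; rewrite lt_min => /andP[].
have vd1 : rnorm v < d1 by apply: lt_le_trans hv _; rewrite ge_min lexx.
have v1 : rnorm v <= 1.
  by apply/ltW; apply: lt_le_trans hv _; rewrite !ge_min lexx orbT.
have ve : rnorm v * (A * G + 1) <= e.
  by rewrite -ler_pdivlMr//; apply/ltW; apply: lt_le_trans hv _; rewrite !ge_min lexx !orbT.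
pose w := z - emb y; pose a := quad w; pose b := quad (v + z - emb y).
have aq : absC (a - quad (z - emb y0)) < q / 2.
  by apply: hd1 => // j; rewrite subrr absC0.
have bq : absC (b - quad (z - emb y0)) < q / 2.
  apply: hd1 => // j; rewrite mxE addrK.
  exact: le_lt_trans (coord_le_rnorm _ _) vd1.
have big (c : C) : absC (c - quad (z - emb y0)) < q / 2 -> c != 0 /\ absC c^-1 <= B.
  move=> hc; have h := ler_absCB (quad (z - emb y0)) c.
  rewrite absCB in h; have cq : q / 2 <= absC c by rewrite -/q in h; lra.
  have c0 : 0 < absC c by lra.
  by split; [rewrite -absC_gt0|rewrite absCV lef_pV2].
have [a0 aB] := big a aq; have [b0 bB] := big b bq.
have bE : b - a = 2 * bilin w v + quad v.
  rewrite /b /a; have -> : v + z - emb y = w + v by rewrite /w -addrA addrC.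
  by rewrite quadD; ring.
have wZ j : absC (w 0 j) <= Z.
  have -> : w 0 j = (z - emb y0) 0 j - mkC (y 0 j - y0 0 j) 0.
    have -> : mkC (y 0 j - y0 0 j) 0 = (y 0 j)%:C%C - (y0 0 j)%:C%C :> C by rewrite -rmorphB.
    by rewrite !mxE; ring.
  apply: (le_trans (absCD _ _)); rewrite absCN absC_mk0 lerD ?coord_le_rnorm//.
  exact: ltW.
have h1 : absC (bilin w v) <= N * (Z * rnorm v).
  by apply: bilin_le => //; exact: coord_le_rnorm.
have h2 : absC (quad v) <= N * (rnorm v * rnorm v).
  by apply: bilin_le; exact: coord_le_rnorm.
have r0 := rnorm_ge0 v.
have hba : absC (b - a) <= (2 * N * Z + N) * rnorm v.
  rewrite bE; apply: (le_trans (absCD _ _)); rewrite [leRHS]mulrDl; apply: lerD.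
    by rewrite absCM absC_nat -!mulrA ler_wpM2l.
  apply: (le_trans h2); rewrite ler_wpM2l// -[leRHS]mul1r ler_wpM2r//.
have remE : rem z v y = (b^-1 ^+ k - a^-1 ^+ k + k%:R * a^-1 ^+ k.+1 * (b - a)) -
   k%:R * a^-1 ^+ k.+1 * quad v.
  rewrite /rem -/b -/w -/a.
  have -> : \sum_i v 0 i * coef z i y = - 2 * k%:R * a^-1 ^+ k.+1 * bilin w v.
    rewrite /bilin mulr_sumr; apply: eq_bigr => i _.
    rewrite /coef -/w -/a; have -> : w 0 i = z 0 i - mkC (y 0 i) 0 by rewrite !mxE.
    by ring.
  by rewrite bE; ring.
have hrem : absC (rem z v y) <= A * rnorm v * rnorm v.
  have -> : A * rnorm v * rnorm v = K * ((2 * N * Z + N) * rnorm v) ^+ 2 +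
    k%:R * B ^+ k.+1 * (N * (rnorm v * rnorm v)) by rewrite /A; ring.
  rewrite remE; apply: (le_trans (absCD _ _)); rewrite absCN; apply: lerD.
    apply: (le_trans (hK a b a0 b0 aB bB)).
    apply: ler_wpM2l => //; apply: lerXn2r => //; rewrite nnegrE ?absC_ge0//.
    exact: le_trans (absC_ge0 _) hba.
  rewrite (absCM _ (quad v)) (absCM k%:R) absC_nat absCX.
  apply: ler_pM => //; [by rewrite mulr_ge0 ?exprn_ge0 ?absC_ge0|exact: absC_ge0|].
  by apply: ler_wpM2l => //; rewrite lerXn2r ?nnegrE ?absC_ge0 ?(ltW B0).
have gG : `|g y| <= G.
  have := hd2 y hy2; have := ler_normD (g y - g y0) (g y0); rewrite subrK /G; lra.
rewrite absCM absC_mk0.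
apply: (@le_trans _ _ (A * rnorm v * rnorm v * G)).
  by rewrite ler_pM ?absC_ge0.
have -> : A * rnorm v * rnorm v * G = (rnorm v * (A * G)) * rnorm v by ring.
rewrite ler_wpM2r//; apply: le_trans ve; rewrite ler_wpM2l// lerDl//.
Qed.

(** Differentiation under the integral sign: the candidate derivative [lin] has the integrals of
    [coef] as coefficients, and once it is subtracted only the uniform remainder of [rem_small] is
    left. *)
Lemma pot_differentiable z : trace z `<=` O -> differentiable pot z.
Proof.
move=> zO.
pose l i : C := cbox_int (fun y => coef z i y * mkC (g y) 0).
pose lin (w : W) : C := \sum_i (w 0 i) * l i.
have dlin : differentiable lin z.
  have -> : lin = \sum_(i < n) (fun w : W => w 0 i * l i).
    by apply: funext => w; rewrite fct_sumE.
  apply: differentiable_sum => i; apply: differentiableM => //; exact: differentiable_coord.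
suff : differentiable (fun w => pot w - lin w) z.
  move=> d; have -> : pot = (fun w => (pot w - lin w) + lin w).
    by apply: funext => w; rewrite subrK.
  exact: differentiableD.
apply: differentiable_flat => e e0.
have I1 := I1_ge0 n M0.
(* The 2 compensates [absLC_le]; adding 1 to the volume keeps the denominator positive. *)
pose e' := e / (2 * (box_int M (fun _ : V => 1) + 1)).
have p1 : 0 < 2 * (box_int M (fun _ : V => 1) + 1) by lra.
have e'0 : 0 < e' by rewrite divr_gt0.
have H1 := rem_small zO e'0.
have H2 : \forall v \near (0 : W), trace (v + z) `<=` O.
  have /nbhs_rowC[r r0 hr] := trace_usc oO zO.
  apply/nbhs_rowC; exists r => // v hv; apply: hr => j.
  by have := hv j; rewrite !mxE subr0 addrK.
apply: filterS2 H1 H2 => v hv vO.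
have E : pot (v + z) - lin (v + z) - (pot z - lin z) =
    cbox_int (fun y => rem z v y * mkC (g y) 0).
  have a1 := adm_pot vO; have a2 := adm_pot zO.
  have sumE : forall s : seq 'I_n,
      admC (fun f : V -> R => continuous f) (fun y => (\sum_(i <- s) v 0 i * coef z i y) * mkC (g y) 0)
      /\ cbox_int (fun y => (\sum_(i <- s) v 0 i * coef z i y) * mkC (g y) 0) = \sum_(i <- s) v 0 i * l i.
    elim=> [|i s [IH1 IH2]].
      have -> : (fun y => (\sum_(i <- [::]) v 0 i * coef z i y) * mkC (g y) 0) =
          (fun y => 0 * ((quad (z - emb y))^-1 ^+ k * mkC (g y) 0)).
        by apply: funext => y; rewrite big_nil !mul0r.
      by split; [exact: (admCZ ml)|rewrite big_nil /cbox_int (LCZ ml)// mul0r].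
    have -> : (fun y => (\sum_(j <- i :: s) v 0 j * coef z j y) * mkC (g y) 0) =
        (fun y => v 0 i * (coef z i y * mkC (g y) 0) +
          (\sum_(j <- s) v 0 j * coef z j y) * mkC (g y) 0).
      by apply: funext => y; rewrite big_cons mulrDl mulrA.
    have a3 := admCZ ml (v 0 i) (adm_coef i zO).
    split; first exact: (admCD ml).
    rewrite big_cons /cbox_int (LCD ml a3 IH1); congr (_ + _); last exact: IH2.
    exact: (LCZ ml _ (adm_coef i zO)).
  have [a4 E4] := sumE (index_enum 'I_n).
  have -> : (fun y => rem z v y * mkC (g y) 0) = (fun y =>
      ((quad (v + z - emb y))^-1 ^+ k * mkC (g y) 0 - (quad (z - emb y))^-1 ^+ k * mkC (g y) 0)
      - (\sum_i v 0 i * coef z i y) * mkC (g y) 0).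
    by apply: funext => y; rewrite /rem !mulrBl.
  rewrite /cbox_int (LCB ml (admCB ml a1 a2) a4) (LCB ml a1 a2) -/(cbox_int _) -/(cbox_int _) -/(cbox_int _).
  rewrite E4 -/(pot _) -/(pot _).
  have -> : lin (v + z) = \sum_i v 0 i * l i + lin z.
    by rewrite /lin -big_split /=; apply: eq_bigr => i _; rewrite mxE mulrDl.
  have alg (p q t c : C) : p - (t + c) - (q - c) = p - q - t by ring.
  exact: alg.
rewrite E.
have admr : admC (fun f : V -> R => continuous f) (fun y => rem z v y * mkC (g y) 0).
  apply: admC_weight => y nOy.
  have q1 := @continuous_quadV k (v + z) y (nonzero vO nOy).
  have q2 := @continuous_quadV k z y (nonzero zO nOy).
  have q3 : {for y, continuous (fun y => \sum_i v 0 i * coef z i y)}.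
    have -> : (fun y => \sum_i v 0 i * coef z i y) = \sum_(i < n) (fun y => v 0 i * coef z i y).
      by apply: funext => x; rewrite fct_sumE.
    elim/big_ind : _ => [|f1 f2 h1 h2|i _]; first exact: cst_continuous.
      exact: (continuousD h1 h2).
    have cv : {for y, continuous (fun _ : V => v 0 i)} by exact: cst_continuous.
    exact: (continuousM cv (continuous_coef (i := i) zO nOy)).
  exact: (continuousB (continuousB q1 q2) q3).
have c1 : continuous (fun _ : V => 1 : R) by move=> x; exact: cst_continuous.
have c2 := @continuousZ_rV _ _ (e' * rnorm v) _ c1.
apply: (@le_trans _ _ (2 * box_int M (fun _ : V => e' * rnorm v * 1))).
  by apply: (absLC_le ml admr c2) => y by_; rewrite mulr1; exact: hv.
rewrite (ml_Z ml)// /e'.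
have -> : 2 * (e / (2 * (box_int M (fun _ : V => 1) + 1)) * rnorm v * box_int M (fun _ : V => 1)) =
    (e * rnorm v) * (box_int M (fun _ : V => 1) / (box_int M (fun _ : V => 1) + 1)).
  by field; lra.
rewrite ler_piMr ?mulr_ge0 ?rnorm_ge0 ?(ltW e0)//.
by rewrite ler_pdivrMr; lra.
Qed.

End Potential.

(** * The harmonic hull *)

Section Topology.
Variables (R : realType) (n : nat).
Local Notation C := (Cplx R).
Local Notation W := 'rV[C]_n.
Implicit Types (z w : W) (A : set W).

Definition polydisc z (r : R) : set W := [set w | forall j, absC (w 0 j - z 0 j) < r].

Lemma polydisc_center z r : 0 < r -> polydisc z r z.
Proof. by move=> r0 j; rewrite subrr absC0. Qed.

Lemma polydisc_connected z r : 0 < r -> connected (polydisc z r).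
Proof.
move=> r0.
pose seg w (t : R) : W := z + mkC t 0 *: (w - z).
have -> : polydisc z r = \bigcup_(w in polydisc z r) (seg w @` `[0, 1]%classic).
  apply/seteqP; split=> [w hw|w [v hv [t]]].
    exists w => //; exists 1; first by rewrite /= in_itv /= ler01 lexx.
    by rewrite /seg -[mkC 1 0]/(1 : C) scale1r addrC subrK.
  rewrite /= in_itv /= => /andP[t0 t1] <- j; rewrite !mxE addrAC subrr add0r absCM absC_mk0.
  rewrite ger0_norm//; apply: le_lt_trans (hv j).
  by rewrite ler_piMl ?absC_ge0.
apply: bigcup_connected.
  exists z => w hw; exists 0; first by rewrite /= in_itv /= lexx ler01.
  by rewrite /seg -[mkC 0 0]/(0 : C) scale0r addr0.
move=> w hw; apply: connected_continuous_connected; first exact: segment_connected.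
apply: continuous_subspaceT => t P /nbhs_rowC[e e0 he].
pose B := rnorm (w - z) + 1.
have B0 : 0 < B by rewrite ltr_wpDl ?rnorm_ge0.
apply/nbhs_ballP; exists (e / B) => /=; first by rewrite divr_gt0.
move=> s; rewrite /ball /= distrC ltr_pdivlMr// => hs; apply: he => j.
have segE u : seg w u 0 j = z 0 j + mkC u 0 * (w - z) 0 j by rewrite mxE [in X in _ + X]mxE.
have -> : seg w s 0 j - seg w t 0 j = mkC (s - t) 0 * (w - z) 0 j.
  have -> : mkC (s - t) 0 = mkC s 0 - mkC t 0 :> C by rewrite mkCN mkCD subrr.
  have alg (a b c d : C) : a + b * d - (a + c * d) = (b - c) * d by ring.
  exact: (etrans (congr2 (fun a b => a - b) (segE s) (segE t)) (alg _ _ _ _)).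
rewrite absCM absC_mk0; apply: le_lt_trans hs; apply: ler_wpM2l => //.
apply: (le_trans (coord_le_rnorm _ _)); by rewrite lerDl.
Qed.

Lemma open_polydisc A z : open A -> A z -> exists2 r, 0 < r & polydisc z r `<=` A.
Proof.
move=> oA Az; have /nbhs_rowC[r r0 hr] : nbhs z A by exact: open_nbhs_nbhs.
by exists r.
Qed.

Lemma component_open A z : open A -> open (connected_component A z).
Proof.
move=> oA; rewrite openE => w zw.
have Aw : A w := connected_component_sub zw.
have [r r0 hr] := open_polydisc oA Aw.
apply/nbhs_rowC; exists r => // v hv.
rewrite (same_connected_component zw).
have := @connected_component_max _ A _ w (@polydisc_center w r r0) hr (@polydisc_connected w r r0).
by apply.
Qed.

Lemma near_eq_differentiable_rV (f g : W -> C) z : (\forall w \near z, f w = g w) ->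
  differentiable f z -> differentiable g z.
Proof.
move=> fg df.
have -> : g = (fun w => (g w - f w) + f w) by apply: funext => w; rewrite subrK.
apply: differentiableD; last exact: df.
apply: differentiable_flat => e e0.
move/nbhs_rowC : (fg) => [r r0 hr].
apply/nbhs_rowC; exists r => // v hv.
rewrite hr => [|j]; last by have := hv j; rewrite !mxE subr0 addrK.
by rewrite (nbhs_singleton fg) !subrr absC0 mulr_ge0 ?rnorm_ge0// ltW.
Qed.

End Topology.

(** * Gluing the extensions, and maximality *)

Section Hull.
Variables (R : realType) (n k : nat).
Hypotheses (k0 : (0 < k)%N) (nk : n = (2 * k.+1)%N).
Local Notation C := (Cplx R).
Local Notation V := 'rV[R]_n.
Local Notation W := 'rV[C]_n.
Local Notation emb := (@real_part_embedding R n).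
Variables (U : set V) (x0 : V).
Hypotheses (oU : open U) (cU : connected U) (Ux0 : U x0).
Implicit Types (z w : W) (x y : V) (phi : V -> R) (O : set V).

Definition trace_in O : set W := [set z | trace z `<=` O].

Lemma open_trace_in O : open O -> open (trace_in O).
Proof. by move=> oO; rewrite openE => z zO; exact: trace_usc. Qed.

(** The cone relation read backwards: z lies on the cone of the real point x exactly when x lies in
    the trace of z. *)
Lemma cone_complementE : cone_complement U = trace_in U.
Proof.
apply/seteqP; split=> z h.
  by move=> x qx; apply: contrapT => nUx; apply: h; exists x.
by move=> [x nUx qx]; apply: nUx; exact: h.
Qed.

Lemma trace_in_emb O x : trace_in O (emb x) <-> O x.
Proof. by rewrite /trace_in /= trace_emb; split=> [|Ox y ->]; [apply|]. Qed.

Lemma emb_continuous : continuous emb.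
Proof.
move=> x P /nbhs_rowC[e e0 he]; apply/nbhs_rowR; exists e => // y hy; apply: he => j.
by rewrite !mxE -rmorphB; have := hy j; rewrite -absC_mk0.
Qed.

Lemma mkC_invX (a : R) l : ((mkC a 0 : C)^-1) ^+ l = mkC (a^-1 ^+ l) 0.
Proof.
have inv : (mkC a 0 : C)^-1 = mkC a^-1 0 by rewrite -[LHS]/((a%:C%C)^-1) -fmorphV.
elim: l => [|l IH]; first by rewrite !expr0.
by rewrite !exprS IH inv mkCM !mul0r !mulr0 subr0 addr0.
Qed.

Lemma extension_cutoff (u : V -> R) phi : real_harmonic U u -> is_cutoff U phi ->
  exists F : W -> C, (forall z, trace_in (one_set phi) z -> differentiable F z) /\
    forall x, one_set phi x -> F (emb x) = mkC (u x) 0.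
Proof.
move=> [c2u lu] cphi; have [cphi2 [S [cS SU S0 [r hr]]]] := cphi.
pose f x := phi x * u x.
have cf : Ck 2 [set: V] f := C2_cutoffM oU cphi c2u.
(* The bound r may be negative when [S] is empty. *)
pose r1 := `|r|; have r10 : 0 <= r1 := normr_ge0 r.
(* Room for f, supported within r1, to be translated by a point x within r1; the summand 2 makes the
   box large enough for the bump. *)
pose M := 2 * r1 + 2.
have M0 : 0 < M by rewrite /M; lra.
have M2 : 2 <= M by rewrite /M; lra.
have rM : r1 + r1 < M by rewrite /M; lra.
have vf i : vanish i r1 f.
  move=> x hx; rewrite /f S0 ?mul0r// => /hr /(_ i) h.
  by have := ler_norm r; rewrite -/r1; lra.
have cl : continuous (laplacian f) := @laplacian_continuous _ _ _ cf.
have lO y : one_set phi y -> laplacian f y = 0.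
  move=> hy; rewrite -(lu y); last exact: (one_set_sub cphi).
  apply: laplacian_near_eq; apply: filterS hy => t ht.
  by rewrite /f ht mul1r.
pose G := green_const n M k.
have G0 : G < 0 := green_const_lt0 M0 k0 nk M2.
exists (fun z => (mkC G 0)^-1 * pot k (laplacian f) M z); split.
  move=> z hz; apply: differentiableM; first exact: differentiable_cst.
  exact: (pot_differentiable k (@open_one_set _ _ phi) cl lO M0 hz).
move=> x hx.
have [d d0 hd] : exists2 d : R, 0 < d & forall y, sq (y - x) < d -> laplacian f y = 0.
  have /nbhs_rowR[d d0 hd] : nbhs x (one_set phi).
    by apply: open_nbhs_nbhs; split=> //; exact: open_one_set.
  exists (d ^+ 2); first by rewrite exprn_gt0.
  move=> y hy; apply/lO/hd => j.
  rewrite -(@ltr_pXn2r _ 2) ?nnegrE ?(ltW d0)// real_normK ?num_real//.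
  by apply: le_lt_trans hy; have := sq_coord (y - x) j; rewrite !mxE.
have xr i : `|x 0 i| <= r1.
  have Sx : S x.
    apply: contrapT => nS; have := one_setE hx; rewrite S0// => /esym /eqP.
    by rewrite oner_eq0.
  by have := hr x Sx i; have := ler_norm r; rewrite -/r1; lra.
have rep := green_representation M0 k0 nk M2 r10 vf cf xr rM d0 hd.
have -> : pot k (laplacian f) M (emb x) = mkC (G * f x) 0.
  rewrite /pot /cbox_int /complexify.
  have E y : (quad (emb x - emb y))^-1 ^+ k * mkC (laplacian f y) 0 =
      mkC (kern x 0 k y * laplacian f y) 0.
    rewrite embB quad_emb mkC_invX mkCM !mulr0 !mul0r subr0 addr0.
    by rewrite /kern addr0 -sqN opprB exprVn.
  congr mkC.
    by rewrite /G -rep; congr (box_int _ _); apply: funext => y; rewrite E.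
  have -> : (fun y => complex.Im ((quad (emb x - emb y))^-1 ^+ k * mkC (laplacian f y) 0)) =
      (fun y => 0 * laplacian f y).
    by apply: funext => y; rewrite E mul0r.
  by rewrite (ml_Z (I_mono_linear n M0))// mul0r.
have -> : f x = u x by rewrite /f (one_setE hx) mul1r.
have -> : mkC (G * u x) 0 = mkC G 0 * mkC (u x) 0 :> C.
  by rewrite mkCM !mulr0 !mul0r subr0 addr0.
rewrite mulrA mulVf ?mul1r//.
by apply/eqP => -[]; apply/eqP; rewrite lt_eqF.
Qed.

(** The component of one base point; [tildeE] identifies it with the union over all points of
    [U]. *)
Definition hull : set W := connected_component (trace_in U) (emb x0).

(** Connected, as the identity theorem requires; the pieces of all cut-offs equal to 1 near x0 share
    the point [emb x0]. *)
Definition piece phi : set W := connected_component (trace_in (one_set phi)) (emb x0).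

Let piece_index phi := is_cutoff U phi /\ one_set phi x0.

Lemma piece_open phi : open (piece phi).
Proof. by apply: component_open; apply: open_trace_in; exact: open_one_set. Qed.

Lemma piece_x0 phi : piece_index phi -> piece phi (emb x0).
Proof. by move=> [_ h]; apply: connected_component_refl; apply/trace_in_emb. Qed.

Lemma trace_inS O O' : O `<=` O' -> trace_in O `<=` trace_in O'.
Proof. by move=> OO z h x /h /OO. Qed.

Lemma index_or phi phi' : piece_index phi -> is_cutoff U phi' -> piece_index (cutoff_or phi phi').
Proof.
by move=> [c1 h1] c2; split; [exact: is_cutoff_or|apply: one_set_or; left].
Qed.

Lemma one_set_orl phi phi' : one_set phi `<=` one_set (cutoff_or phi phi').
Proof. by move=> x h; apply: one_set_or; left. Qed.

Lemma one_set_orr phi phi' : one_set phi' `<=` one_set (cutoff_or phi phi').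
Proof. by move=> x h; apply: one_set_or; right. Qed.

(** The union of the pieces is nonempty, open and closed in the connected set [hull]. *)
Lemma hull_pieces z : hull z -> exists phi, piece_index phi /\ piece phi z.
Proof.
pose Y := [set z | exists phi, piece_index phi /\ piece phi z].
suff YT : Y = hull by rewrite -YT.
have YsubT : Y `<=` hull.
  move=> {}z [phi [ip pz]]; move: z pz; apply: connected_component_max.
  - exact: piece_x0.
  - move=> z /connected_component_sub; apply: trace_inS.
    by case: ip => c _; exact: one_set_sub c.
  - exact: component_connected.
have oY : open Y.
  rewrite openE => {}z [phi [ip pz]].
  have : nbhs z (piece phi) by apply: open_nbhs_nbhs; split=> //; exact: piece_open.
  by apply: filterS => w pw; exists phi.
apply: (component_connected (A := trace_in U) (x := emb x0)).
- have [phi c h] := cutoff_point oU Ux0.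
  by exists (emb x0), phi; split=> //; exact: piece_x0.
- exists Y => //; apply/seteqP; split=> [w Yw|w []//]; split=> //; exact: YsubT.
- exists (closure Y); first exact: closed_closure.
  apply/seteqP; split=> [w Yw|w [Tw cYw]].
    by split; [exact: YsubT|exact: subset_closure].
  have Uw : trace w `<=` U := connected_component_sub Tw.
  (* The trace of a limit point w is compact, so one cut-off serves a whole polydisc around w. The
     polydisc meets some piece, and combining the two cut-offs attaches it to that piece. *)
  have [p1 c1 h1] := cutoff_compact oU (@trace_compact R n w) Uw.
  have [r r0 hr] := open_polydisc (open_trace_in (@open_one_set _ _ p1)) h1.
  have : nbhs w (polydisc w r) by apply/nbhs_rowC; exists r.
  move=> /cYw[p [[p2 [i2 pp]] pw]].
  exists (cutoff_or p2 p1); split; first exact: index_or.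
  have con : connected (piece p2 `|` polydisc w r).
    apply: connectedU; [by exists p|exact: component_connected|exact: polydisc_connected].
  apply: (connected_component_max _ _ con); [by left; exact: piece_x0| |].
    move=> v [/connected_component_sub|/hr]; apply: trace_inS.
      exact: one_set_orl.
    exact: one_set_orr.
  by right; exact: polydisc_center.
Qed.

Lemma emb_hull x : U x -> hull (emb x).
Proof.
move=> Ux.
have con : connected (emb @` U).
  apply: connected_continuous_connected => //.
  by apply: continuous_subspaceT; exact: emb_continuous.
apply: (connected_component_max _ _ con); [by exists x0| |by exists x].
by move=> _ [y Uy <-]; apply/trace_in_emb.
Qed.

Lemma hull_extension_real (u : V -> R) : real_harmonic U u ->
  exists F : W -> C, holomorphic_on hull F /\ forall x, U x -> F (emb x) = mkC (u x) 0.
Proof.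
move=> hu.
have /choice[Ff hF] : forall phi, exists F : W -> C, is_cutoff U phi ->
    (forall z, trace_in (one_set phi) z -> differentiable F z) /\
    forall x, one_set phi x -> F (emb x) = mkC (u x) 0.
  move=> phi; have [c|nc] := pselect (is_cutoff U phi); last by exists (fun=> 0).
  by have [F hF] := extension_cutoff hu c; exists F.
(* The comparison takes place on the connected set [piece p1], on whose real points both extensions
   equal u. *)
have agree_or p1 p2 z : piece_index p1 -> is_cutoff U p2 -> piece p1 z ->
    Ff p1 z = Ff (cutoff_or p1 p2) z.
  move=> i1 c2 pz; have [c1 _] := i1.
  have [c3 _] := index_or i1 c2.
  have [d1 v1] := hF _ c1; have [d3 v3] := hF _ c3.
  pose D := emb @^-1` (piece p1).
  have DO x : D x -> one_set p1 x by move=> /connected_component_sub /trace_in_emb.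
  apply/eqP; rewrite -subr_eq0; apply/eqP.
  apply: (@identity_rV R n (piece p1) D (fun z => Ff p1 z - Ff (cutoff_or p1 p2) z)).
  - exact: piece_open.
  - exact: component_connected.
  - by apply: open_comp; [move=> x _; exact: emb_continuous|exact: piece_open].
  - by exists x0; exact: piece_x0.
  - by move=> _ [x Dx <-].
  - move=> w /connected_component_sub pw; apply: differentiableB; first exact: d1.
    by apply: d3; apply: trace_inS pw; exact: one_set_orl.
  - move=> x Dx; rewrite v1; last exact: DO.
    by rewrite v3 ?subrr//; apply: one_set_orl; exact: DO.
  - exact: pz.
(* By symmetry the comparisons starting from p1 and from p2 end in the same function. *)
have cutoff_orC (p1 p2 : V -> R) : cutoff_or p1 p2 = cutoff_or p2 p1.
  by apply: funext => x; rewrite /cutoff_or; ring.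
have agree p1 p2 z : piece_index p1 -> piece_index p2 -> piece p1 z -> piece p2 z -> Ff p1 z = Ff p2 z.
  move=> i1 i2 pz1 pz2; have [c1 _] := i1; have [c2 _] := i2.
  by rewrite (agree_or p1 p2)// (agree_or p2 p1)// cutoff_orC.
(* The chosen cut-off may vary with the point, but by [agree] the glued function coincides near z
   with the single extension [Ff (ix z)]. *)
have /choice[ix hix] : forall z, exists phi, hull z -> piece_index phi /\ piece phi z.
  move=> z; have [/hull_pieces[phi h]|nh] := pselect (hull z); first by exists phi.
  by exists (fun=> 0).
exists (fun z => Ff (ix z) z); split=> [z hz|x Ux].
  have [i pz] := hix z hz; have [c _] := i; have [d _] := hF _ c.
  apply: (near_eq_differentiable_rV (f := Ff (ix z))).
    have : nbhs z (piece (ix z)) by apply: open_nbhs_nbhs; split=> //; exact: piece_open.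
    have : nbhs z hull.
      by apply: open_nbhs_nbhs; split=> //; apply: component_open; exact: open_trace_in.
    apply: filterS2 => w hw pw; have [i' pw'] := hix w hw; exact: agree.
  by apply: d; exact: connected_component_sub pz.
have [i pz] := hix _ (emb_hull Ux); have [c _] := i; have [_ v] := hF _ c.
by apply: v; apply/trace_in_emb; exact: connected_component_sub pz.
Qed.

Lemma hull_extension_domain : harmonic_extension_domain U hull.
Proof.
split.
- by apply: component_open; exact: open_trace_in.
- exact: component_connected.
- by move=> _ [x Ux <-]; exact: emb_hull.
- move=> u [hR hI].
  have [F1 [d1 v1]] := hull_extension_real hR.
  have [F2 [d2 v2]] := hull_extension_real hI.
  exists (fun z => F1 z + mkC 0 1 * F2 z); split=> [z hz|x Ux].
    apply: differentiableD; first exact: d1.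
    by apply: differentiableM; [exact: differentiable_cst|exact: d2].
  rewrite v1// v2//; apply: eqC; rewrite !(ReD,ImD,ReM,ImM) /=; ring.
Qed.

Lemma real_harmonic_kern a : ~ U a -> real_harmonic U (kern a 0 k).
Proof.
move=> nUa; have s0 y : U y -> sq (y - a) + 0 != 0.
  move=> Uy; rewrite addr0; apply/eqP => /sq_eq0 /eqP; rewrite subr_eq0 => /eqP ya.
  by apply: nUa; rewrite -ya.
split; first exact: (Ck_kern 2 k oU s0).
by move=> x /s0 sx; rewrite (laplacian_kern nk sx) mul0r mulr0.
Qed.

Lemma extension_domain_sub W' : harmonic_extension_domain U W' -> W' `<=` hull.
Proof.
move=> [oW cW UW ext].
apply: connected_component_max => //; first by apply: UW; exists x0.
move=> z Wz a qa; apply: contrapT => nUa.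
have hu : harmonic_on U (fun x => mkC (kern a 0 k x) 0).
  split; first exact: real_harmonic_kern.
  split; first exact: (Ck_cst 2 0 oU).
  by move=> x _; exact: laplacian_cst.
have [f [df fu]] := ext _ hu.
have : f z * quad (z - emb a) ^+ k - 1 = 0.
  apply: (@identity_rV R n W' U (fun z => f z * quad (z - emb a) ^+ k - 1)).
  - exact: oW.
  - exact: cW.
  - exact: oU.
  - by exists x0.
  - exact: UW.
  - move=> w Ww; apply: differentiableB; last exact: differentiable_cst.
    apply: differentiableM; first exact: df.
    exact: differentiable_quadX.
  - move=> x Ux; rewrite fu// embB quad_emb.
    have sx : sq (x - a) != 0.
      by apply/eqP => /sq_eq0 /eqP; rewrite subr_eq0 => /eqP xa; apply: nUa; rewrite -xa.
    have -> : mkC (kern a 0 k x) 0 = ((mkC (sq (x - a)) 0 : C)^-1) ^+ k.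
      by rewrite mkC_invX /kern addr0 exprVn.
    rewrite -exprMn mulVf ?expr1n ?subrr//.
    by apply/eqP => -[]; apply/eqP.
  - exact: Wz.
(* On the cone of a the identity reads -1 = 0, because the exponent k is positive. *)
rewrite qa expr0n eqn0Ngt k0 mulr0 sub0r => /eqP; rewrite oppr_eq0.
by rewrite oner_eq0.
Qed.

Lemma tildeE : tilde U = hull.
Proof.
rewrite /tilde cone_complementE; apply/seteqP; split=> [z [x Ux]|z hz]; last by exists x0.
by rewrite /hull (same_connected_component (emb_hull Ux)).
Qed.

End Hull.

Lemma tilde_is_harmonic_hull (R : realType) (n k : nat) (k0 : (0 < k)%N)
  (nk : n = (2 * k.+1)%N) (U : set 'rV[R]_n) (U_neq0 : U !=set0) (U_open : open U)
  (U_conn : connected U) : is_harmonic_hull U (tilde U).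
Proof.
have [x0 Ux0] := U_neq0; rewrite (tildeE U_conn Ux0); split.
  exact: (hull_extension_domain k0 nk U_open U_conn Ux0).
move=> W'; exact: (extension_domain_sub k0 nk U_open Ux0).
Qed.

Unset Implicit Arguments.

Theorem theorem0p3 (R : realType) (m : nat) (hm : (2 <= m)%N)
  (U : set 'rV[R]_(2 * m)) (U_neq0 : U !=set0) (U_open : open U)
  (U_conn : connected U) :
  (exists W, is_harmonic_hull U W) /\
  (forall W, is_harmonic_hull U W -> W = tilde U).
Proof.
(* With m = k + 1 the bound 2 <= m is 0 < k by computation, so [hm] serves as the positivity of the
   exponent. *)
case: m hm U U_neq0 U_open U_conn => [//|k] hm U U0 oU cU.
have [hd hmax] := @tilde_is_harmonic_hull R (2 * k.+1) k hm erefl U U0 oU cU.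
split=> [|W [Wd Wmax]]; first by exists (tilde U).
by apply/seteqP; split; [exact: hmax|exact: Wmax].
Qed.
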